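(* Let $G_n\to_{lwc}\mu$ and consider the independent set model with fugacity $\lambda>0$; write $\lambda_c=\lambda_{c,\mu}$. (a) Suppose $\lambda<\lambda_c$ and that for every $\lambda_0\in(0,\lambda)$, $\mu^\uparrow$-a.s. the function $\lambda'\mapsto h^{0,\lambda'}_{x\to y}(1)$ has total variation on $[\lambda_0,\lambda]$ bounded by a deterministic constant depending only on $\lambda_0,\lambda$. Then $\phi(\lambda)=\lim_n\phi_n(\lambda)$ exists and $$\phi(\lambda)=\Phi_\mu(\lambda,h^0)=\Phi_\mu(\lambda,h^1).\qquad(\ast)$$ If this hypothesis holds for every $\lambda<\lambda_c$ (with $\lambda_c<\infty$), then $\phi(\lambda_c)$ exists and $\phi(\lambda)\to\phi(\lambda_c)$ as $\lambda\uparrow\lambda_c$. (b) If there is a deterministic $\Delta$ with $\mathrm{br}\,T_{x\to y}\le\Delta-1$ $\mu^\uparrow$-a.s., then $(\ast)$ holds for every $\lambda<\lambda_c$ with $\lambda(\Delta-2)<1$. (c) If $\mu=\delta_{\mathbb T_d}$ (the $d$-regular tree), then $(\ast)$ holds for every $0<\lambda\le\lambda_c$.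
   Context: Graphs are undirected and locally finite; $\partial v$ = neighbours, $D_v=|\partial v|$, $B_t(v)$ = induced ball of radius $t$. $\mathcal T_*$ is the space of isomorphism classes of rooted locally finite trees $(T,o)$ with the local metric ($1/(1+R)$, $R$ largest radius of agreement of rooted balls); $T_t=B_t(o)$. A Borel probability measure $\mu$ on rooted graphs is unimodular if $\mathbb E_\mu[\sum_x f(G,o,x)]=\mathbb E_\mu[\sum_x f(G,x,o)]$ for all nonnegative Borel $f$ on doubly-rooted graphs. For random finite graphs $G_n=(V_n=[n],E_n)$ with $I_n$ uniform: ''$G_n\to_{lwc}\mu$'' means $(G_n)$ is uniformly sparse ($\lim_{L}\limsup_n\mathbb E_n[D_{I_n}\mathbf 1\{D_{I_n}\ge L\}]=0$), $B_t(I_n)\to T_t$ in law for each $t$ with $T\sim\mu$ a law on $\mathcal T_*$ (unimodular), and $\mu(D_o=0)<1$. For a directed edge $x\to y$ of $T$, $T_{x\to y}$ is the component containing $x$ of $T$ minus edge $(x,y)$, rooted at $x$; $\mu^\uparrow$ is the law of $(T,J\to o)$ with $T\sim\mu$ conditioned on $D_o\ge1$ and $J$ uniform on $\partial o$. Independent set model on finite $G=(V,E)$: $\nu_G(\vec\sigma)=Z_G(\lambda)^{-1}\prod_{(ij)\in E}\mathbf 1\{\sigma_i\sigma_j\ne1\}\prod_{i}\lambda^{\sigma_i}$, $\vec\sigma\in\{0,1\}^V$; so $\psi(\sigma,\sigma')=\mathbf 1\{\sigma\sigma'\ne1\}$, $\bar\psi(\sigma)=\lambda^\sigma$; $\phi_n(\lambda)=\frac1n\mathbb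 E_n\log Z_{G_n}(\lambda)$. Bethe functional: for a message $h$ (a map $(T,x\to y)\mapsto h_{x\to y}\in$ probability vectors on $\{0,1\}$), $\Phi_T(\lambda,h)=\log\{\sum_\sigma\bar\psi(\sigma)\prod_{j\in\partial o}\sum_{\sigma_j}\psi(\sigma,\sigma_j)h_{j\to o}(\sigma_j)\}-\frac12\sum_{j\in\partial o}\log\{\sum_{\sigma,\sigma_j}\psi(\sigma,\sigma_j)h_{j\to o}(\sigma_j)h_{o\to j}(\sigma)\}$ and $\Phi_\mu(\lambda,h)=\mathbb E_\mu\Phi_T(\lambda,h)$. Messages $h^0,h^1$: for $T\in\mathcal T_*$ and $\ddagger\in\{0,1\}$, $\bar h^{t,\ddagger,\lambda}_T$ is the law of $\sigma_o$ under the measure on $\{0,1\}^{V(T_t)}$ proportional to $\prod_{(ij)\in E(T_{t+1})}\mathbf 1\{\sigma_i\sigma_j\neq1\}\prod_{i\in T_t}\lambda^{\sigma_i}$ with $\sigma_v=\ddagger$ fixed for all $v$ at distance $t+1$ from $o$. $\bar h^\ddagger_T=\lim_{t\to\infty}\bar h^{2t-1,\ddagger}_T$ (this limit exists), and $h^{\ddagger,\lambda}_{x\to y}=\bar h^\ddagger_{T_{x\to y}}$. The uniqueness threshold is $\lambda_{c,\mu}=\inf\{\lambda\ge0:\mu^\uparrow(h^{0,\lambda}_{x\to y}=h^{1,\lambda}_{x\to y})<1\}$. The branching number of an infinite rooted tree is $\mathrm{br}\,T=\sup\{\gamma\ge1:\inf_\Pi\sum_{e\in\Pi}\gamma^{-|e|}>0\}$,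 where the infimum is over cutsets $\Pi$ (finite sets of edges separating $o$ from infinity) and $|e|$ is the distance from $o$ to the far endpoint of $e$; for finite $T$ set $\mathrm{br}\,T=0$. *)

(* Defs.v *)
From HB Require Import structures.
From mathcomp Require Import all_boot all_order all_algebra.
From mathcomp Require Import all_classical all_reals all_analysis.

Set Implicit Arguments.
Unset Strict Implicit.
Unset Printing Implicit Defensive.

Import Order.TTheory GRing.Theory Num.Theory.
Import numFieldNormedType.Exports.
Local Open Scope classical_set_scope.
Local Open Scope ring_scope.

(* Rooted locally finite trees, encoded as (Ulam-Harris) plane trees.  *)
(* A tree is given by its child-count function T : seq nat -> nat; the *)
(* node [:: i1; ...; ik] is the ik-th child of ... of the i1-th child  *)
(* of the root.  Every rooted locally finite tree is isomorphic to such*)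
(* a tree; all quantities below are isomorphism invariant.             *)
Definition ptree := seq nat -> nat.

Definition subt (i : nat) (T : ptree) : ptree := fun s => T (i :: s).

Definition remchild (j : nat) (T : ptree) : ptree := fun s =>
  match s with
  | [::] => (T [::]).-1
  | i :: s' => T ((if (i < j)%N then i else i.+1) :: s')
  end.

Fixpoint valid (T : ptree) (s : seq nat) : bool :=
  match s with
  | [::] => true
  | i :: s' => (i < T [::])%N && valid (subt i T) s'
  end.

Definition rdeg (T : ptree) : nat := T [::].

Definition regtree (d : nat) : ptree := fun s => if s is [::] then d else d.-1.

(* measurable structure: generated by the cylinder sets {T | T s = k}, *)
(* i.e. by the local topology                                          *)
Definition cylinders : set (set ptree) :=
  [set A | exists (s : seq nat) (k : nat), A = [set T | T s = k]].
Definition PT := g_sigma_algebraType cylinders.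

Definition tball (T : ptree) (t : nat) : set (seq nat) :=
  [set s | valid T s /\ (size s <= t)%N].
Definition tadj (s s' : seq nat) : Prop :=
  (exists i, s' = rcons s i) \/ (exists i, s = rcons s' i).
Definition tball_iso (T : ptree) (t : nat) (tau : ptree) : Prop :=
  exists f : seq nat -> seq nat,
    [/\ f [::] = [::],
        (forall s, tball T t s -> tball tau t (f s)),
        (forall s s', tball T t s -> tball T t s' -> f s = f s' -> s = s'),
        (forall s, tball tau t s -> exists2 u, tball T t u & f u = s) &
        (forall s s', tball T t s -> tball T t s' ->
                      (tadj s s' <-> tadj (f s) (f s')))].

Definition is_ray (T : ptree) (r : nat -> nat) : Prop :=
  forall k, valid T (mkseq r k).
(* a cutset: a finite set of edges (identified with their far endpoint,*)
(* a non-root node) separating o from infinity                         *)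
Definition cutset (T : ptree) (Pi : seq (seq nat)) : Prop :=
  [/\ uniq Pi, all (fun s => valid T s && (s != [::])) Pi &
      forall r, is_ray T r -> exists k, mkseq r k \in Pi].
Definition infinite_tree (T : ptree) : Prop :=
  ~ finite_set [set s | valid T s].

Section Real.
Variable R : realType.

Definition branching_number (T : ptree) : \bar R :=
  if `[< infinite_tree T >] then
    ereal_sup [set g%:E | g in [set g : R | 1 <= g /\
       0 < inf [set \sum_(s <- Pi) g ^- (size s) | Pi in cutset T]]]
  else 0%E.

Definition psi (a b : bool) : R := if a && b then 0 else 1.
Definition psibar (lam : R) (a : bool) : R := if a then lam else 1.

(* Zt lam dag t T a : partition function (unnormalised weight) of      *)
(* sigma_o = a for the measure on {0,1}^{V(T_t)} proportional to       *)
(*   prod_{(ij) in E(T_{t+1})} psi(s_i,s_j) prod_{i in T_t} lam^{s_i}  *)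
(* with boundary condition dag at distance t+1 (computed by the tree   *)
(* factorisation of the sum over configurations).                      *)
Fixpoint Zt (lam : R) (dag : bool) (t : nat) (T : ptree) (a : bool) : R :=
  match t with
  | 0 => psibar lam a * \prod_(c < T [::]) psi a dag
  | t'.+1 => psibar lam a *
      \prod_(c < T [::]) \sum_(b : bool) psi a b * Zt lam dag t' (subt c T) b
  end.

Definition hbar_t (lam : R) (dag : bool) (t : nat) (T : ptree) : R :=
  Zt lam dag t T true / (Zt lam dag t T false + Zt lam dag t T true).

Definition hbar (lam : R) (dag : bool) (T : ptree) : R :=
  limn (fun t => hbar_t lam dag t.*2.+1 T).

(* h^{dag,lam}_{x -> y}(1) = hbar lam dag (T_{x->y}) *)
Definition h0 (lam : R) : ptree -> R := hbar lam false.
Definition h1 (lam : R) : ptree -> R := hbar lam true.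

(* a message is represented by the map T_{x->y} |-> h_{x->y}(1) *)
Definition msg (p : R) (b : bool) : R := if b then p else 1 - p.

Definition PhiT (lam : R) (h : ptree -> R) (T : ptree) : R :=
  ln (\sum_(a : bool) psibar lam a *
        \prod_(j < T [::]) \sum_(b : bool) psi a b * msg (h (subt j T)) b)
  - 2^-1 * \sum_(j < T [::])
      ln (\sum_(a : bool) \sum_(b : bool)
            psi a b * msg (h (subt j T)) b * msg (h (remchild j T)) a).

Definition Phi_mu (mu : probability PT R) (lam : R) (h : ptree -> R) : \bar R :=
  (\int[mu]_(T in setT) (PhiT lam h T)%:E)%E.

(* mu^uparrow : law of T_{J -> o}, T ~ mu conditioned on D_o >= 1,    *)
(* J uniform on the neighbours of o                                    *)
Definition mu_up (mu : probability PT R) (A : set ptree) : \bar R :=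
  ((\int[mu]_(T in setT)
      (if (0 < rdeg T)%N then
         (rdeg T)%:R^-1 * \sum_(j < rdeg T) \1_A (subt j T) else 0)%:E)
   * ((fine (mu [set T : PT | (0 < rdeg T)%N]))^-1)%:E)%E.

Definition mu_up_ae (mu : probability PT R) (Q : ptree -> Prop) : Prop :=
  exists N : set PT, [/\ measurable N, mu_up mu N = 0%E &
                         [set T | ~ Q T] `<=` N].

Definition lam_c (mu : probability PT R) : \bar R :=
  ereal_inf [set l%:E | l in [set l : R | 0 <= l /\
      (mu_up mu [set T | h0 l T = h1 l T] < 1)%E]].

Definition graph (n : nat) := {ffun 'I_n * 'I_n -> bool}.
Definition simple n (g : graph n) : bool :=
  [forall u, forall v, (g (u, v) == g (v, u)) && ~~ g (u, u)].
Definition deg n (g : graph n) (v : 'I_n) : nat := #|[set w | g (v, w)]|.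
Fixpoint ball n (g : graph n) (t : nat) (v : 'I_n) : {set 'I_n} :=
  match t with
  | 0 => [set v]
  | t'.+1 => ball g t' v :|: [set w | [exists u in ball g t' v, g (u, w)]]
  end.
Definition gball_iso n (g : graph n) (v : 'I_n) (t : nat) (tau : ptree) : Prop :=
  exists f : 'I_n -> seq nat,
    [/\ f v = [::],
        (forall u, u \in ball g t v -> tball tau t (f u)),
        (forall u w, u \in ball g t v -> w \in ball g t v -> f u = f w -> u = w),
        (forall s, tball tau t s -> exists2 u, u \in ball g t v & f u = s) &
        (forall u w, u \in ball g t v -> w \in ball g t v ->
                     (g (u, w) <-> tadj (f u) (f w)))].

Definition indep n (g : graph n) (S : {set 'I_n}) : bool :=
  [forall u in S, forall w in S, ~~ g (u, w)].
Definition Zg n (lam : R) (g : graph n) : R :=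
  \sum_(S : {set 'I_n} | indep g S) lam ^+ #|S|.

(* P n : law (probability mass function) of the random graph G_n *)
Definition Egraph (P : forall n, graph n -> R) n (f : graph n -> R) : R :=
  \sum_(g : graph n) P n g * f g.

Definition phin (P : forall n, graph n -> R) (lam : R) (n : nat) : R :=
  n%:R^-1 * Egraph P (fun g : graph n => ln (Zg lam g)).

Definition Proot (P : forall n, graph n -> R) n (E : graph n -> 'I_n -> Prop) : R :=
  Egraph P (fun g : graph n => n%:R^-1 * \sum_(v : 'I_n) (if `[< E g v >] then 1 else 0)).

Definition tail_deg (P : forall n, graph n -> R) (L n : nat) : R :=
  Egraph P (fun g : graph n => n%:R^-1 *
    \sum_(v : 'I_n) (deg g v)%:R * ((L <= deg g v)%N)%:R).

Definition lwc (P : forall n, graph n -> R) (mu : probability PT R) : Prop :=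
  [/\ [/\ (forall n g, 0 <= P n g),
      (forall n, \sum_(g : graph n) P n g = 1) &
      (forall n g, P n g != 0 -> simple g)],
      ((fun L => limn_esup (fun n => (tail_deg P L n)%:E)) @ \oo --> 0%E),
      (* B_t(I_n) -> T_t in law: the law of a radius-t ball lives on a  *)
      (* countable discrete set, so this is convergence of the pmf      *)
      (forall (t : nat) (tau : ptree),
          ((fun n => Proot P (fun (g : graph n) v => gball_iso g v t tau)) @ \oo -->
          fine (mu [set T : PT | tball_iso T t tau]))) &
      (mu [set T : PT | rdeg T = 0%N] < 1)%E].

End Real.

(* Main.v *)
(** On a finite graph let [M] be the maximum of the Bethe free energy
    over vertex marginals [p] with [p u + p v <= 1] on edges.  Both [ln Z]
    and [M] are convex in [ln lam], with subgradients [\sum_v nu v] and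
    [\sum_v p v] respectively ([nu] the hard-core marginals, [p] a
    maximizer), and both lie between [0] and [n * lam].  The log-sum inequality
    shows that a maximizer is an interior fixed point of belief propagation,
    so that [M] is the sum of the vertex terms of the Bethe functional.

    Where a ball is a tree, [nu v] and [p v] are both squeezed between the tree
    messages with the two extreme boundary conditions.  If these agree almost
    surely at all fugacities up to [lam], the average of [|nu v - p v|] tends
    to [0] there; comparing the two convex functions along a fine subdivision
    in [ln lam], started at a small fugacity, gives [(ln Z - M) / n -> 0],
    while [M / n -> Phi_mu] by local convergence.  Uniqueness below the
    threshold is thus all that is used in (a) and (b).

    On a regular tree uniqueness persists at the threshold: the messages form a
    2-cycle of [f z = l / (1 + z) ^+ k], and Bernoulli's inequality shows
    that [ln (f (f z)) - ln z] is strictly decreasing as long as the slope of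
    [f] at its fixed point is at least [-1]; beyond that fugacity uniqueness
    fails. *)
Require Import Defs.
From HB Require Import structures.
From mathcomp Require Import all_boot all_order all_algebra.
From mathcomp Require Import all_classical all_reals all_analysis.
From mathcomp Require Import ring lra measurable_realfun.
Import Order.TTheory GRing.Theory Num.Theory.
Import numFieldNormedType.Exports.
Local Open Scope classical_set_scope.
Local Open Scope ring_scope.
Set Implicit Arguments.
Unset Strict Implicit.
Unset Printing Implicit Defensive.

(** * Messages on trees *)

(** Messages on the infinite tree may move irregularly with the fugacity, so the comparison takes
    place on each finite graph: there a maximum of functions affine in [ln lam] is convex however
    its maximizer moves. Any choice of maximizer will do, because the sandwich catches every fixed
    point. The sandwich rests on exactness: on a tree-like ball the deletion recursion for [nu] and
    the messages of the fixed point both satisfy the tree recursion without error, and only their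
    boundary values are unknown. Per vertex the slopes lie in [0, 1], so discretisation errors
    telescope to one step length, and starting at a fugacity of that size costs another. A second
    obstacle is that degrees are unbounded and only their first moment is controlled. Local
    functionals are therefore transferred under bounds linear in the degree, and an error bound that
    would be quadratic is truncated to stay in that class. *)

Section TreeRecursion.
Variables (R : realType) (lam : R).
Hypothesis lam_ge0 : 0 <= lam.
Implicit Types (T : ptree) (t : nat) (b : bool).

(* Upper ([b]) and lower ([~~ b]) bounds on the odds of occupation of the root
   given the first [t] levels; they alternate since the recursion is
   decreasing.  A childless root has odds exactly [lam]. *)
Fixpoint bd b t T : R :=
  match t with
  | 0 => if b || (T [::] == 0%N) then lam else 0
  | t'.+1 => lam * \prod_(c < T [::]) (1 + bd (~~ b) t' (subt c T))^-1
  end.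

(* [x] is the root value of some solution of the recursion on [t] levels, with
   arbitrary odds in [0, lam] at the boundary. *)
Fixpoint sand t T (x : R) : Prop :=
  match t with
  | 0 => 0 <= x <= lam /\ (T [::] = 0%N -> x = lam)
  | t'.+1 => exists y : nat -> R,
      (forall c, (c < T [::])%N -> sand t' (subt c T) (y c)) /\
      x = lam * \prod_(c < T [::]) (1 + y c)^-1
  end.

Lemma prod_inv1D_itv01 (I : finType) (y : I -> R) :
  (forall c, 0 <= y c) -> 0 <= \prod_c (1 + y c)^-1 <= 1.
Proof.
move=> y0; have h c : 0 <= (1 + y c)^-1 <= 1.
  by rewrite invr_ge0 addr_ge0//= invf_le1 ?ltr_wpDr// lerDl.
apply/andP; split; first by apply: prodr_ge0 => c _; case/andP: (h c).
by apply: Num.Theory.prodr_ile1 => c _; exact: h.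
Qed.

Lemma bd_itv b t T : 0 <= bd b t T <= lam.
Proof.
elim: t b T => [|t IH] b T /=; first by case: ifP => _; rewrite ?lexx ?lam_ge0.
have h : 0 <= \prod_(c < T [::]) (1 + bd (~~ b) t (subt c T))^-1 <= 1.
  by apply: prod_inv1D_itv01 => c; case/andP: (IH (~~ b) (subt c T)).
case/andP: h => h0 h1; apply/andP; split; first exact: mulr_ge0.
by rewrite -[leRHS]mulr1 ler_wpM2l.
Qed.

Lemma bd_ge0 b t T : 0 <= bd b t T.
Proof. by case/andP: (bd_itv b t T). Qed.

(** Each level of the recursion is decreasing in the odds of the children, so an upper bound below
    gives a lower bound above. A leaf must have odds [lam] in [sand], to match [bd] at level 0. *)
Lemma sand_bounds t T x : sand t T x -> bd false t T <= x <= bd true t T.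
Proof.
elim: t T x => [|t IH] T x /=.
  move=> [/andP[x0 xl] h]; rewrite xl andbT.
  by case: eqP => // /h ->.
move=> [y [hy ->]].
have y0 (c : 'I_(T [::])) : 0 <= y c.
  have /andP[h _] := IH _ _ (hy c (ltn_ord c)).
  exact: le_trans (bd_ge0 _ _ _) h.
have mono (u v : 'I_(T [::]) -> R) : (forall c, 0 <= u c <= v c) ->
    \prod_c (1 + v c)^-1 <= \prod_c (1 + u c)^-1.
  move=> uv; apply: ler_prod => c _; case/andP: (uv c) => u0 uv'.
  have v0 := le_trans u0 uv'.
  apply/andP; split; first by rewrite invr_ge0 addr_ge0.
  by rewrite lef_pV2 ?posrE ?ltr_wpDr// lerD2l.
apply/andP; split; apply: ler_wpM2l => //; apply: mono => c.
  by rewrite y0 /=; case/andP: (IH _ _ (hy c (ltn_ord c))).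
by rewrite bd_ge0 /=; case/andP: (IH _ _ (hy c (ltn_ord c))).
Qed.

(** A deeper extremal solution, cut at level [t], is a solution with some boundary values in [0,
    [lam]]. Monotonicity of [bd] in the depth then follows from [sand_bounds]. *)
Lemma sand_bd b t t' T : (t <= t')%N -> sand t T (bd b t' T).
Proof.
elim: t t' b T => [|t IH] t' b T /=.
  move=> _; split; first exact: bd_itv.
  move=> T0; case: t' => [|t'] /=; first by rewrite T0 orbT.
  by rewrite T0 big_ord0 mulr1.
case: t' => // t' tt'; exists (fun c => bd (~~ b) t' (subt c T)); split => //.
by move=> c _; apply: IH.
Qed.

Lemma bd_false_nd T t t' : (t <= t')%N -> bd false t T <= bd false t' T.
Proof. by move=> /(sand_bd false T) /sand_bounds/andP[]. Qed.

Lemma bd_true_ni T t t' : (t <= t')%N -> bd true t' T <= bd true t T.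
Proof. by move=> /(sand_bd true T) /sand_bounds/andP[]. Qed.

Lemma bd_false_le_true T t : bd false t T <= bd true t T.
Proof. by have /sand_bounds/andP[] := sand_bd true T (leqnn t). Qed.

(** The parity records the alternation: an occupied boundary empties the vertices next to it, which
    is the lower bound at [t = 0], and every further level swaps the two bounds. *)
Lemma Zt_bd dag t T : 0 < Zt lam dag t T false /\
  Zt lam dag t T true = bd (dag == odd t) t T * Zt lam dag t T false.
Proof.
elim: t T => [|t IH] T /=.
  rewrite /psibar /psi /= !big_const !iter_mulr_1 ?expr1n !mulr1 ?mul1r.
  split; first by rewrite ltr01.
  by case: dag => /=; rewrite card_ord; case: (T [::]) => [|m] /=; rewrite ?(expr0, exprS, expr1n, mul0r, mulr0, mulr1).
rewrite /psi /psibar mul1r; split.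
  apply: prodr_gt0 => c _; rewrite big_bool /= !mul1r.
  have [h0 h1] := IH (subt c T).
  by rewrite h1 ltr_wpDl// mulr_ge0 ?bd_ge0 ?ltW.
rewrite -mulrA -big_split /=; congr (_ * _); apply: eq_bigr => c _.
rewrite !big_bool /= !mul1r mul0r add0r.
have [h0 h1] := IH (subt c T).
have -> : dag == ~~ odd t = ~~ (dag == odd t) by case: (dag); case: (odd t).
rewrite negbK h1; set B := bd _ _ _; set z := Zt _ _ _ _ _.
have B1 : 1 + B != 0 by rewrite lt0r_neq0// ltr_wpDr// bd_ge0.
by rewrite -[X in B * z + X]mul1r -mulrDl [B + 1]addrC mulKf.
Qed.

Definition hb b t T : R := bd b t T / (1 + bd b t T).

Lemma hbar_t_hb dag t T : hbar_t lam dag t T = hb (dag == odd t) t T.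
Proof.
rewrite /hbar_t /hb; have [h0 ->] := Zt_bd dag t T.
set b := bd _ _ _; set z := Zt _ _ _ _ _ in h0 *.
rewrite -{2}[z]mul1r -mulrDl invfM mulrACA divff ?mulr1// gt_eqF//.
Qed.

Lemma inv1D_hb b t T : (1 + bd b t T)^-1 = 1 - hb b t T.
Proof.
have h := bd_ge0 b t T; rewrite /hb.
have h' : 1 + bd b t T != 0 by rewrite lt0r_neq0// ltr_wpDr.
by apply: (mulIf h'); rewrite mulVf// mulrBl mul1r divfK// addrK.
Qed.

Lemma hbS b t T : bd b t.+1 T = lam * \prod_(c < T [::]) (1 - hb (~~ b) t (subt c T)).
Proof. by rewrite /=; congr (_ * _); apply: eq_bigr => c _; rewrite inv1D_hb. Qed.

End TreeRecursion.

Section Odds.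
Variable R : realType.

Lemma ler_odds (x y : R) : 0 <= x -> x <= y -> x / (1 + x) <= y / (1 + y).
Proof.
move=> x0 xy; have y0 := le_trans x0 xy.
rewrite ler_pdivrMr ?ltr_wpDr// mulrAC ler_pdivlMr ?ltr_wpDr//.
by rewrite !mulrDr !mulr1 mulrC lerD2r.
Qed.

Lemma odds_itv (x : R) : 0 <= x -> 0 <= x / (1 + x) < 1.
Proof.
move=> x0; rewrite divr_ge0 ?addr_ge0//= ltr_pdivrMr ?ltr_wpDr// mul1r ltrDr//.
Qed.

End Odds.

Section HbLimits.
Variables (R : realType) (lam : R).
Hypothesis lam_ge0 : 0 <= lam.
Implicit Types (T : ptree) (t : nat) (b : bool).

Local Notation hb := (hb lam).
Local Notation bd := (bd lam).

Lemma hb_itv b t T : 0 <= hb b t T < 1.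
Proof. by apply: odds_itv; exact: bd_ge0. Qed.

Lemma hb_le_sup b t T : hb b t T <= lam / (1 + lam).
Proof. by apply: ler_odds; [exact: bd_ge0|case/andP: (bd_itv lam_ge0 b t T)]. Qed.

Lemma hb_false_nd T : nondecreasing_seq (fun t => hb false t T).
Proof. by move=> t t' tt'; apply: ler_odds; [exact: bd_ge0|exact: bd_false_nd]. Qed.

Lemma hb_true_ni T : nonincreasing_seq (fun t => hb true t T).
Proof. by move=> t t' tt'; apply: ler_odds; [exact: bd_ge0|exact: bd_true_ni]. Qed.

Lemma hb_false_le_true t T : hb false t T <= hb true t T.
Proof. by apply: ler_odds; [exact: bd_ge0|exact: bd_false_le_true]. Qed.

Lemma is_cvg_hb b T : cvgn (fun t => hb b t T).
Proof.
case: b.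
  apply: nonincreasing_is_cvgn; first exact: hb_true_ni.
  by exists 0 => _ [t _ <-]; case/andP: (hb_itv true t T).
apply: nondecreasing_is_cvgn; first exact: hb_false_nd.
by exists 1 => _ [t _ <-]; case/andP: (hb_itv false t T) => _ /ltW.
Qed.

(** [hbar] samples odd depths only, where the boundary condition [b] is exactly the bound [b]. As
    [hb b] is monotone in the depth, the limit along odd depths is the full limit. *)
Lemma cvg_hb b T : hb b t T @[t --> \oo] --> hbar lam b T.
Proof.
have -> : hbar lam b T = limn (fun t => hb b t T); last exact: is_cvg_hb.
rewrite /hbar.
have -> : (fun t => hbar_t lam b t.*2.+1 T) = (fun t => hb b t T) \o (fun t => t.*2.+1).
  apply/funext => t /=; rewrite hbar_t_hb //= odd_double /=.
  by congr hb; case: b.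
apply/cvg_lim => //; apply: (cvg_comp _ _ _ (@is_cvg_hb b T)).
move=> A [N _ NA]; exists N => // k /= Nk; apply: NA => /=.
by rewrite (leq_trans Nk)// -addnn -addnS leq_addr.
Qed.

Lemma hbar_itv b T : 0 <= hbar lam b T <= lam / (1 + lam).
Proof.
rewrite -(cvg_lim _ (@cvg_hb b T)) //; apply/andP; split.
  by apply: limr_ge; [exact: is_cvg_hb|apply: nearW => t; case/andP: (hb_itv b t T)].
by apply: limr_le; [exact: is_cvg_hb|apply: nearW => t; exact: hb_le_sup].
Qed.

Lemma hbar_lt1 b T : hbar lam b T < 1.
Proof.
case/andP: (hbar_itv b T) => _ /le_lt_trans; apply.
by case/andP: (odds_itv lam_ge0).
Qed.

Lemma hbar_le T : hbar lam false T <= hbar lam true T.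
Proof.
rewrite -(cvg_lim _ (@cvg_hb false T)) // -(cvg_lim _ (@cvg_hb true T)) //.
apply: ler_lim; [exact: is_cvg_hb|exact: is_cvg_hb|].
by apply: nearW => t; exact: hb_false_le_true.
Qed.

(** The limit messages satisfy the recursion with the boundary condition swapped, so on a
    homogeneous tree they form a 2-cycle and not necessarily a fixed point. *)
Lemma hbar_rec b T : hbar lam b T =
  (fun x => x / (1 + x)) (lam * \prod_(c < T [::]) (1 - hbar lam (~~ b) (subt c T))).
Proof.
set x := lam * _.
have x0 : 0 <= x.
  apply: mulr_ge0 => //; apply: prodr_ge0 => c _.
  by rewrite subr_ge0 ltW// hbar_lt1.
have h : bd b t.+1 T @[t --> \oo] --> x.
  under eq_fun do rewrite hbS//.
  apply: cvgMr; apply: cvg_big => [|c _]; first exact: mul_continuous.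
  by apply: cvgB; [exact: cvg_cst|exact: cvg_hb].
have h' : hb b t.+1 T @[t --> \oo] --> x / (1 + x).
  apply: cvgM => //; apply: cvgV; first by rewrite gt_eqF// ltr_wpDr.
  by apply: cvgD => //; exact: cvg_cst.
rewrite -(cvg_lim _ h') //; apply/esym/cvg_lim => //.
by rewrite (cvg_shiftS (fun t => hb b t T)); exact: cvg_hb.
Qed.

End HbLimits.

(** * Hard-core model on a finite graph *)

Section HardCore.
Variables (R : realType) (n : nat) (g : graph n).
Hypothesis gs : simple g.
Implicit Types (A S : {set 'I_n}) (u v w : 'I_n) (lam : R).

Lemma simple_sym u v : g (u, v) = g (v, u).
Proof. by move/forallP: gs => /(_ u)/forallP/(_ v)/andP[/eqP]. Qed.

Lemma simple_irr u : g (u, u) = false.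
Proof. by move/forallP: gs => /(_ u)/forallP/(_ u)/andP[_ /negbTE]. Qed.

Definition nbrs v : {set 'I_n} := [set w | g (v, w)].
Definition cnbrs v : {set 'I_n} := v |: nbrs v.

(** Partition function of the subgraph induced on [A]; deleting vertices changes the set [A] and
    leaves the graph and its type fixed. *)
Definition ZA lam A : R := \sum_(S : {set 'I_n} | indep g S && (S \subset A)) lam ^+ #|S|.

Lemma Zg_ZA lam : Zg lam g = ZA lam finset.setT.
Proof. by apply: eq_bigl => S; rewrite finset.subsetT andbT. Qed.

Lemma indep_sub S (S' : {set 'I_n}) : S \subset S' -> indep g S' -> indep g S.
Proof.
move=> /fintype.subsetP sub /forallP h; apply/forallP => u; apply/implyP => uS.
apply/forallP => w; apply/implyP => wS.
by move: (h u); rewrite (sub _ uS) /= => /forallP/(_ w); rewrite (sub _ wS).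
Qed.

Lemma indepU1 S v : v \notin S ->
  indep g (v |: S) = indep g S && [disjoint S & nbrs v].
Proof.
move=> vS; apply/idP/andP => [h|[h d]].
  split; first by apply: indep_sub h; exact: finset.subsetUr.
  apply/pred0P => w /=; apply/negbTE/negP => /andP[wS]; rewrite inE => gvw.
  move/forallP: h => /(_ v); rewrite finset.setU11 /= => /forallP/(_ w).
  by rewrite finset.setU1r// gvw.
have nv w : w \in S -> g (v, w) = false.
  move=> wS; apply/negbTE/negP => gvw; move/pred0P: d => /(_ w) /=.
  by rewrite wS inE gvw.
apply/forallP => u; apply/implyP; rewrite finset.in_setU1 => /orP[/eqP ->|uS];
  apply/forallP => w; apply/implyP; rewrite finset.in_setU1 => /orP[/eqP ->|wS].
- by rewrite simple_irr.
- by rewrite nv.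
- by rewrite simple_sym nv.
- by move/forallP: h => /(_ u); rewrite uS => /forallP/(_ w); rewrite wS.
Qed.

Lemma ZA_in lam A v : v \in A ->
  \sum_(S : {set 'I_n} | indep g S && (S \subset A) && (v \in S)) lam ^+ #|S| =
  lam * ZA lam (A :\: cnbrs v).
Proof.
move=> vA; rewrite /ZA big_distrr /=.
(* Independent sets containing [v] correspond to independent sets avoiding the closed neighbourhood
   of [v]. *)
rewrite (reindex_onto (fun S => v |: S) (fun S => S :\ v)) /=; last first.
  by move=> S /andP[_ vS]; rewrite finset.setD1K.
apply: eq_big => [S|S].
  rewrite finset.setU11 andbT; case: (boolP (v \in S)) => vS.
    have -> : (v |: S) :\ v == S = false.
      by apply/negbTE/eqP => h; move: vS; rewrite -h finset.setD11.
    rewrite andbF; apply/esym/negbTE/nandP; right; apply/subsetPn; exists v => //.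
    by rewrite !inE eqxx.
  rewrite finset.setU1K// eqxx andbT indepU1// finset.subUset finset.sub1set vA /= -andbA; congr andb.
  rewrite finset.subsetD andbC; congr andb; apply/pred0P/pred0P => h w /=.
    by rewrite !inE; case: eqP => [->|_]; [rewrite (negbTE vS)|have := h w; rewrite /= inE].
  by have := h w; rewrite /= !inE; case: (w \in S) => //=; case: (w == v).
move=> /andP[/andP[/andP[h _] _] /eqP e].
have vS : v \notin S by rewrite -e finset.setD11.
by rewrite finset.cardsU1 vS exprS.
Qed.

Lemma ZA_rec lam A v : v \in A ->
  ZA lam A = ZA lam (A :\ v) + lam * ZA lam (A :\: cnbrs v).
Proof.
move=> vA; rewrite -ZA_in// {1}/ZA (bigID (fun S => v \in S)) /= addrC; congr (_ + _).
apply: eq_bigl => S; rewrite -andbA; congr andb.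
by rewrite finset.subsetD1.
Qed.

Lemma ZA_ge1 lam A : 0 <= lam -> 1 <= ZA lam A.
Proof.
move=> l0; rewrite /ZA (bigD1 (finset.set0 : {set 'I_n})) /=; last first.
  by rewrite finset.sub0set andbT; apply/forallP => u; rewrite inE.
by rewrite finset.cards0 expr0 lerDl sumr_ge0// => S _; rewrite exprn_ge0.
Qed.

Lemma ZA_gt0 lam A : 0 <= lam -> 0 < ZA lam A.
Proof. by move=> l0; apply: lt_le_trans (ZA_ge1 A l0). Qed.

Lemma ZA_mono lam A (B : {set 'I_n}) : 0 <= lam -> A \subset B -> ZA lam A <= ZA lam B.
Proof.
move=> l0 AB; rewrite [leRHS](bigID (fun S : {set 'I_n} => S \subset A)) /=.
rewrite -[leLHS]addr0 lerD//; last by apply: sumr_ge0 => S _; rewrite exprn_ge0.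
rewrite le_eqVlt; apply/orP; left; apply/eqP; apply: eq_bigl => S.
rewrite -andbA; congr andb; case: (boolP (S \subset A)) => h; rewrite ?andbF//.
by rewrite (fintype.subset_trans h AB).
Qed.

Lemma ZA_le lam A : 0 <= lam -> ZA lam A <= (1 + lam) ^+ #|A|.
Proof.
move=> l0; have [k] := ubnP #|A|; elim: k A => // k IH A.
case: (finset.set_0Vmem A) => [->|[v vA]].
  rewrite finset.cards0 expr0 => _; rewrite /ZA (big_pred1 finset.set0) ?finset.cards0 ?expr0// => S /=.
  rewrite finset.subset0; case: eqP => [->|]; rewrite ?andbF// andbT.
  by apply/forallP => u; rewrite inE.
rewrite (finset.cardsD1 v A) vA /= add1n ltnS => kA; rewrite exprS (ZA_rec _ vA) mulrDl mul1r.
apply: lerD; first exact: IH.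
apply: ler_wpM2l => //; apply: le_trans (IH _ kA).
apply: ZA_mono => //; apply/fintype.subsetP => w; rewrite !inE negb_or -andbA.
by case/and3P => -> _ ->.
Qed.

(* Odds of occupation of [v] in the hard-core model on [v |: A]. *)
Definition RA lam A v : R := lam * ZA lam (A :\: cnbrs v) / ZA lam (A :\ v).

Lemma RA_ge0 lam A v : 0 <= lam -> 0 <= RA lam A v.
Proof. by move=> l0; rewrite divr_ge0 ?mulr_ge0// ltW// ZA_gt0. Qed.

Lemma RA_le lam A v : 0 <= lam -> RA lam A v <= lam.
Proof.
move=> l0; rewrite ler_pdivrMr ?ZA_gt0// ler_wpM2l// ZA_mono//.
apply/fintype.subsetP => w; rewrite !inE negb_or -andbA.
by case/and3P => -> _ ->.
Qed.

(** Both sides are the probability that [v] is vacant in the model on [A]. *)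
Lemma ZA_ratio lam A v : 0 <= lam -> v \in A ->
  ZA lam (A :\ v) / ZA lam A = (1 + RA lam A v)^-1.
Proof.
move=> l0 vA; rewrite -[LHS]invf_div; congr (_^-1).
by rewrite (ZA_rec lam vA) mulrDl divff// gt_eqF// ZA_gt0.
Qed.

(* Successive deletion of the neighbours [un 0, un 1, ...] of [v] makes the
   partition function ratio in [RA] telescope. *)
Definition delnbrs A v (un : nat -> 'I_n) i : {set 'I_n} :=
  [set w in A :\ v | all (fun j => w != un j) (iota 0 i)].

Lemma delnbrsS A v (un : nat -> 'I_n) i : delnbrs A v un i.+1 = delnbrs A v un i :\ un i.
Proof.
apply/finset.setP => w; rewrite !inE -addn1 iotaD all_cat /= andbT add0n.
by rewrite andbA andbC.
Qed.

(** The self-avoiding-walk form of the tree recursion: each neighbour is evaluated after deleting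
    [v] and the earlier neighbours. On a tree-like ball these deletions do not touch the subtree
    below the neighbour. *)
Lemma RA_rec lam A v (un : nat -> 'I_n) d : 0 <= lam ->
  (forall i j, (i < d)%N -> (j < d)%N -> un i = un j -> i = j) ->
  (forall w, w \in A -> g (v, w) <-> exists2 i, (i < d)%N & w = un i) ->
  (forall i, (i < d)%N -> un i \in A) ->
  RA lam A v = lam * \prod_(i < d) (1 + RA lam (delnbrs A v un i) (un i))^-1.
Proof.
move=> l0 uinj hN uA; rewrite /RA -mulrA; congr (_ * _).
have -> : A :\: cnbrs v = delnbrs A v un d.
  apply/finset.setP => w; rewrite !inE.
  case: (boolP (w \in A)) => wA; rewrite ?andbF//= !andbT.
  case: (boolP (w == v)) => //= wv.
  apply/idP/allP => [gvw j|h].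
    rewrite mem_iota add0n => /= jd; apply: contraNneq gvw => wj.
    by apply/(hN _ wA); exists j.
  apply/negP => /(hN _ wA)[i id wi].
  by have := h i; rewrite mem_iota wi eqxx => /(_ id).
have -> : A :\ v = delnbrs A v un 0.
  by apply/finset.setP => w; rewrite !inE andbT.
have gvu i : (i < d)%N -> g (v, un i).
  by move=> id; apply/hN; [exact: uA|exists i].
(* Each deletion multiplies the ratio by the probability that the deleted neighbour is vacant. *)
have: forall k, (k <= d)%N -> ZA lam (delnbrs A v un k) / ZA lam (delnbrs A v un 0) =
    \prod_(i < k) (1 + RA lam (delnbrs A v un i) (un i))^-1.
  elim=> [_|k IH kd]; first by rewrite big_ord0 divff// gt_eqF// ZA_gt0.
  rewrite big_ord_recr /= -IH ?(ltnW kd)// delnbrsS -ZA_ratio//; last first.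
    rewrite !inE uA// andbT; apply/andP; split.
      by apply: contraTneq (gvu _ kd) => ->; rewrite simple_irr.
    apply/allP => j; rewrite mem_iota add0n /= => jk; apply/eqP => /uinj h.
    by have e := h kd (ltn_trans jk kd); rewrite e ltnn in jk.
  by rewrite [RHS]mulrC mulrA divfK// gt_eqF// ZA_gt0.
by move=> /(_ d (leqnn d)).
Qed.

Definition nu lam v : R := RA lam finset.setT v / (1 + RA lam finset.setT v).

Lemma nu_ZA lam v : 0 <= lam -> nu lam v = lam * ZA lam (finset.setT :\: cnbrs v) / ZA lam finset.setT.
Proof.
move=> l0; rewrite /nu -ZA_ratio ?inE// /RA mulrA divfK// gt_eqF// ZA_gt0//.
Qed.

Lemma nu_itv lam v : 0 <= lam -> 0 <= nu lam v <= 1.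
Proof.
by move=> l0; have /andP[-> /ltW ->] := odds_itv (RA_ge0 finset.setT v l0).
Qed.

(** Double counting of pairs of a vertex and an independent set containing it; the right side is the
    mean size of a random independent set. *)
Lemma sum_nu lam : 0 <= lam -> \sum_v nu lam v =
  \sum_(S : {set 'I_n} | indep g S) #|S|%:R * lam ^+ #|S| / Zg lam g.
Proof.
move=> l0; rewrite Zg_ZA -mulr_suml.
under eq_bigr do rewrite nu_ZA// -ZA_in ?inE//.
rewrite -mulr_suml; congr (_ / _).
under eq_bigr do under eq_bigl do rewrite finset.subsetT andbT.
under eq_bigr do rewrite big_mkcondr /=.
rewrite exchange_big /=; apply: eq_bigr => S _.
by rewrite -big_mkcond /= sumr_const mulr_natl.
Qed.

(** Jensen's inequality: [Zg lam' g / Zg lam g] is the mean of [(lam' / lam) ^+ #|S|] under the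
    hard-core measure at [lam]. *)
Lemma lnZ_subgradient lam lam' : 0 < lam -> 0 < lam' ->
  ln (Zg lam g) + (ln lam' - ln lam) * \sum_v nu lam v <= ln (Zg lam' g).
Proof.
move=> l0 l0'; rewrite (sum_nu (ltW l0)).
have Z0 : 0 < Zg lam g by rewrite Zg_ZA ZA_gt0 ?ltW.
have Z0' : 0 < Zg lam' g by rewrite Zg_ZA ZA_gt0 ?ltW.
pose a := Zg lam' g / Zg lam g.
have a0 : 0 < a by rewrite divr_gt0.
rewrite -lerBrDl -ln_div ?posrE// -ln_div ?posrE// -/a mulr_sumr.
(* The tangent line of [ln] at the mean [a], averaged under the hard-core measure, has value [ln a];
   it lies above [ln] pointwise. *)
have E : \sum_(S : {set 'I_n} | indep g S)
   (lam ^+ #|S| / Zg lam g) * ((lam' / lam) ^+ #|S| / a - 1 + ln a) = ln a.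
  under eq_bigr do rewrite mulrDr mulrBr mulr1.
  rewrite big_split /= sumrB.
  have -> : \sum_(i : {set 'I_n} | indep g i) lam ^+ #|i| / Zg lam g = 1.
    by rewrite -mulr_suml divff// gt_eqF.
  rewrite -!mulr_suml divff ?gt_eqF// mul1r.
  rewrite (_ : \sum_(i | _) _ = 1) ?subrr ?add0r//.
  transitivity ((\sum_(S : {set 'I_n} | indep g S) lam' ^+ #|S|) / Zg lam' g); last first.
    by rewrite divff// gt_eqF.
  rewrite mulr_suml; apply: eq_bigr => S _.
  rewrite expr_div_n /a invf_div mulrACA -[X in _ = X]mulr1.
  have lS : lam ^+ #|S| != 0 by rewrite expf_neq0// gt_eqF.
  have Zn : Zg lam g != 0 by rewrite gt_eqF.
  have Zn' : Zg lam' g != 0 by rewrite gt_eqF.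
  by field; rewrite lS Zn Zn'.
rewrite -[leRHS]E; apply: ler_sum => S _.
have x0 : 0 < (lam' / lam) ^+ #|S| by rewrite exprn_gt0// divr_gt0.
have w0 : 0 <= lam ^+ #|S| / Zg lam g by rewrite divr_ge0 ?exprn_ge0 ?ltW.
have -> : ln (lam' / lam) * (#|S|%:R * lam ^+ #|S| / Zg lam g) =
    lam ^+ #|S| / Zg lam g * ln ((lam' / lam) ^+ #|S|).
  by rewrite lnXn ?divr_gt0// -mulr_natl; ring.
apply: ler_wpM2l => //; set x := _ ^+ _ in x0 *.
have xa : 0 < x / a by rewrite divr_gt0.
have -> : ln x = ln (x / a) + ln a by rewrite ln_div ?posrE// subrK.
rewrite lerD2r -[x / a in leLHS](subrK 1) addrC le_ln1Dx//.
by rewrite ltrBrDr addNr.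
Qed.

End HardCore.

(** * Entropy inequalities *)

Section Entropy.
Variable R : realType.
Implicit Types a b x : R.

Definition eta x : R := x * ln x.

Lemma eta0 : eta 0 = 0. Proof. by rewrite /eta mul0r. Qed.
Lemma eta1 : eta 1 = 0. Proof. by rewrite /eta ln1 mulr0. Qed.

Lemma ln_le_sub1 x : 0 < x -> ln x <= x - 1.
Proof.
by move=> x0; rewrite -[x in leLHS](subrK 1) addrC le_ln1Dx// ltrBrDr addNr.
Qed.

(** Strictness comes from using the weak bound twice, at the factors of [x] obtained by splitting
    off the midpoint of [x] and 1. *)
Lemma ln_lt_sub1 x : 0 < x -> x != 1 -> ln x < x - 1.
Proof.
move=> x0 x1; have hx : 0 < x / 2 + 2^-1 by rewrite addr_gt0// divr_gt0.
have : ln x - ln (x/2+2^-1) + ln (x/2+2^-1) < x - 1; last by rewrite subrK.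
rewrite -ln_div ?posrE//.
have h1 := ln_le_sub1 (divr_gt0 x0 hx).
have h2 := ln_le_sub1 hx.
apply: le_lt_trans (lerD h1 h2) _.
rewrite -subr_gt0.
have -> : x - 1 - (x / (x/2+2^-1) - 1 + (x/2+2^-1 - 1)) = (x-1)^+2 / (x+1) / 2.
  by field; rewrite gt_eqF ?addr_gt0//.
rewrite divr_gt0// divr_gt0 ?addr_gt0// exprn_even_gt0//= subr_eq0//.
Qed.

Lemma eta_continuous : continuous eta.
Proof.
move=> x; case: (ltgtP x 0) => [x0|x0|->].
- apply: (near_cst_continuous 0); near=> y.
  by rewrite /eta ln0 ?mulr0// ltW//; near: y; apply: lt_nbhsl.
- by apply: continuousM; [exact: cvg_id|exact: continuous_ln].
apply/cvgrPdist_lt => e e0; rewrite eta0.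
have e1 : 0 < (e / 2) ^+ 2 by rewrite exprn_gt0// divr_gt0.
near=> y; rewrite sub0r normrN /eta.
have [y0|y0] := leP y 0; first by rewrite ln0// mulr0 normr0.
have y1 : y < 1 by near: y; apply: lt_nbhsl.
rewrite normrM (gtr0_norm y0) ltr0_norm ?ln_lt0 ?y0//.
(* Writing [ln y = 2 * ln s] bounds [|y * ln y|] by [2 * s], which tends to 0 with [y]. *)
pose s := Num.sqrt y; have s0 : 0 < s by rewrite sqrtr_gt0.
have ys : y = s ^+ 2 by rewrite sqr_sqrtr// ltW.
have h : - ln y <= 2 * s^-1.
  have -> : ln y = 2 * ln s by rewrite ys lnXn// mulr_natl.
  rewrite -mulrN; apply: ler_wpM2l => //.
  rewrite -lnV ?posrE//; apply: le_trans (ln_le_sub1 _) _; first by rewrite invr_gt0.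
  by rewrite gerBl.
apply: le_lt_trans (ler_wpM2l (ltW y0) h) _.
have -> : y * (2 * s^-1) = 2 * s by rewrite ys expr2 mulrCA -mulrA divff ?mulr1// gt_eqF.
rewrite mulrC -ltr_pdivlMr// -(@ltr_pXn2r _ 2)// ?nnegrE ?ltW ?divr_gt0// -ys.
by near: y; apply: lt_nbhsl.
Unshelve. all: by end_near. Qed.

(** The Bregman divergence of [eta], that is, relative entropy of masses that need not be
    normalised. *)
Definition dv a b : R := eta a - a * ln b - a + b.

Lemma dv_ge0 a b : 0 <= a -> 0 < b -> 0 <= dv a b.
Proof.
rewrite le_eqVlt => /predU1P[<-|a0] b0.
  by rewrite /dv eta0 mul0r !subr0 add0r ltW.
have := ler_wpM2l (ltW a0) (ln_le_sub1 (divr_gt0 b0 a0)).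
rewrite ln_div ?posrE// !mulrBr mulr1 mulrCA divff ?gt_eqF// mulr1 /dv /eta.
lra.
Qed.

Lemma dv_gt0 a b : 0 <= a -> 0 < b -> a != b -> 0 < dv a b.
Proof.
rewrite le_eqVlt => /predU1P[<-|a0] b0 ab.
  by rewrite /dv eta0 mul0r !subr0 add0r.
have ba1 : b / a != 1.
  by apply: contraNneq ab => h; rewrite -[b](divfK (lt0r_neq0 a0)) h mul1r.
have := ln_lt_sub1 (divr_gt0 b0 a0) ba1; rewrite -(ltr_pM2l a0).
rewrite ln_div ?posrE// !mulrBr mulr1 mulrCA divff ?gt_eqF// mulr1 /dv /eta.
lra.
Qed.

(* This is the log-sum inequality for the pairs [(a - x, x)] and [(b - x, x)]. *)
Lemma dv_shift a b x : 0 <= x -> x <= a -> x < b -> dv a b <= dv (a - x) (b - x).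
Proof.
rewrite le_eqVlt => /predU1P[<-|x0]; first by rewrite !subr0.
move=> xa xb; have a0 := lt_le_trans x0 xa; have b0 := lt_trans x0 xb.
have ab := ln_le_sub1 (divr_gt0 a0 b0); rewrite ln_div ?posrE// in ab.
have h1 := ler_wpM2l (ltW x0) ab.
move: xa; rewrite le_eqVlt => /predU1P[e|xa].
  rewrite e subrr /dv /eta !mul0r !subr0 add0r; subst x.
  have := h1; rewrite !mulrBr mulr1.
  have : a * (a / b) <= a.
    by rewrite ler_piMr ?ltW// ltr_pdivrMr// mul1r.
  lra.
have ax0 : 0 < a - x by rewrite subr_gt0.
have bx0 : 0 < b - x by rewrite subr_gt0.
(* The argument is chosen so that the right sides of this tangent bound and of the one at [a / b]
   cancel. *)
have t0 : 0 < a * (b - x) / (b * (a - x)) by rewrite divr_gt0 ?mulr_gt0.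
have h2 := ler_wpM2l (ltW ax0) (ln_le_sub1 t0).
rewrite ln_div ?posrE ?mulr_gt0// !lnM ?posrE// in h2.
have e : (a - x) * (a * (b - x) / (b * (a - x)) - 1) + x * (a / b - 1) = 0.
  by field; rewrite !gt_eqF.
have h := lerD h2 h1; rewrite e in h.
rewrite /dv /eta; move: h; lra.
Qed.

(** Nonnegativity of mutual information for an edge whose ends are vacant with probabilities [a] and
    [b]: both are vacant with probability [a + b - 1], as they are never both occupied. *)
Lemma eta_edge a b : 0 < a -> 0 < b -> a <= 1 -> b <= 1 -> 0 < a + b - 1 ->
  eta a + eta b <= eta (a + b - 1).
Proof.
move=> a0 b0 a1 b1 c0.
have ha := ler_wpM2l (_ : 0 <= 1 - b) (ln_le_sub1 a0).
have hb := ler_wpM2l (_ : 0 <= 1 - a) (ln_le_sub1 b0).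
have t0 : 0 < a * b / (a + b - 1) by rewrite divr_gt0 ?mulr_gt0.
have hc := ler_wpM2l (ltW c0) (ln_le_sub1 t0).
rewrite ln_div ?posrE ?mulr_gt0// lnM ?posrE// in hc.
have e : (a + b - 1) * (a * b / (a + b - 1) - 1) = a * b - (a + b - 1).
  by field; rewrite gt_eqF.
rewrite e in hc.
move: (ha ltac:(by rewrite subr_ge0)) (hb ltac:(by rewrite subr_ge0)) hc.
have : 0 <= (1 - a) * (1 - b) by rewrite mulr_ge0 ?subr_ge0.
rewrite /eta; nra.
Qed.

(** The Gibbs variational principle for a single vertex. *)
Lemma entropy_le_ln1D lam x : 0 < lam -> 0 < x -> x < 1 ->
  ln lam * x - eta x - eta (1 - x) <= ln (1 + lam).
Proof.
move=> l0 x0 x1; have x1' : 0 < 1 - x by rewrite subr_gt0.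
have L0 : 0 < 1 + lam by rewrite addr_gt0.
have h1 : 0 < lam / ((1 + lam) * x) by rewrite divr_gt0 ?mulr_gt0.
have h2 : 0 < ((1 + lam) * (1 - x))^-1 by rewrite invr_gt0 mulr_gt0.
have := ler_wpM2l (ltW x0) (ln_le_sub1 h1).
have := ler_wpM2l (ltW x1') (ln_le_sub1 h2).
rewrite ln_div ?posrE ?mulr_gt0// lnV ?posrE ?mulr_gt0// !lnM ?posrE//.
have -> : (1 - x) * (((1 + lam) * (1 - x))^-1 - 1) = (1 + lam)^-1 - (1 - x).
  by field; rewrite !gt_eqF.
have -> : x * (lam / ((1 + lam) * x) - 1) = 1 - (1 + lam)^-1 - x.
  by field; rewrite !gt_eqF.
rewrite /eta; lra.
Qed.

End Entropy.

Section PointwiseContinuity.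
Variables (R : realType) (X : topologicalType).
Implicit Types f h : X -> R.

Lemma continuous_add f h :
  continuous f -> continuous h -> continuous (fun x => f x + h x).
Proof. by move=> cf ch x; apply: cvgD; [exact: cf|exact: ch]. Qed.

Lemma continuous_sub f h :
  continuous f -> continuous h -> continuous (fun x => f x - h x).
Proof. by move=> cf ch x; apply: cvgB; [exact: cf|exact: ch]. Qed.

Lemma continuous_sub1 h : continuous h -> continuous (fun x => 1 - h x).
Proof. by move=> ch x; apply: cvgB; [exact: cvg_cst|exact: ch]. Qed.

Lemma continuous_scale (a : R) h : continuous h -> continuous (fun x => a * h x).
Proof. by move=> ch x; apply: cvgMr; exact: ch. Qed.

Lemma continuous_sumr (I : finType) (Q : pred I) (h : I -> X -> R) :
  (forall v, continuous (h v)) -> continuous (fun x => \sum_(v | Q v) h v x).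
Proof.
by move=> ch x; apply: cvg_big => [|v _]; [exact: add_continuous|exact: ch].
Qed.

End PointwiseContinuity.

(** * Bethe free energy of a finite graph *)

Section Bethe.
Variables (R : realType) (n : nat) (g : graph n).
Hypothesis gs : simple g.
Implicit Types (p : 'I_n -> R) (v : 'I_n) (lam x : R).

(* Edge sums run over ordered pairs, hence the factor [2^-1]; edge marginals
   have been eliminated, since [psi] forces them to be determined by [p]. *)
Definition Bethe lam p : R :=
  ln lam * \sum_v p v - \sum_v eta (p v)
  + \sum_v ((deg g v)%:R - 1) * eta (1 - p v)
  - 2^-1 * \sum_v \sum_(u | g (v, u)) eta (1 - (p u + p v)).

Definition feasible p : Prop :=
  (forall v, 0 <= p v <= 1) /\ (forall u v, g (u, v) -> p u + p v <= 1).

Definition upd p v x : 'I_n -> R := fun u => if u == v then x else p u.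

Lemma upd_id p v : upd p v (p v) = p.
Proof. by apply/funext => u; rewrite /upd; case: eqP => // ->. Qed.

Lemma sum_upd (F : R -> R) (c : 'I_n -> R) p v x :
  \sum_u c u * F (upd p v x u) = c v * F x + \sum_(u | u != v) c u * F (p u).
Proof.
rewrite (bigD1 v) //= /upd eqxx; congr (_ + _).
by apply: eq_bigr => u /negbTE ->.
Qed.

Lemma edge_sum_upd (F : R -> R) p v x :
  \sum_w \sum_(u | g (w, u)) F (upd p v x u + upd p v x w) =
  2 * (\sum_(u | g (v, u)) F (p u + x)) +
  \sum_(w | w != v) \sum_(u | g (w, u) && (u != v)) F (p u + p w).
Proof.
rewrite (bigD1 v) //=.
have -> : \sum_(u | g (v, u)) F (upd p v x u + upd p v x v) =
          \sum_(u | g (v, u)) F (p u + x).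
  apply: eq_bigr => u gvu; rewrite /upd eqxx; case: eqP => // e.
  by rewrite e (simple_irr gs) in gvu.
have -> : \sum_(w | w != v) \sum_(u | g (w, u)) F (upd p v x u + upd p v x w) =
   \sum_(w | w != v) (if g (v, w) then F (p w + x) else 0) +
   \sum_(w | w != v) \sum_(u | g (w, u) && (u != v)) F (p u + p w).
  rewrite -big_split /=; apply: eq_bigr => w wv.
  rewrite (bigID (fun u => u == v)) /=; congr (_ + _).
    under eq_bigl do rewrite andbC.
    rewrite big_mkcondr /= big_pred1_eq (simple_sym gs)//.
    by rewrite /upd eqxx (negbTE wv) addrC.
  by apply: eq_bigr => u /andP[_ uv]; rewrite /upd (negbTE uv) (negbTE wv).
rewrite addrA; congr (_ + _); rewrite mulr2n mulrDl mul1r; congr (_ + _).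
rewrite -big_mkcondr /=; apply: eq_bigl => w; rewrite andbC.
by case: eqP => [->|_]; rewrite ?andbT// (simple_irr gs).
Qed.

Lemma Bethe_upd lam p v x :
  Bethe lam (upd p v x) - Bethe lam p =
    ln lam * (x - p v) - (eta x - eta (p v))
    + ((deg g v)%:R - 1) * (eta (1 - x) - eta (1 - p v))
    - \sum_(u | g (v, u)) (eta (1 - (p u + x)) - eta (1 - (p u + p v))).
Proof.
have Bu y : Bethe lam (upd p v y) =
    ln lam * (y + \sum_(u | u != v) 1 * p u)
    - (eta y + \sum_(u | u != v) 1 * eta (p u))
    + (((deg g v)%:R - 1) * eta (1 - y) +
         \sum_(u | u != v) ((deg g u)%:R - 1) * eta (1 - p u))
    - 2^-1 * (2 * \sum_(u | g (v, u)) eta (1 - (p u + y)) +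
       \sum_(w | w != v) \sum_(u | g (w, u) && (u != v)) eta (1 - (p u + p w))).
  rewrite /Bethe (edge_sum_upd (fun z => eta (1 - z))).
  rewrite (sum_upd (fun z => eta (1 - z))).
  have := sum_upd (fun z => z) (fun=> 1) p v y; rewrite mul1r => <-.
  have := sum_upd (fun z => eta z) (fun=> 1) p v y; rewrite mul1r => <-.
  have m1 (F : 'I_n -> R) : \sum_u 1 * F u = \sum_u F u.
    by apply: eq_bigr => u _; rewrite mul1r.
  by rewrite !m1.
rewrite -[in X in _ - X](upd_id p v) !Bu sumrB.
by field.
Qed.

Lemma sumr_nbrs_const v x : \sum_(u | g (v, u)) x = (deg g v)%:R * x.
Proof.
rewrite sumr_const mulr_natl /deg; congr (_ *+ _).
by apply: eq_card => u; apply/idP/idP => h; [exact/mem_set|exact: (set_mem h)].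
Qed.

(* Stationarity of [Bethe lam] in the coordinate [p v], in terms of odds. *)
Definition BPeq lam p v : Prop :=
  [/\ 0 < p v < 1, (forall u, g (v, u) -> p u + p v < 1) &
      lam * \prod_(u | g (v, u)) (1 - p u / (1 - p v)) = p v / (1 - p v)].

(** In logarithmic form the equation says that the partial derivative of [Bethe lam] in [p v]
    vanishes. *)
Lemma BPeq_ln lam p v : 0 < lam -> BPeq lam p v ->
  ln lam = ln (p v) + ((deg g v)%:R - 1) * ln (1 - p v)
     - \sum_(u | g (v, u)) ln (1 - (p u + p v)).
Proof.
move=> l0 [/andP[x0 x1] hu e].
have x1' : 0 < 1 - p v by rewrite subr_gt0.
have fu u : g (v, u) -> 1 - p u / (1 - p v) = (1 - (p u + p v)) / (1 - p v).
  by move=> _; field; rewrite gt_eqF.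
have fu0 u : g (v, u) -> 0 < 1 - (p u + p v) by move=> /hu; rewrite subr_gt0.
have : ln (lam * \prod_(u | g (v, u)) ((1 - (p u + p v)) / (1 - p v))) =
       ln (p v) - ln (1 - p v).
  by rewrite -ln_div ?posrE// -e; congr (ln (_ * _)); apply: eq_bigr => u /fu ->.
have P0 : forall s, 0 < \prod_(u <- s | g (v, u)) ((1 - (p u + p v)) / (1 - p v)).
  by move=> s; apply: prodr_gt0 => u /fu0 h; rewrite divr_gt0.
rewrite lnM ?posrE//.
have -> : ln (\prod_(u | g (v, u)) ((1 - (p u + p v)) / (1 - p v))) =
  \sum_(u | g (v, u)) (ln (1 - (p u + p v)) - ln (1 - p v)).
  elim: (index_enum _) => [|u s IH]; first by rewrite !big_nil ln1.
  rewrite !big_cons; case: ifP => // gvu.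
  by rewrite lnM ?posrE ?divr_gt0 ?fu0// IH ln_div ?posrE ?fu0.
rewrite sumrB sumr_nbrs_const => h.
rewrite mulrBl mul1r -[LHS](addrK (\sum_(u | g (v, u)) ln (1 - (p u + p v)) - (deg g v)%:R * ln (1 - p v))) h.
by ring.
Qed.

(** Intermediate value theorem for the difference [k] of the two sides: at 0 it is positive, and at
    the right end [c] either the odds reach [lam] or a factor of the product vanishes. *)
Lemma exists_local_root lam p v : 0 < lam ->
  (forall u, g (v, u) -> 0 <= p u < 1) ->
  exists x, BPeq lam (upd p v x) v.
Proof.
move=> l0 hp; pose c0 := lam / (1 + lam).
have /andP[c00 c01] : 0 <= c0 < 1 by apply: odds_itv; exact: ltW.
have c0p : 0 < c0 by rewrite divr_gt0// addr_gt0.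
(* [c] is the minimum of [c0] and of the numbers [1 - p u] over the neighbours; the last clause
   records where it is attained. *)
have [c [cp cc0 cp1 cor]] : exists c, [/\ 0 < c, c <= c0,
   forall u, g (v, u) -> c <= 1 - p u & c = c0 \/ exists2 u, g (v, u) & c = 1 - p u].
  have : forall s : seq 'I_n, exists c, [/\ 0 < c, c <= c0,
   forall u, u \in s -> g (v, u) -> c <= 1 - p u & c = c0 \/ exists2 u, g (v, u) & c = 1 - p u].
    elim=> [|u s [c [h1 h2 h3 h4]]]; first by exists c0; split => //; left.
    case: (boolP (g (v, u))) => gvu; last first.
      exists c; split => // w; rewrite inE => /predU1P[->|]; last exact: h3.
      by rewrite (negbTE gvu).
    have /andP[_ pu1] := hp _ gvu.
    case: (leP c (1 - p u)) => hc.
      by exists c; split => // w; rewrite inE => /predU1P[->|]; last exact: h3.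
    exists (1 - p u); split; first by rewrite subr_gt0.
    - by rewrite ltW// (lt_le_trans hc).
    - move=> w; rewrite inE => /predU1P[->//|ws gvw].
      by apply: ltW; apply: lt_le_trans hc _; exact: h3.
    - by right; exists u.
  move=> /(_ (index_enum 'I_n))[c [h1 h2 h3 h4]]; exists c; split => // u.
  by apply: h3; rewrite mem_index_enum.
have c1 : c < 1 by apply: le_lt_trans c01.
pose k x := lam * \prod_(u | g (v, u)) (1 - p u / (1 - x)) - x / (1 - x).
have kc : {within `[0, c], continuous k}.
  apply: continuous_in_subspaceT => x; rewrite inE /= in_itv/= => /andP[_ xc].
  have x1 : 1 - x != 0 by rewrite gt_eqF// subr_gt0 (le_lt_trans xc).
  have ci : (1 - y)^-1 @[y --> x] --> (1 - x)^-1.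
    by apply: cvgV => //; apply: cvgB; [exact: cvg_cst|exact: cvg_id].
  apply: cvgB; last by apply: cvgM => //; exact: cvg_id.
  apply: cvgMr; apply: cvg_big => [|u _]; first exact: mul_continuous.
  by apply: cvgB; [exact: cvg_cst|exact: cvgMr].
have k0 : 0 < k 0.
  rewrite /k mul0r subr0 mulr_gt0//; apply: prodr_gt0 => u gvu.
  by rewrite subr0 divr1 subr_gt0; case/andP: (hp _ gvu).
have fac x u : g (v, u) -> 0 <= x <= c -> 0 <= 1 - p u / (1 - x) <= 1.
  move=> gvu /andP[x0 xc]; have /andP[pu0 pu1] := hp _ gvu.
  have x1 : 0 < 1 - x by rewrite subr_gt0 (le_lt_trans xc).
  rewrite subr_ge0 ler_pdivrMr// mul1r gerBl divr_ge0 ?(ltW x1)// andbT.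
  by rewrite lerBrDr -lerBrDl (le_trans xc)// cp1.
have kc0 : k c <= 0.
  rewrite /k subr_le0; case: cor => [e|[u gvu e]].
    have -> : c / (1 - c) = lam.
      have L0 : 1 + lam != 0 by rewrite gt_eqF ?addr_gt0.
      have -> : 1 - c = (1 + lam)^-1 by rewrite e /c0; field.
      by rewrite invrK e /c0 divfK.
    rewrite ler_piMr ?(ltW l0)//; apply: Num.Theory.prodr_ile1 => u gvu.
    by apply: fac => //; rewrite lexx (ltW cp).
  have pu0 : p u != 0 by apply: contraTneq c1 => pu0; rewrite e pu0 subr0 ltxx.
  have cu : 1 - c = p u by rewrite e; ring.
  rewrite (bigD1 u)//= cu divff// subrr mul0r mulr0 -cu.
  by rewrite divr_ge0 ?subr_ge0// ltW.
have [x xc kx] : exists2 x, x \in `[0, c] & k x = 0.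
  apply: IVT => //; first exact: ltW.
  by rewrite ge_min kc0 orbT le_max (ltW k0).
move: xc; rewrite in_itv/= => /andP[x0 xc].
have xp : 0 < x.
  rewrite lt_neqAle x0 andbT; apply/eqP => e.
  by rewrite -e in kx; rewrite kx ltxx in k0.
have x1 : x < 1 by apply: le_lt_trans c1.
have x1' : 0 < 1 - x by rewrite subr_gt0.
have e : lam * \prod_(u | g (v, u)) (1 - p u / (1 - x)) = x / (1 - x).
  by apply/eqP; rewrite -subr_eq0 -/(k x) kx.
exists x; rewrite /BPeq /upd eqxx; split; first by rewrite xp x1.
- move=> u gvu; have -> : u == v = false.
    by apply/eqP => h; rewrite h (simple_irr gs) in gvu.
  (* A vanishing factor would make the odds at the root 0, so the root satisfies the edge
     constraints strictly. *)
  have : 1 - p u / (1 - x) != 0.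
    apply: contraTneq (divr_gt0 xp x1') => h.
    by rewrite -e (bigD1 u)//= h mul0r mulr0 ltxx.
  have /andP[] := fac x u gvu ltac:(by rewrite x0 xc).
  rewrite le_eqVlt => /predU1P[<-|]; first by rewrite eqxx.
  by rewrite subr_gt0 ltr_pdivrMr// mul1r ltrBrDr.
- rewrite -e; congr (_ * _); apply: eq_bigr => u gvu.
  by case: eqP => // h; rewrite h (simple_irr gs) in gvu.
Qed.

(* The second-order remainder of a one-coordinate change is a sum of relative
   entropies, whose edge part is controlled by [dv_shift]. *)
Lemma Bethe_upd_root lam p v x : 0 < lam -> feasible p ->
  BPeq lam (upd p v x) v ->
  Bethe lam p + dv (p v) x + dv (1 - p v) (1 - x) <= Bethe lam (upd p v x).
Proof.
move=> l0 [hp he] bp; have eB := Bethe_upd lam p v x.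
move: (Bethe lam (upd p v x)) eB => B' eB.
have := BPeq_ln l0 bp; case: bp; rewrite /upd eqxx.
move=> /andP[x0 x1] hu _ hl.
have uv u : g (v, u) -> u == v = false.
  by move=> gvu; apply/eqP => h; rewrite h (simple_irr gs) in gvu.
have {}hu u : g (v, u) -> p u + x < 1 by move=> gvu; have := hu _ gvu; rewrite uv.
have {}hl : ln lam = ln x + ((deg g v)%:R - 1) * ln (1 - x)
     - \sum_(u | g (v, u)) ln (1 - (p u + x)).
  by rewrite hl; congr (_ - _); apply: eq_bigr => u gvu; rewrite uv.
have key : \sum_(u | g (v, u)) dv (1 - p v) (1 - x) <=
           \sum_(u | g (v, u)) dv (1 - (p u + p v)) (1 - (p u + x)).
  apply: ler_sum => u gvu; have /andP[pu0 pu1] := hp u.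
  have hs := he _ _ gvu; have hx := hu _ gvu.
  have -> : 1 - (p u + p v) = 1 - p v - p u by ring.
  have -> : 1 - (p u + x) = 1 - x - p u by ring.
  by apply: dv_shift => //; lra.
rewrite sumr_nbrs_const in key.
have ed : \sum_(u | g (v, u)) dv (1 - (p u + p v)) (1 - (p u + x)) =
  - \sum_(u | g (v, u)) (eta (1 - (p u + x)) - eta (1 - (p u + p v)))
  + (p v - x) * (\sum_(u | g (v, u)) ln (1 - (p u + x)) + (deg g v)%:R).
  rewrite -[_%:R]mulr1 -sumr_nbrs_const -big_split /= mulr_sumr -sumrN -big_split /=.
  by apply: eq_bigr => u _; rewrite /dv /eta; ring.
rewrite ed in key; rewrite hl in eB.
set E := \sum_(u | g (v, u)) (_ - _) in key eB; set L := \sum_(u | g (v, u)) _ in key eB.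
have ex0 : eta x = x * ln x by [].
have ex : eta (1 - x) = (1 - x) * ln (1 - x) by [].
move: key eB; rewrite /dv ex0 ex; lra.
Qed.

Lemma Bethe_maximizer lam : exists2 p, feasible p &
  forall q, feasible q -> Bethe lam q <= Bethe lam p.
Proof.
(* Marginals are viewed as row vectors: the feasible set is closed in a compact cube, and the
   extreme value theorem applies. *)
pose f (r : 'rV[R]_n) := Bethe lam (fun v => r ord0 v).
pose K : set 'rV[R]_n := [set r | feasible (fun v => r ord0 v)].
have cr v : continuous (fun r : 'rV[R]_n => r ord0 v) by exact: coord_continuous.
have Kc : compact K.
  pose K0 : set 'rV[R]_n := [set r | forall v, `[0, 1]%classic (r ord0 v)].
  have cK0 : compact K0 by apply: (@rV_compact _ n (fun=> `[(0 : R), 1]%classic)) => v; exact: segment_compact.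
  apply: subclosed_compact cK0 _; last first.
    by move=> r [h _] v /=; rewrite in_itv; exact: h.
  have cpre (h : 'rV[R]_n -> R) : continuous h -> closed [set r | h r <= 1].
    move=> ch; apply: (@preimage_closed _ _ h [set x | x <= 1]); last exact: closed_le.
    by move=> r _; exact: ch.
  have -> : K = (\bigcap_(v in [set: 'I_n]) [set r : 'rV[R]_n | 1 - r ord0 v <= 1]) `&`
     (\bigcap_(v in [set: 'I_n]) [set r : 'rV[R]_n | r ord0 v <= 1]) `&`
     \bigcap_(uv in [set uv : 'I_n * 'I_n | g uv]) [set r : 'rV[R]_n | r ord0 uv.1 + r ord0 uv.2 <= 1].
    apply/seteqP; split => r /=.
      move=> [h1 h2]; split; last by move=> [u v] /= guv; exact: h2.
      split=> v _ /=; first by rewrite gerBl; case/andP: (h1 v).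
      by case/andP: (h1 v).
    move=> [[h1 h2] h3]; split; last by move=> u v guv; exact: (h3 (u, v) guv).
    by move=> v; have /= := h1 v I; rewrite gerBl => ->; exact: h2.
  apply: closedI; first apply: closedI.
  - by apply: closed_bigI => v _; apply: cpre; apply: continuous_sub1; exact: cr.
  - by apply: closed_bigI => v _; apply: cpre; exact: cr.
  - by apply: closed_bigI => -[u v] _; apply: cpre; apply: continuous_add; exact: cr.
have cf : continuous f.
  have ceta h : continuous h -> continuous (fun r : 'rV[R]_n => eta (h r)).
    by move=> ch r; apply: continuous_comp; [exact: ch|exact: eta_continuous].
  apply: continuous_sub; first apply: continuous_add; first apply: continuous_sub.
  - by apply: continuous_scale; apply: continuous_sumr.
  - by apply: continuous_sumr => v; apply: ceta.
  - apply: continuous_sumr => v; apply: continuous_scale; apply: ceta.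
    exact: continuous_sub1.
  - apply: continuous_scale; apply: continuous_sumr => v; apply: continuous_sumr => u.
    by apply: ceta; apply: continuous_sub1; apply: continuous_add; exact: cr.
have [r rK rmax] : exists2 c, c \in K & forall t, t \in K -> f t <= f c.
  apply: EVT_max_rV => //; last exact: continuous_subspaceT.
  exists 0; split => [v|u v _]; rewrite !mxE ?lexx ?ler01//.
exists (fun v => r ord0 v); first exact: (set_mem rK).
move=> q hq; have := rmax (\row_v q v); rewrite /f.
have -> : (fun v => (\row_v0 q v0) ord0 v) = q by apply/funext => v; rewrite mxE.
apply; apply/mem_set; rewrite /K /=.
by have -> : (fun v => (\row_v0 q v0) ord0 v) = q by apply/funext => v; rewrite mxE.
Qed.

(** A coordinate that does not solve its own equation could be moved to the root of it; the result
    is feasible and [Bethe] increases by a positive divergence. *)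
Lemma maximizer_BPeq lam p : 0 < lam -> feasible p ->
  (forall q, feasible q -> Bethe lam q <= Bethe lam p) -> forall v, BPeq lam p v.
Proof.
move=> l0 fp pmax; have [hp he] := fp.
have step v : (forall u, g (v, u) -> p u < 1) -> BPeq lam p v.
  move=> hu; have hu' u : g (v, u) -> 0 <= p u < 1.
    by move=> /hu ->; rewrite andbT; case/andP: (hp u).
  have [x bp] := exists_local_root l0 hu'.
  have := Bethe_upd_root l0 fp bp.
  have [xi xu _] := bp; rewrite /upd eqxx in xi xu; case/andP: xi => x0 x1.
  have uv u : g (v, u) -> u == v = false.
    by move=> gvu; apply/eqP => h; rewrite h (simple_irr gs) in gvu.
  have fq : feasible (upd p v x).
    split=> [w|u w guw]; rewrite /upd.
      by case: eqP => _; [rewrite !ltW|exact: hp].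
    case: eqP guw => [->|_]; case: eqP => [->|_] guw.
    - by rewrite (simple_irr gs) in guw.
    - by have := xu _ guw; rewrite uv// addrC => /ltW.
    - by rewrite (simple_sym gs) in guw; have := xu _ guw; rewrite uv// => /ltW.
    - exact: he.
  have := pmax _ fq; have /andP[p0 p1] := hp v.
  have [e|ne] := eqVneq (p v) x; first by rewrite -e upd_id in bp.
  have := dv_gt0 p0 x0 ne.
  have : 0 <= dv (1 - p v) (1 - x) by apply: dv_ge0; lra.
  lra.
have p1 v : p v < 1.
  have /andP[p0] := hp v; rewrite le_eqVlt => /predU1P[e|//].
  (* If [p v = 1], the edge constraints force the neighbours to 0; then [step] applies at [v] and
     yields [p v < 1] after all. *)
  have [|/andP[_ //]] := step v; move=> u gvu.
  have := he _ _ gvu; rewrite e; lra.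
by move=> v; apply: step => u _.
Qed.

(* The term of the Bethe functional at [v], with the messages expressed through
   the vertex marginals. *)
Definition PhiV p v : R := - ln (1 - p v) -
  2^-1 * \sum_(u | g (v, u)) (ln (1 - (p u + p v)) - ln (1 - p u) - ln (1 - p v)).

Lemma edge_sum_sym (F : 'I_n -> 'I_n -> R) :
  \sum_v \sum_(u | g (v, u)) F v u = \sum_v \sum_(u | g (v, u)) F u v.
Proof.
rewrite [RHS](exchange_big_dep xpredT)//=; apply: eq_bigr => v _.
by apply: eq_bigl => u; rewrite (simple_sym gs).
Qed.

(** Stationarity eliminates [ln lam]; exchanging the two ends of each edge then matches the
    remaining terms vertex by vertex. *)
Lemma Bethe_BP lam p : 0 < lam -> (forall v, BPeq lam p v) ->
  Bethe lam p = \sum_v PhiV p v.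
Proof.
move=> l0 bp; rewrite /Bethe /PhiV.
have e1 : \sum_v \sum_(u | g (v, u)) eta (1 - (p u + p v)) =
  \sum_v \sum_(u | g (v, u)) (1 - 2 * p v) * ln (1 - (p u + p v)).
  apply/eqP; rewrite -subr_eq0 -sumrB; apply/eqP.
  under eq_bigr do rewrite -sumrB.
  have -> : \sum_v \sum_(u | g (v, u)) (eta (1 - (p u + p v)) - (1 - 2 * p v) * ln (1 - (p u + p v)))
    = \sum_v \sum_(u | g (v, u)) (p v * ln (1 - (p u + p v)))
    - \sum_v \sum_(u | g (v, u)) (p u * ln (1 - (p u + p v))).
    rewrite -sumrB; apply: eq_bigr => v _; rewrite -sumrB; apply: eq_bigr => u _.
    by rewrite /eta; ring.
  rewrite [X in _ - X]edge_sum_sym; apply/eqP; rewrite subr_eq0; apply/eqP.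
  by apply: eq_bigr => v _; apply: eq_bigr => u _; rewrite [p v + p u]addrC.
have e2 : \sum_v \sum_(u | g (v, u)) (ln (1 - (p u + p v)) - ln (1 - p u) - ln (1 - p v))
  = \sum_v \sum_(u | g (v, u)) (ln (1 - (p u + p v)) - 2 * ln (1 - p v)).
  have -> : \sum_v \sum_(u | g (v, u)) (ln (1 - (p u + p v)) - ln (1 - p u) - ln (1 - p v)) =
   \sum_v \sum_(u | g (v, u)) (ln (1 - (p u + p v)) - ln (1 - p v)) -
   \sum_v \sum_(u | g (v, u)) ln (1 - p u).
    rewrite -sumrB; apply: eq_bigr => v _; rewrite -sumrB; apply: eq_bigr => u _.
    by ring.
  rewrite (edge_sum_sym (fun v u => ln (1 - p u))) -sumrB; apply: eq_bigr => v _.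
  by rewrite -sumrB; apply: eq_bigr => u _; ring.
have -> : \sum_v (- ln (1 - p v) - 2^-1 * \sum_(u | g (v, u))
     (ln (1 - (p u + p v)) - ln (1 - p u) - ln (1 - p v))) =
   \sum_v - ln (1 - p v) - 2^-1 * \sum_v \sum_(u | g (v, u))
     (ln (1 - (p u + p v)) - 2 * ln (1 - p v)) by rewrite sumrB -mulr_sumr e2.
rewrite e1 !mulr_sumr -!sumrN -!big_split /=.
apply: eq_bigr => v _; rewrite (BPeq_ln l0 (bp v)) sumrB -mulr_sumr sumr_nbrs_const /eta.
by field.
Qed.

Lemma zero_feasible : feasible (fun=> 0).
Proof. by split=> [v|u v _]; rewrite ?lexx ?ler01 ?addr0 ?ler01. Qed.

Lemma Bethe_zero lam : Bethe lam (fun=> 0) = 0.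
Proof.
rewrite /Bethe; transitivity (ln lam * 0 - 0 + 0 - 2^-1 * 0 : R); last by ring.
congr (_ * _ - _ + _ - _ * _); apply: big1 => v _; rewrite ?eta0 ?subr0 ?eta1 ?mulr0//.
by apply: big1 => u _; rewrite addr0 subr0 eta1.
Qed.

Lemma BP_feasible lam p : (forall v, BPeq lam p v) -> feasible p.
Proof.
move=> bp; split=> [v|u v guv]; first by have [/andP[/ltW -> /ltW ->]] := bp v.
by apply: ltW; have [_ h _] := bp v; apply: h; rewrite (simple_sym gs).
Qed.

(** [Bethe] is a sum of single-vertex free energies, each at most [ln (1 + lam)], minus the mutual
    informations of the edges. *)
Lemma Bethe_le lam p : 0 < lam -> (forall v, BPeq lam p v) ->
  Bethe lam p <= n%:R * ln (1 + lam).
Proof.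
move=> l0 bp.
have e : Bethe lam p = \sum_v (ln lam * p v - eta (p v) - eta (1 - p v)) +
   2^-1 * \sum_v \sum_(u | g (v, u)) (eta (1 - p u) + eta (1 - p v) - eta (1 - (p u + p v))).
  have -> : \sum_v \sum_(u | g (v, u)) (eta (1 - p u) + eta (1 - p v) - eta (1 - (p u + p v))) =
    2 * (\sum_v (deg g v)%:R * eta (1 - p v)) - \sum_v \sum_(u | g (v, u)) eta (1 - (p u + p v)).
    have -> : \sum_v (deg g v)%:R * eta (1 - p v) = \sum_v \sum_(u | g (v, u)) eta (1 - p v).
      by apply: eq_bigr => v _; rewrite sumr_nbrs_const.
    rewrite mulr2n mulrDl mul1r {1}(edge_sum_sym (fun v u => eta (1 - p v))).
    rewrite -big_split /= -sumrB; apply: eq_bigr => v _.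
    by rewrite -big_split /= -sumrB.
  rewrite /Bethe !sumrB -mulr_sumr.
  under [X in _ + X - _]eq_bigr do rewrite mulrBl mul1r.
  by rewrite sumrB; field.
rewrite e; apply: le_trans (_ : \sum_(v < n) ln (1 + lam) + 0 <= _); last first.
  by rewrite addr0 sumr_const card_ord mulr_natl.
apply: lerD.
  apply: ler_sum => v _; have [/andP[x0 x1] _ _] := bp v.
  exact: entropy_le_ln1D.
rewrite pmulr_rle0//; apply: sumr_le0 => v _; apply: sumr_le0 => u gvu.
have [/andP[x0 x1] hu _] := bp v; have [/andP[y0 y1] _ _] := bp u.
have := hu _ gvu => h; rewrite subr_le0.
have -> : 1 - (p u + p v) = (1 - p u) + (1 - p v) - 1 by ring.
apply: eta_edge; lra.
Qed.

(** Hence the maximum over [p] is convex in [ln lam], with the sum of any maximizer as a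
    subgradient. *)
Lemma Bethe_affine lam lam' p :
  Bethe lam' p = Bethe lam p + (ln lam' - ln lam) * \sum_v p v.
Proof. by rewrite /Bethe; ring. Qed.

End Bethe.

(** * Locally tree-like neighbourhoods *)

Section TreeNodes.
Implicit Types (T : ptree) (s : seq nat) (i t : nat).

Lemma valid_rcons T s i : valid T (rcons s i) = valid T s && (i < T s)%N.
Proof.
elim: s T => [|a s IH] T /=; first by rewrite andbT.
by rewrite IH -andbA.
Qed.

Definition sub_at s T : ptree := fun u => T (s ++ u).

Lemma subt_sub_at s T i : subt i (sub_at s T) = sub_at (rcons s i) T.
Proof. by apply/funext => u; rewrite /subt /sub_at cat_rcons. Qed.

Lemma sub_at_root s T : sub_at s T [::] = T s.
Proof. by rewrite /sub_at cats0. Qed.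

Lemma tball_rcons T t s i : tball T t s -> (i < T s)%N -> tball T t.+1 (rcons s i).
Proof. by move=> [vs st] iT; split; rewrite ?valid_rcons ?vs// size_rcons. Qed.

Lemma tball_S T t s : tball T t s -> tball T t.+1 s.
Proof. by move=> [vs st]; split => //; exact: leqW. Qed.

Lemma tball_parent T t s i : tball T t.+1 (rcons s i) -> tball T t s /\ (i < T s)%N.
Proof. by move=> [+ +]; rewrite valid_rcons size_rcons => /andP[vs iT] st; split. Qed.

Lemma tball_nil T t : tball T t [::]. Proof. by []. Qed.

End TreeNodes.

Lemma big_enum_by (R : Type) (idx : R) (op : Monoid.com_law idx) (I : finType)
    (P : pred I) (F : I -> R) (un : nat -> I) (d : nat) :
  (forall i j, (i < d)%N -> (j < d)%N -> un i = un j -> i = j) ->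
  (forall z, P z <-> exists2 i, (i < d)%N & z = un i) ->
  \big[op/idx]_(z | P z) F z = \big[op/idx]_(i < d) F (un i).
Proof.
move=> uinj hP.
rewrite -(big_imset _ (h := fun i : 'I_d => un i) (A := predT)) /=; last first.
  by move=> i j _ _ /uinj e; apply/val_inj/e.
apply: eq_bigl => z; apply/idP/imsetP => [/hP[i id ->]|[i _ ->]].
  by exists (Ordinal id).
by apply/hP; exists i.
Qed.

(** The inverse of a ball isomorphism. It reaches one level beyond [t] so that all neighbours of a
    vertex at depth at most [t] are accounted for. *)
Record tree_emb n (g : graph n) (T : ptree) (t : nat) (e : seq nat -> 'I_n) : Prop :=
  TreeEmb {
    emb_inj : forall s s', tball T t.+1 s -> tball T t.+1 s' -> e s = e s' -> s = s';
    emb_adj : forall s s', tball T t.+1 s -> tball T t.+1 s' ->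
                 (g (e s, e s') <-> tadj s s');
    emb_closed : forall s w, tball T t s -> g (e s, w) ->
                   exists2 s', tball T t.+1 s' & w = e s' }.

Lemma gball_iso_emb n (g : graph n) v t T : gball_iso g v t.+1 T ->
  exists2 e, tree_emb g T t e & e [::] = v.
Proof.
move=> [f [f0 fb finj fsurj fadj]].
have bS k u : u \in Defs.ball g k v -> u \in Defs.ball g k.+1 v by move=> h; rewrite /= inE h.
have bmono k k' u : (k <= k')%N -> u \in Defs.ball g k v -> u \in Defs.ball g k' v.
  move=> /subnKC <-; elim: (k' - k)%N => [|m IH]; rewrite ?addn0// addnS => /IH.
  exact: bS.
have vb k : v \in Defs.ball g k v by apply: (bmono 0%N) => //=; rewrite inE.
have [e he] : {e : seq nat -> 'I_n & forall s, tball T t.+1 s ->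
    e s \in Defs.ball g t.+1 v /\ f (e s) = s}.
  apply: (@choice _ _ (fun s u => tball T t.+1 s -> u \in Defs.ball g t.+1 v /\ f u = s)) => s.
  have [hs|hs] := pselect (tball T t.+1 s); last by exists v.
  by have [u ub fu] := fsurj _ hs; exists u.
have efu u : u \in Defs.ball g t.+1 v -> e (f u) = u.
  by move=> ub; have [h1 h2] := he _ (fb _ ub); apply: finj.
have e0 : e [::] = v by rewrite -f0 efu.
have eadj s s' : tball T t.+1 s -> tball T t.+1 s' -> (g (e s, e s') <-> tadj s s').
  move=> hs hs'; have [h1 h2] := he _ hs; have [h3 h4] := he _ hs'.
  by have := fadj _ _ h1 h3; rewrite h2 h4.
(* Depth in the tree bounds distance in the graph, so a neighbour of a vertex of depth at most [t]
   still lies in the ball of radius [t.+1]. *)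
have eball k s : (k <= t.+1)%N -> tball T k s -> e s \in Defs.ball g k v.
  elim: k s => [|k IH] s kt hs.
    by case: hs => _; rewrite leqn0 size_eq0 => /eqP ->; rewrite e0.
  case/lastP: s hs => [|s i] hs; first by rewrite e0.
  have [hs' iT] := tball_parent hs.
  have hs1 : tball T t.+1 s by case: hs' => h1 h2; split => //; apply: leq_trans h2 (ltnW kt).
  have hs2 : tball T t.+1 (rcons s i) by case: hs => h1 h2; split => //; apply: leq_trans h2 kt.
  rewrite /= !inE; apply/orP; right; apply/exists_inP; exists (e s).
    exact: IH (ltnW kt) hs'.
  by apply/eadj => //; left; exists i.
exists e => //; split => //.
  move=> s s' hs hs' ess'; have [_ <-] := he _ hs; have [_ <-] := he _ hs'.
  by rewrite ess'.
move=> s w hs gw; have wb : w \in Defs.ball g t.+1 v.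
  rewrite /= !inE; apply/orP; right; apply/exists_inP; exists (e s) => //.
  by apply: eball.
by exists (f w); [exact: fb|rewrite efu].
Qed.

Section Sandwich.
Variables (R : realType) (lam : R) (n : nat) (g : graph n) (T : ptree) (t : nat).
Variable e : seq nat -> 'I_n.
Hypotheses (lam_gt0 : 0 < lam) (gs : simple g) (he : tree_emb g T t e).
Let lam_ge0 : 0 <= lam := ltW lam_gt0.

Lemma emb_nbr s w : tball T t s -> (g (e s, w) <->
  (exists2 i, (i < T s)%N & w = e (rcons s i)) \/
  (exists s0 i, s = rcons s0 i /\ w = e s0)).
Proof.
move=> hs; have hs1 := tball_S hs; split.
  move=> gw; have [s' hs' ew] := emb_closed he hs gw; rewrite ew in gw.
  have [[i es']|[i es]] := (emb_adj he hs1 hs').1 gw.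
    left; exists i; last by rewrite ew es'.
    by rewrite es' in hs'; case: (tball_parent hs').
  by right; exists s', i.
move=> [[i iT ->]|[s0 [i [es ->]]]].
  by apply/(emb_adj he) => //; [exact: tball_rcons|left; exists i].
rewrite es in hs hs1 *; have hs0 : tball T t.+1 s0.
  by have [h _] := tball_parent hs1; exact: tball_S.
by apply/(emb_adj he) => //; right; exists i.
Qed.

Lemma emb_children_inj s i j : tball T t s -> (i < T s)%N -> (j < T s)%N ->
  e (rcons s i) = e (rcons s j) -> i = j.
Proof.
move=> hs iT jT /(emb_inj he (tball_rcons hs iT) (tball_rcons hs jT)).
by move=> /rcons_inj[].
Qed.

Lemma sand_RA k s (A : {set 'I_n}) : valid T s -> (size s + k <= t)%N ->
  (forall u, tball T t.+1 (s ++ u) -> e (s ++ u) \in A) ->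
  (forall s0 i, s = rcons s0 i -> e s0 \notin A) ->
  sand lam k (sub_at s T) (RA g lam A (e s)).
Proof.
elim: k s A => [|k IH] s A vs sk hA hp.
  have hs : tball T t s by split; rewrite // -[size s]addn0.
  split; first by rewrite RA_ge0 ?RA_le.
  rewrite sub_at_root => Ts; rewrite (@RA_rec _ _ _ gs _ _ _ (fun=> e s) 0%N) ?big_ord0 ?mulr1// => w wA.
  split=> [|[]//] /(emb_nbr _ hs)[[i]|[s0 [i [es ew]]]]; first by rewrite Ts.
  by have := hp _ _ es; rewrite -ew wA.
have hs : tball T t s by split; rewrite // (leq_trans _ sk)// leq_addr.
have cA i : (i < T s)%N -> e (rcons s i) \in A.
  by move=> iT; rewrite -cats1; apply: hA; rewrite cats1; exact: tball_rcons.
pose un i := e (rcons s i).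
exists (fun c => RA g lam (delnbrs A (e s) un c) (un c)).
rewrite sub_at_root; split; last first.
  apply: (RA_rec gs) => //; first by move=> i j; exact: emb_children_inj.
  move=> w wA; split=> [/(emb_nbr _ hs)[//|[s0 [i [es ew]]]]|[i iT ->]].
    by have := hp _ _ es; rewrite -ew wA.
  by apply/(emb_nbr _ hs); left; exists i.
move=> c cT; rewrite subt_sub_at; apply: IH.
- by rewrite valid_rcons vs.
- by rewrite size_rcons addSnnS.
(* The deleted vertices are [s] and the siblings before [c], none of which lies below
   [rcons s c]. *)
- move=> u hu; have hs1 := tball_S hs; rewrite !inE.
  move: hu; rewrite cat_rcons => hu; rewrite hA ?andbT//; apply/andP; split.
    apply/eqP => E; have := congr1 size (emb_inj he hu hs1 E).
    by rewrite size_cat /= addnS => /eqP; rewrite eqn_leq ltnNge leq_addr.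
  apply/allP => j; rewrite mem_iota add0n /= => jc; apply/eqP => E.
  have := emb_inj he hu (tball_rcons hs (ltn_trans jc cT)) E.
  rewrite -cats1 => /eqP; rewrite eqseq_cat// eqxx /= => /eqP[cj _].
  by rewrite cj ltnn in jc.
- by move=> s0 i /rcons_inj[<- _]; rewrite !inE eqxx.
Qed.

Lemma sand_hb k S x : sand lam k S x -> hb lam false k S <= x / (1 + x) <= hb lam true k S.
Proof.
move=> /(sand_bounds lam_ge0)/andP[h1 h2]; have h0 := bd_ge0 lam_ge0 false k S.
by rewrite !ler_odds// (le_trans h0).
Qed.

Lemma nu_sandwich : hb lam false t T <= nu g lam (e [::]) <= hb lam true t T.
Proof.
apply: sand_hb; apply: (@sand_RA t [::]) => // [u _|[|a s0] i]; rewrite ?inE//.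
Qed.

Variable p : 'I_n -> R.
Hypothesis bp : forall v, BPeq g lam p v.

(* The message from [u] to [w], as odds. *)
Definition pmsg u w : R := p u / (1 - (p u + p w)).

Lemma pmsg1 z u : g (u, z) -> (1 + pmsg z u)^-1 = 1 - p z / (1 - p u).
Proof.
move=> guz; have [/andP[u0 u1] hu _] := bp u; have h := hu _ guz.
have a0 : 1 - p u != 0 by rewrite gt_eqF// subr_gt0.
have b0 : 1 - (p z + p u) != 0 by rewrite gt_eqF// subr_gt0.
rewrite /pmsg; have -> : 1 + p z / (1 - (p z + p u)) = (1 - p u) / (1 - (p z + p u)).
  by field.
by rewrite invf_div; field.
Qed.

Lemma root_ratio u : p u / (1 - p u) = lam * \prod_(z | g (u, z)) (1 + pmsg z u)^-1.
Proof.
have [_ _ <-] := bp u; congr (_ * _).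
by apply: eq_bigr => z guz; rewrite pmsg1.
Qed.

(** Dividing the equation at [u] by the factor of [w] turns the vertex odds into the odds sent to
    [w]. *)
Lemma pmsg_rec u w : g (u, w) ->
  pmsg u w = lam * \prod_(z | g (u, z) && (z != w)) (1 + pmsg z u)^-1.
Proof.
move=> guw; have := root_ratio u; rewrite (bigD1 w)//= pmsg1// mulrCA.
have [/andP[u0 u1] hu _] := bp u; have h := hu _ guw.
have a0 : 1 - p u != 0 by rewrite gt_eqF// subr_gt0.
have b0 : 1 - (p w + p u) != 0 by rewrite gt_eqF// subr_gt0.
have c0 : 1 - p w / (1 - p u) != 0.
  have -> : 1 - p w / (1 - p u) = (1 - (p w + p u)) / (1 - p u) by field.
  by rewrite mulf_neq0// invr_neq0.
move=> e1; apply: (mulfI c0); rewrite -e1 /pmsg [p u + p w]addrC; field.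
by rewrite a0.
Qed.

Lemma pmsg_itv u w : g (u, w) -> 0 <= pmsg u w <= lam.
Proof.
move=> guw; have h z u' : g (z, u') -> 0 <= pmsg z u'.
  move=> gzu; have [/andP[/ltW z0 _] hz _] := bp z.
  rewrite divr_ge0// ltW// subr_gt0 addrC; exact: hz.
rewrite h//= pmsg_rec// ler_piMr// Num.Theory.prodr_ile1// => z /andP[guz _].
have hz : 0 <= pmsg z u by apply: h; rewrite (simple_sym gs).
by rewrite invr_ge0 addr_ge0//= invf_le1 ?ltr_wpDr// lerDl.
Qed.

(** Messages towards the root obey the tree recursion exactly, since the only neighbour of a node
    that is not a child is the recipient. Boundary values are constrained only by [pmsg_itv]. *)
Lemma sand_pmsg k s i : valid T (rcons s i) -> (size s + k < t)%N ->
  sand lam k (sub_at (rcons s i) T) (pmsg (e (rcons s i)) (e s)).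
Proof.
elim: k s i => [|k IH] s i vs sk; set s' := rcons s i.
all: have hs' : tball T t s' by split => //; rewrite size_rcons (leq_trans _ sk)// ltnS leq_addr.
all: have hs : tball T t s by case: (tball_parent (tball_S hs')).
all: have g1 : g (e s', e s) by apply/(emb_nbr _ hs'); right; exists s, i.
all: have g2 : g (e s, e s') by rewrite (simple_sym gs).
all: have rc : pmsg (e s') (e s) = lam * \prod_(c < T s') (1 + pmsg (e (rcons s' c)) (e s'))^-1.
1,3: rewrite pmsg_rec//; congr (_ * _); apply: (@big_enum_by _ _ _ _ _ (fun z => (1 + pmsg z (e s'))^-1) (fun c => e (rcons s' c))).
1,3: by move=> a b; exact: emb_children_inj.
1,2: move=> z; split.
1,3: move=> /andP[/(emb_nbr _ hs')[//|[s0 [j [es ->]]]]];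
     by move: es => /rcons_inj[<- _]; rewrite eqxx.
1,2: move=> [c cT ->]; apply/andP; split; first by apply/(emb_nbr _ hs'); left; exists c.
1,2: apply/eqP => E; have := congr1 size (emb_inj he (tball_rcons hs' cT) (tball_S hs) E);
     by rewrite !size_rcons => /eqP; rewrite eqn_leq ltnNge leqnSn.
- split; first exact: pmsg_itv.
  by rewrite sub_at_root rc => ->; rewrite big_ord0 mulr1.
- exists (fun c => pmsg (e (rcons s' c)) (e s')); rewrite sub_at_root; split => // c cT.
  rewrite subt_sub_at; apply: IH; first by rewrite valid_rcons vs.
  by rewrite size_rcons addSnnS.
Qed.

Lemma big_root (V : Type) (idx : V) (op : Monoid.com_law idx) (F : 'I_n -> V) :
  \big[op/idx]_(z | g (e [::], z)) F z = \big[op/idx]_(c < T [::]) F (e [:: val c]).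
Proof.
apply: (@big_enum_by _ _ _ _ _ F (fun c => e [:: c])).
  by move=> a b aT bT; apply: (@emb_children_inj [::]).
move=> z; rewrite (emb_nbr _ (tball_nil T t)); split=> [[//|[s0 [j [es _]]]]|h].
  by case: s0 es.
by left.
Qed.

Lemma prod_root (F : 'I_n -> R) :
  \prod_(z | g (e [::], z)) F z = \prod_(c < T [::]) F (e [:: val c]).
Proof. exact: big_root. Qed.

Lemma sum_root (F : 'I_n -> R) :
  \sum_(z | g (e [::], z)) F z = \sum_(c < T [::]) F (e [:: val c]).
Proof. exact: big_root. Qed.

Lemma sum_root_nat (F : 'I_n -> nat) :
  (\sum_(z | g (e [::], z)) F z)%N = (\sum_(c < T [::]) F (e [:: val c]))%N.
Proof. exact: big_root. Qed.

End Sandwich.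

(** * The vertex term as a function of incoming messages *)

Section VertexTerm.
Variables (R : realType) (lam : R).
Hypothesis lam_gt0 : 0 < lam.
Let lam_ge0 : 0 <= lam := ltW lam_gt0.
Implicit Types (h : nat -> R) (d : nat).

(* The vertex term as a function of the incoming messages alone, the outgoing
   ones being given by the recursion. *)
Definition Psi d h : R :=
  ln (1 + lam * \prod_(i < d) (1 - h i)) - 2^-1 * \sum_(j < d)
    (ln (1 + lam * \prod_(i < d) (1 - h i)) -
     ln (1 + lam * \prod_(i < d | i != j) (1 - h i))).

Lemma prod_sub1_itv (I : finType) (Q : pred I) (h : I -> R) :
  (forall i, 0 <= h i <= 1) -> 0 <= \prod_(i | Q i) (1 - h i) <= 1.
Proof.
move=> hh; apply/andP; split.
  by apply: prodr_ge0 => i _; rewrite subr_ge0; case/andP: (hh i).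
apply: Num.Theory.prodr_ile1 => i _; rewrite subr_ge0 gerBl.
by case/andP: (hh i) => -> ->.
Qed.

Lemma prod_sub1_lip (I : finType) (Q : pred I) (h h' : I -> R) :
  (forall i, 0 <= h i <= 1) -> (forall i, 0 <= h' i <= 1) ->
  `|\prod_(i | Q i) (1 - h i) - \prod_(i | Q i) (1 - h' i)| <= \sum_i `|h i - h' i|.
Proof.
move=> hh hh'; elim: (index_enum I) => [|i s IH].
  by rewrite !big_nil subrr normr0.
rewrite !big_cons; case: ifP => Qi; last by rewrite (le_trans IH)// lerDr.
set P := \prod_(_ <- _ | _) _ in IH *; set P' := \prod_(_ <- _ | _) _ in IH *.
have P01 : 0 <= P <= 1.
  apply/andP; split.
    by apply: prodr_ge0 => j _; rewrite subr_ge0; case/andP: (hh j).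
  apply: Num.Theory.prodr_ile1 => j _; rewrite subr_ge0 gerBl.
  by case/andP: (hh j) => -> ->.
have -> : (1 - h i) * P - (1 - h' i) * P' = (h' i - h i) * P + (1 - h' i) * (P - P').
  by ring.
case/andP: P01 => P0 P1; case/andP: (hh' i) => a0 a1.
apply: le_trans (ler_normD _ _) _; apply: lerD.
  by rewrite normrM (ger0_norm P0) distrC ler_piMr.
apply: le_trans IH; rewrite normrM ger0_norm ?subr_ge0// ler_piMl//.
by rewrite gerBl.
Qed.

Lemma ln1D_lip (x y : R) : 0 <= x -> 0 <= y -> `|ln (1 + x) - ln (1 + y)| <= `|x - y|.
Proof.
wlog xy : x y / x <= y.
  move=> H x0 y0; case: (leP x y) => [h|/ltW h]; first exact: H.
  by rewrite distrC [leRHS]distrC; exact: H.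
move=> x0 y0; have X0 : 0 < 1 + x by rewrite ltr_wpDr.
have Y0 : 0 < 1 + y by rewrite ltr_wpDr.
rewrite distrC [leRHS]distrC !ger0_norm ?subr_ge0// ?ler_ln ?posrE// ?lerD2l//.
rewrite -ln_div ?posrE//; apply: le_trans (ln_le_sub1 (divr_gt0 Y0 X0)) _.
have -> : (1 + y) / (1 + x) - 1 = (y - x) / (1 + x) by field; rewrite gt_eqF.
by rewrite ler_pdivrMr// ler_peMr ?subr_ge0// lerDl.
Qed.

(** The leading logarithm and each of the [d] halved differences move by at most [lam] times the l1
    distance, whence the factor [d.+1]. *)
Lemma Psi_lip d h h' : (forall i, (i < d)%N -> 0 <= h i <= 1) ->
  (forall i, (i < d)%N -> 0 <= h' i <= 1) ->
  `|Psi d h - Psi d h'| <= d.+1%:R * (lam * \sum_(i < d) `|h i - h' i|).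
Proof.
move=> hh hh'; set S := \sum_(i < d) _.
have S0 : 0 <= lam * S by rewrite mulr_ge0 ?sumr_ge0.
have key (Q : pred 'I_d) : `|ln (1 + lam * \prod_(i < d | Q i) (1 - h i)) -
     ln (1 + lam * \prod_(i < d | Q i) (1 - h' i))| <= lam * S.
  have i1 : 0 <= \prod_(i < d | Q i) (1 - h i) <= 1 by apply: prod_sub1_itv => i; exact: hh.
  have i2 : 0 <= \prod_(i < d | Q i) (1 - h' i) <= 1 by apply: prod_sub1_itv => i; exact: hh'.
  case/andP: i1 => p1 _; case/andP: i2 => p2 _.
  apply: le_trans (ln1D_lip _ _) _; rewrite ?mulr_ge0//.
  rewrite -mulrBr normrM ger0_norm// ler_wpM2l//.
  by apply: prod_sub1_lip => i; [exact: hh|exact: hh'].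
rewrite /Psi; set A := ln _; set A' := ln (1 + lam * \prod_(i < d) (1 - h' i)).
have hA : `|A - A'| <= lam * S by apply: key.
pose B (f : nat -> R) (j : 'I_d) := ln (1 + lam * \prod_(i < d | i != j) (1 - f i)).
have hB j : `|B h j - B h' j| <= lam * S by apply: key.
have -> : A - 2^-1 * \sum_(j < d) (A - B h j) - (A' - 2^-1 * \sum_(j < d) (A' - B h' j)) =
   (A - A') - 2^-1 * \sum_(j < d) ((A - A') - (B h j - B h' j)).
  rewrite !sumrB; ring.
apply: le_trans (ler_normB _ _) _.
rewrite -[d.+1%:R]natr1 mulrDl mul1r addrC; apply: lerD => //.
rewrite normrM ger0_norm ?invr_ge0// ler_pdivrMl//.
apply: le_trans (ler_norm_sum _ _ _) _.
apply: le_trans (_ : \sum_(j < d) 2 * (lam * S) <= _).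
  apply: ler_sum => j _; apply: le_trans (ler_normB _ _) _.
  by rewrite mulr2n mulrDl mul1r lerD.
by rewrite sumr_const card_ord -mulr_natl; lra.
Qed.

Lemma Psi_bound d h : (forall i, (i < d)%N -> 0 <= h i <= 1) ->
  `|Psi d h| <= d.+1%:R * lam.
Proof.
move=> hh.
have key (Q : pred 'I_d) : 0 <= ln (1 + lam * \prod_(i < d | Q i) (1 - h i)) <= lam.
  have i1 : 0 <= \prod_(i < d | Q i) (1 - h i) <= 1 by apply: prod_sub1_itv => i; exact: hh.
  case/andP: i1 => p1 p2; have q : 0 <= lam * \prod_(i < d | Q i) (1 - h i) by rewrite mulr_ge0.
  rewrite ln_ge0 ?lerDl//= (le_trans (le_ln1Dx _)) ?(lt_le_trans _ q)//.
  by rewrite ler_piMr.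
rewrite /Psi; set A := ln _; have /andP[A0 A1] : 0 <= A <= lam by apply: key.
apply: le_trans (ler_normB _ _) _; rewrite -[d.+1%:R]natr1 mulrDl mul1r addrC.
apply: lerD; last by rewrite ger0_norm.
rewrite normrM ger0_norm ?invr_ge0// ler_pdivrMl//.
apply: le_trans (ler_norm_sum _ _ _) _.
apply: le_trans (_ : \sum_(j < d) lam <= _).
  apply: ler_sum => j _; have /andP[h1 h2] := key (fun i => i != j).
  rewrite ler_norml; lra.
rewrite sumr_const card_ord -[lam *+ d]mulr_natl ler_peMl ?mulr_ge0//.
by rewrite ler1n.
Qed.

Lemma Psi_eq d h h' : (forall i, (i < d)%N -> h i = h' i) -> Psi d h = Psi d h'.
Proof.
move=> e; have key (Q : pred 'I_d) : \prod_(i < d | Q i) (1 - h i) = \prod_(i < d | Q i) (1 - h' i).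
  by apply: eq_bigr => i _; rewrite e.
by rewrite /Psi key; congr (_ - _ * _); apply: eq_bigr => j _; rewrite key.
Qed.

(** Ball isomorphisms may permute children, so vertex terms must not depend on the plane order. *)
Lemma Psi_perm d h (pi : nat -> nat) :
  (forall i, (i < d)%N -> (pi i < d)%N) ->
  (forall i j, (i < d)%N -> (j < d)%N -> pi i = pi j -> i = j) ->
  Psi d (h \o pi) = Psi d h.
Proof.
move=> pd pinj; pose q (i : 'I_d) : 'I_d := Ordinal (pd i (ltn_ord i)).
have qinj : injective q by move=> i j /(congr1 val) /= /pinj h'; apply/val_inj/h'.
have e1 : \prod_(i < d) (1 - (h \o pi) i) = \prod_(i < d) (1 - h i).
  by rewrite [RHS](reindex_inj qinj).
rewrite /Psi e1; congr (_ - _ * _); rewrite [RHS](reindex_inj qinj); apply: eq_bigr => j _.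
congr (_ - ln (1 + _ * _)); rewrite [RHS](reindex_inj qinj).
by apply: eq_bigl => i; rewrite (inj_eq qinj).
Qed.

(** The message from [u] to [v], as a probability, is [p u / (1 - p v)]. Dropping the factor of
    child [j] from the equation at the root gives the odds sent to [j], hence the edge term. *)
Lemma PhiV_Psi n (g : graph n) (T : ptree) t e (p : 'I_n -> R) : simple g ->
  tree_emb g T t e -> (forall v, BPeq g lam p v) ->
  PhiV g p (e [::]) = Psi (T [::]) (fun i => p (e [:: i]) / (1 - p (e [::]))).
Proof.
move=> gs he bp; set v := e [::]; have [/andP[v0 v1] hv ev] := bp v.
have gv i : (i < T [::])%N -> g (v, e [:: i]).
  by move=> iT; apply/(emb_nbr he _ (tball_nil T t)); left; exists i.
have a0 : 0 < 1 - p v by rewrite subr_gt0.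
rewrite /PhiV (sum_root he) /Psi -(prod_root he (fun z => 1 - p z / (1 - p v))) -/v ev.
have -> : 1 + p v / (1 - p v) = (1 - p v)^-1 by field; rewrite gt_eqF.
rewrite lnV ?posrE//; congr (_ - _ * _); apply: eq_bigr => j _.
have gj := gv j (ltn_ord j); have [/andP[j0 j1] _ _] := bp (e [:: val j]).
have hj := hv _ gj; have b0 : 0 < 1 - (p (e [:: val j]) + p v) by rewrite subr_gt0.
have c0 : 0 < 1 - p (e [:: val j]) by rewrite subr_gt0.
have -> : 1 + lam * \prod_(i < T [::] | i != j) (1 - p (e [:: val i]) / (1 - p v)) =
   (1 - p (e [:: val j])) / (1 - (p (e [:: val j]) + p v)).
  move: ev; rewrite (prod_root he (fun z => 1 - p z / (1 - p v))) (bigD1 j)//= mulrCA => ev.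
  have f0 : 1 - p (e [:: val j]) / (1 - p v) != 0.
    have -> : 1 - p (e [:: val j]) / (1 - p v) = (1 - (p (e [:: val j]) + p v)) / (1 - p v).
      by field; rewrite gt_eqF.
    by rewrite mulf_neq0 ?invr_neq0// gt_eqF.
  move: ev; set X := lam * _ => ev.
  have -> : X = (p v / (1 - p v)) / (1 - p (e [:: val j]) / (1 - p v)) by rewrite -ev mulrC mulKf.
  have -> : 1 - p (e [:: val j]) / (1 - p v) = (1 - (p (e [:: val j]) + p v)) / (1 - p v).
    by field; rewrite gt_eqF.
  rewrite invf_div mulrA divfK ?gt_eqF//.
  by field; rewrite gt_eqF.
rewrite ln_div ?posrE//; ring.
Qed.

End VertexTerm.

Section LocalEstimates.
Variables (R : realType) (lam : R) (n : nat) (g : graph n) (p : 'I_n -> R).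
Hypotheses (lam_gt0 : 0 < lam) (gs : simple g).
Hypothesis bp : forall v, BPeq g lam p v.
Let lam_ge0 : 0 <= lam := ltW lam_gt0.
Implicit Types (T : ptree) (t : nat) (v : 'I_n).

Lemma deg_card v : deg g v = #|nbrs g v|.
Proof.
by apply: eq_card => u; apply/idP/idP => [/set_mem|]; rewrite inE// => h; exact/mem_set.
Qed.

Lemma deg_emb T t e : tree_emb g T t e -> deg g (e [::]) = T [::].
Proof.
move=> he; rewrite deg_card -sum1_card; under eq_bigl do rewrite inE.
by rewrite (sum_root_nat he) sum1_card card_ord.
Qed.

Lemma gball_deg v t T : gball_iso g v t.+1 T -> deg g v = T [::].
Proof. by case/gball_iso_emb => e he <-; exact: deg_emb he. Qed.

Lemma odds_pmsg u v : g (v, u) -> pmsg p u v / (1 + pmsg p u v) = p u / (1 - p v).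
Proof.
move=> gvu; have [/andP[v0 v1] hv _] := bp v.
have b0 : 1 - (p u + p v) != 0 by rewrite gt_eqF// subr_gt0 hv.
have a0 : 1 - p v != 0 by rewrite gt_eqF// subr_gt0.
rewrite /pmsg.
have -> : 1 + p u / (1 - (p u + p v)) = (1 - p v) / (1 - (p u + p v)) by field.
by rewrite invf_div mulrA divfK.
Qed.

Lemma odds_root v : p v / (1 - p v) / (1 + p v / (1 - p v)) = p v.
Proof.
have [/andP[v0 v1] _ _] := bp v.
have a0 : 1 - p v != 0 by rewrite gt_eqF// subr_gt0.
have -> : 1 + p v / (1 - p v) = (1 - p v)^-1 by field.
by rewrite invrK divfK.
Qed.

Lemma child_msg_sandwich T t e i : tree_emb g T t.+1 e -> (i < T [::])%N ->
  hb lam false t (subt i T) <= p (e [:: i]) / (1 - p (e [::])) <= hb lam true t (subt i T).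
Proof.
move=> he iT; have gvi : g (e [::], e [:: i]).
  by apply/(emb_nbr he _ (tball_nil T t.+1)); left; exists i.
rewrite -odds_pmsg//; apply: sand_hb => //.
by apply: (sand_pmsg lam_gt0 gs he bp (s := [::])); rewrite /= ?iT.
Qed.

Lemma root_marginal_sandwich T t e : tree_emb g T t.+1 e ->
  hb lam false t.+1 T <= p (e [::]) <= hb lam true t.+1 T.
Proof.
move=> he; rewrite -odds_root; apply: sand_hb => //.
exists (fun c => pmsg p (e [:: c]) (e [::])); split.
  by move=> c cT; apply: (sand_pmsg lam_gt0 gs he bp (s := [::])); rewrite /= ?cT.
by rewrite (root_ratio bp) (prod_root he (fun z => (1 + pmsg p z (e [::]))^-1)).
Qed.

(** The true marginal and the Bethe marginal lie between the same two tree bounds. *)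
Lemma nu_sub_p_le v t T : gball_iso g v t.+2 T ->
  `|nu g lam v - p v| <= hb lam true t.+1 T - hb lam false t.+1 T.
Proof.
case/gball_iso_emb => e he <-.
have := nu_sandwich lam_gt0 gs he; have := root_marginal_sandwich he.
by move=> /andP[? ?] /andP[? ?]; rewrite ler_norml; lra.
Qed.

Definition msg_gap t T : R :=
  \sum_(i < T [::]) (hb lam true t (subt i T) - hb lam false t (subt i T)).

Definition Psi_low t T : R := Psi lam (T [::]) (fun i => hb lam false t (subt i T)).

Lemma PhiV_sub_Psi_le v t T : gball_iso g v t.+2 T ->
  `|PhiV g p v - Psi_low t T| <= (T [::]).+1%:R * (lam * msg_gap t T).
Proof.
case/gball_iso_emb => e he <-; rewrite (PhiV_Psi gs he bp).
apply: le_trans (Psi_lip lam_gt0 _ _) _.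
- move=> i iT; have /andP[h1 h2] := child_msg_sandwich he iT.
  have /andP[h3 _] := hb_itv lam_ge0 false t (subt i T).
  have /andP[_ h4] := hb_itv lam_ge0 true t (subt i T).
  by rewrite (le_trans h3)//= (le_trans h2)// ltW.
- by move=> i _; have /andP[-> /ltW ->] := hb_itv lam_ge0 false t (subt i T).
- apply: ler_wpM2l => //; apply: ler_wpM2l => //; apply: ler_sum => i _.
  have /andP[h1 h2] := child_msg_sandwich he (ltn_ord i).
  by rewrite ger0_norm ?subr_ge0// lerD2r.
Qed.

Lemma p_itv v : 0 < p v < 1. Proof. by have [] := bp v. Qed.

Lemma nu_sub_p_le1 v : `|nu g lam v - p v| <= 1.
Proof.
have /andP[? ?] := p_itv v; have /andP[? ?] := nu_itv g v lam_ge0.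
by rewrite ler_norml; lra.
Qed.

(** Growth linear in the degree is what uniform sparsity can control in [transfer_le]. *)
Lemma PhiV_bound v : `|PhiV g p v| <= (deg g v).+1%:R * lam.
Proof.
have /andP[v0 v1] := p_itv v; have a0 : 0 < 1 - p v by rewrite subr_gt0.
have L : 0 <= - ln (1 - p v) <= lam.
  have r0 : 0 <= p v / (1 - p v) by rewrite divr_ge0 ?ltW.
  have -> : - ln (1 - p v) = ln (1 + p v / (1 - p v)).
    by rewrite -lnV ?posrE//; congr ln; field; rewrite gt_eqF.
  rewrite ln_ge0 ?lerDl//= (le_trans (le_ln1Dx _)) ?(lt_le_trans _ r0)//.
  rewrite (root_ratio bp) ler_piMr//; apply: Num.Theory.prodr_ile1 => z gvz.
  have gzv : g (z, v) by rewrite (simple_sym gs).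
  have /andP[h _] := pmsg_itv lam_gt0 gs bp gzv.
  by rewrite invr_ge0 addr_ge0//= invf_le1 ?ltr_wpDr// lerDl.
have S u : g (v, u) -> `|ln (1 - (p u + p v)) - ln (1 - p u) - ln (1 - p v)| <= lam.
  move=> gvu; have /andP[u0 u1] := p_itv u; have [_ hv _] := bp v; have h := hv _ gvu.
  have b0 : 0 < 1 - (p u + p v) by rewrite subr_gt0.
  have c0 : 0 < 1 - p u by rewrite subr_gt0.
  have /andP[m0 m1] := pmsg_itv lam_gt0 gs bp gvu.
  have e : ln (1 - (p u + p v)) - ln (1 - p u) = - ln (1 + pmsg p v u).
    rewrite -ln_div ?posrE// -lnV ?posrE ?ltr_wpDr//; congr ln; rewrite /pmsg [p v + p u]addrC.
    have -> : 1 + p v / (1 - (p u + p v)) = (1 - p u) / (1 - (p u + p v)).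
      by field; rewrite gt_eqF.
    by rewrite invf_div.
  have l1 : 0 <= ln (1 + pmsg p v u) <= lam.
    by rewrite ln_ge0 ?lerDl//= (le_trans (le_ln1Dx _)) ?(lt_le_trans _ m0).
  rewrite e ler_norml; move: L l1; lra.
rewrite /PhiV; apply: le_trans (ler_normB _ _) _.
rewrite -[(deg g v).+1%:R]natr1 mulrDl mul1r addrC; apply: lerD.
  rewrite normrM ger0_norm ?invr_ge0// ler_pdivrMl//.
  apply: le_trans (ler_norm_sum _ _ _) _.
  apply: le_trans (_ : \sum_(u | g (v, u)) lam <= _); first exact: ler_sum.
  by rewrite sumr_nbrs_const ler_peMl ?mulr_ge0// ler1n.
by case/andP: L => L0 L1; rewrite ger0_norm.
Qed.

End LocalEstimates.

(** * Isomorphism classes of balls *)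

Section BallIsomorphism.

(** The common shape of [tball_iso] and [gball_iso], so that composition and inversion are proved
    once for trees and graphs. *)
Definition riso (U V : Type) (PU : U -> Prop) (oU : U) (EU : U -> U -> Prop)
    (PV : V -> Prop) (oV : V) (EV : V -> V -> Prop) : Prop :=
  exists f : U -> V,
    [/\ f oU = oV,
        (forall u, PU u -> PV (f u)),
        (forall u u', PU u -> PU u' -> f u = f u' -> u = u'),
        (forall v, PV v -> exists2 u, PU u & f u = v) &
        (forall u u', PU u -> PU u' -> (EU u u' <-> EV (f u) (f u')))].

Lemma riso_trans U V W PU oU EU PV oV EV PW oW EW :
  @riso U V PU oU EU PV oV EV -> @riso V W PV oV EV PW oW EW ->
  @riso U W PU oU EU PW oW EW.
Proof.
move=> [f [f0 fP fi fs fa]] [h [h0 hP hi hs ha]]; exists (h \o f); split.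
- by rewrite /= f0.
- by move=> u /fP/hP.
- by move=> u u' Pu Pu' /hi e; apply: fi => //; apply: e; exact: fP.
- move=> w /hs[v Pv <-]; have [u Pu <-] := fs _ Pv; by exists u.
- by move=> u u' Pu Pu'; rewrite fa//; apply: ha; exact: fP.
Qed.

Lemma riso_sym U V PU oU EU PV oV EV : PU oU ->
  @riso U V PU oU EU PV oV EV -> @riso V U PV oV EV PU oU EU.
Proof.
move=> Po [f [f0 fP fi fs fa]].
have [h hh] : {h : V -> U & forall v, PV v -> PU (h v) /\ f (h v) = v}.
  apply: (@choice _ _ (fun v u => PV v -> PU u /\ f u = v)) => v.
  have [Pv|nPv] := pselect (PV v); last by exists oU.
  by have [u Pu fu] := fs _ Pv; exists u.
have PVo : PV oV by rewrite -f0; exact: fP.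
exists h; split.
- by have [h1 h2] := hh _ PVo; apply: fi => //; rewrite h2.
- by move=> v /hh[].
- by move=> v v' /hh[_ e] /hh[_ e'] ee; rewrite -e -e' ee.
- move=> u Pu; exists (f u); first exact: fP.
  by have [h1 h2] := hh _ (fP _ Pu); apply: fi.
- move=> v v' /hh[h1 h2] /hh[h3 h4]; rewrite -{1}h2 -{1}h4.
  by split => /fa; apply.
Qed.

Variables (n : nat) (g : graph n).
Implicit Types (T : ptree) (t : nat).

Lemma tball_iso_sym T t T' : tball_iso T t T' -> tball_iso T' t T.
Proof. exact: riso_sym. Qed.

Lemma tball_iso_trans T t T' (T'' : ptree) :
  tball_iso T t T' -> tball_iso T' t T'' -> tball_iso T t T''.
Proof. exact: riso_trans. Qed.

Lemma tball_eq_iso T t T' : (forall s, tball T t s <-> tball T' t s) -> tball_iso T t T'.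
Proof.
move=> e; exists id; split => // [s /e//|s /e h]; by exists s.
Qed.

Lemma gball_root v t : v \in Defs.ball g t v.
Proof. by elim: t => [|t IH] /=; rewrite inE// IH. Qed.

Lemma gball_tball_iso v t T T' : gball_iso g v t T -> gball_iso g v t T' -> tball_iso T t T'.
Proof.
move=> h h'; apply: (riso_trans _ h').
apply: riso_sym h; exact: gball_root.
Qed.

End BallIsomorphism.

Section IsoChildren.
Implicit Types (T : ptree) (t i : nat) (s : seq nat).

Lemma tadj_nil s : tadj [::] s <-> exists i, s = [:: i].
Proof.
split=> [[[i ->]|[i]]|[i ->]]; first by exists i.
  by case: s.
by left; exists i.
Qed.

Lemma tadj_cons i s (s' : seq nat) : tadj (i :: s) (i :: s') <-> tadj s s'.
Proof.
split=> [[[a]|[a]]|[[a ->]|[a ->]]].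
- by case=> ->; left; exists a.
- by case=> ->; right; exists a.
- by left; exists a.
- by right; exists a.
Qed.

Lemma tball_cons T t i s : (i < T [::])%N -> tball T t.+1 (i :: s) <-> tball (subt i T) t s.
Proof. by move=> iT; rewrite /tball /= iT. Qed.

Lemma tball_iso_deg_le T t T' : tball_iso T t.+1 T' -> (T [::] <= T' [::])%N.
Proof.
move=> [f [f0 fb fi _ fa]].
have hb i : (i < T [::])%N -> tball T t.+1 [:: i] by move=> iT; split; rewrite /= ?iT.
have hf i : (i < T [::])%N -> exists2 j, (j < T' [::])%N & f [:: i] = [:: j].
  move=> iT; have : tadj (f [::]) (f [:: i]).
    by apply: (fa _ _ (tball_nil T _) (hb _ iT)).1; left; exists i.
  rewrite f0 => /tadj_nil[j e]; exists j => //.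
  by have := fb _ (hb _ iT); rewrite e => -[] /=; rewrite andbT.
pose pi i := head 0%N (f [:: i]).
have pE i : (i < T [::])%N -> (pi i < T' [::])%N /\ f [:: i] = [:: pi i].
  by move=> /hf[j jT e]; rewrite /pi e.
pose q (i : 'I_(T [::])) : 'I_(T' [::]) := Ordinal (pE i (ltn_ord i)).1.
have qi : injective q.
  move=> i j /(congr1 val) /= e; apply/val_inj.
  have [_ ei] := pE i (ltn_ord i); have [_ ej] := pE j (ltn_ord j).
  have : f [:: val i] = f [:: val j] by rewrite ei ej e.
  by move=> /(fi _ _ (hb _ (ltn_ord i)) (hb _ (ltn_ord j)))[].
by have := leq_card q qi; rewrite !card_ord.
Qed.

Lemma tball_iso_deg T t T' : tball_iso T t.+1 T' -> T [::] = T' [::].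
Proof.
move=> h; apply/eqP; rewrite eqn_leq (tball_iso_deg_le h)/=.
exact: tball_iso_deg_le (tball_iso_sym h).
Qed.

(** The permutation [pi] is read off the images of the nodes of depth one, and the isomorphism
    restricts to the subtrees below them. *)
Lemma tball_iso_children T t T' : tball_iso T t.+1 T' ->
  exists pi : nat -> nat,
    [/\ (forall i, (i < T [::])%N -> (pi i < T' [::])%N),
        (forall i j, (i < T [::])%N -> (j < T [::])%N -> pi i = pi j -> i = j) &
        (forall i, (i < T [::])%N -> tball_iso (subt i T) t (subt (pi i) T'))].
Proof.
move=> [f [f0 fb fi fs fa]].
have hb i : (i < T [::])%N -> tball T t.+1 [:: i] by move=> iT; split; rewrite /= ?iT.
pose pi i := head 0%N (f [:: i]).
have pE i : (i < T [::])%N -> (pi i < T' [::])%N /\ f [:: i] = [:: pi i].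
  move=> iT; have : tadj (f [::]) (f [:: i]).
    by apply: (fa _ _ (tball_nil T _) (hb _ iT)).1; left; exists i.
  rewrite f0 => /tadj_nil[j e]; rewrite /pi e; split => //.
  by have := fb _ (hb _ iT); rewrite e => -[] /=; rewrite andbT.
have pinj i j : (i < T [::])%N -> (j < T [::])%N -> pi i = pi j -> i = j.
  move=> iT jT e; have [_ ei] := pE i iT; have [_ ej] := pE j jT.
  have : f [:: i] = f [:: j] by rewrite ei ej e.
  by move=> /(fi _ _ (hb _ iT) (hb _ jT))[].
(* A path inside the image could leave the subtree of [pi i] only through the root, which is already
   the image of the root. *)
have fsub i s : tball T t.+1 (i :: s) -> exists s', f (i :: s) = pi i :: s'.
  elim/last_ind: s => [|s a IH] hs.
    have iT : (i < T [::])%N by case: hs => /= /andP[].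
    by exists [::]; exact: (pE i iT).2.
  have hs' : tball T t.+1 (i :: s) by apply: tball_S; exact: (@tball_parent T t (i :: s) a hs).1.
  have [s' es'] := IH hs'.
  have : tadj (f (i :: s)) (f (i :: rcons s a)) by apply: (fa _ _ hs' hs).1; left; exists a.
  rewrite es' => -[[b ->]|[b]]; first by exists (rcons s' b).
  case: (f _) (fi _ _ hs (tball_nil T t.+1)) => [|c r] h e.
    by have := h (esym f0).
  by move: e; rewrite rcons_cons => -[<- _]; exists r.
exists pi; split => // [i /pE[]//|i iT]; have [pT ep] := pE i iT.
have fE s : tball (subt i T) t s -> f (i :: s) = pi i :: behead (f (i :: s)).
  by move=> /(tball_cons _ _ iT)/fsub[s' ->].
exists (fun s => behead (f (i :: s))); split.
- by rewrite ep.
- move=> s hs; apply/(tball_cons _ _ pT); rewrite -fE//.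
  by apply: fb; apply/(tball_cons _ _ iT).
- move=> s s' hs hs' e.
  have : f (i :: s) = f (i :: s') by rewrite (fE _ hs) (fE _ hs') e.
  have h1 := (tball_cons t s iT).2 hs; have h2 := (tball_cons t s' iT).2 hs'.
  by move=> /(fi _ _ h1 h2)[].
- move=> s' /(tball_cons _ _ pT)/fs[[|a u] hu eu]; first by rewrite f0 in eu.
  have aT : (a < T [::])%N by case: hu => /= /andP[].
  have [s1 es1] := fsub _ _ hu; move: eu; rewrite es1 => -[pai es].
  have ai := pinj _ _ aT iT pai; rewrite ai in hu es1.
  by exists u; [exact/(tball_cons _ _ iT)|rewrite es1 /= es].
- move=> s s' hs hs'; rewrite -(tadj_cons i) fa; last 2 first.
  + exact/(tball_cons _ _ iT).
  + exact/(tball_cons _ _ iT).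
  by rewrite (fE _ hs) (fE _ hs') tadj_cons.
Qed.

End IsoChildren.

Section IsoInvariance.
Variables (R : realType) (lam : R).
Hypothesis lam_ge0 : 0 <= lam.
Implicit Types (T : ptree) (t i : nat).

Lemma big_children_perm (V : Type) (idx : V) (op : Monoid.com_law idx) d (F : nat -> V)
   (pi : nat -> nat) :
  (forall i, (i < d)%N -> (pi i < d)%N) ->
  (forall i j, (i < d)%N -> (j < d)%N -> pi i = pi j -> i = j) ->
  \big[op/idx]_(i < d) F (pi i) = \big[op/idx]_(i < d) F i.
Proof.
move=> pd pinj; pose q (i : 'I_d) : 'I_d := Ordinal (pd i (ltn_ord i)).
have qinj : injective q by move=> i j /(congr1 val) /= /pinj h'; apply/val_inj/h'.
by rewrite [RHS](reindex_inj qinj).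
Qed.

(** One extra level of agreement is needed because [bd] at level 0 tests whether the node has
    children. *)
Lemma bd_iso b t T T' : tball_iso T t.+1 T' -> bd lam b t T = bd lam b t T'.
Proof.
elim: t b T T' => [|t IH] b T T' h /=; first by rewrite (tball_iso_deg h).
have [pi [p1 p2 p3]] := tball_iso_children h; have dT := tball_iso_deg h.
congr (_ * _); transitivity (\prod_(c < T [::]) (1 + bd lam (~~ b) t (subt (pi c) T'))^-1).
  by apply: eq_bigr => c _; rewrite (IH _ _ _ (p3 _ (ltn_ord c))).
rewrite dT in p1 p2 *.
by rewrite (big_children_perm _ (fun c => (1 + bd lam (~~ b) t (subt c T'))^-1)).
Qed.

Lemma hb_iso b t T T' : tball_iso T t.+1 T' -> hb lam b t T = hb lam b t T'.
Proof. by move=> h; rewrite /hb (bd_iso _ h). Qed.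

Lemma msg_gap_iso t T T' : tball_iso T t.+2 T' -> msg_gap lam t T = msg_gap lam t T'.
Proof.
move=> h; have [pi [p1 p2 p3]] := tball_iso_children h; have dT := tball_iso_deg h.
transitivity (\sum_(c < T [::])
   (hb lam true t (subt (pi c) T') - hb lam false t (subt (pi c) T'))).
  by apply: eq_bigr => c _; rewrite !(hb_iso _ (p3 _ (ltn_ord c))).
rewrite /msg_gap; rewrite dT in p1 p2 *.
by rewrite (big_children_perm _ (fun c => hb lam true t (subt c T') - hb lam false t (subt c T'))).
Qed.

Lemma Psi_low_iso t T T' : tball_iso T t.+2 T' -> Psi_low lam t T = Psi_low lam t T'.
Proof.
move=> h; have [pi [p1 p2 p3]] := tball_iso_children h; have dT := tball_iso_deg h.
rewrite /Psi_low; transitivity (Psi lam (T [::]) ((fun i => hb lam false t (subt i T')) \o pi)).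
  by apply: Psi_eq => i iT /=; rewrite (hb_iso _ (p3 _ iT)).
by rewrite dT in p1 p2 *; exact: Psi_perm.
Qed.

End IsoInvariance.

(** * Measurability of local functionals *)

Section BallMeasurability.
Implicit Types (T : ptree) (s : seq nat) (t : nat).

Lemma measurable_cylinder s (Y : set nat) : measurable [set T : PT | Y (T s)].
Proof.
have -> : [set T : PT | Y (T s)] = \bigcup_(k in Y) [set T : PT | T s = k].
  apply/seteqP; split => [T /= YT|T [k Yk /= ->]//]; by exists (T s).
apply: bigcup_measurable => k _; apply: sub_sigma_algebra.
by exists s, k.
Qed.

Lemma measurable_valid s : measurable [set T : PT | valid T s].
Proof.
elim/last_ind: s => [|s i IH].
  by have -> : [set T : PT | valid T [::]] = setT by apply/seteqP; split.
have -> : [set T : PT | valid T (rcons s i)] =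
    [set T : PT | valid T s] `&` [set T : PT | [set k | (i < k)%N] (T s)].
  apply/seteqP; split => T /=; rewrite valid_rcons; first by move/andP.
  by move=> [-> ->].
by apply: measurableI => //; exact: measurable_cylinder.
Qed.

Lemma measurable_tball t s : measurable [set T : PT | tball T t s].
Proof.
case: (leqP (size s) t) => st.
  have -> : [set T : PT | tball T t s] = [set T : PT | valid T s].
    by apply/seteqP; split => T /=; [case|].
  exact: measurable_valid.
have -> : [set T : PT | tball T t s] = set0; last exact: measurable0.
by apply/seteqP; split => T //= [_]; rewrite leqNgt st.
Qed.

Fixpoint benum t T : seq (seq nat) :=
  [::] :: match t with
  | 0 => [::]
  | t'.+1 => flatten [seq [seq i :: s | s <- benum t' (subt i T)] | i <- iota 0 (T [::])]
  end.

Lemma mem_benum t T s : s \in benum t T <-> tball T t s.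
Proof.
elim: t T s => [|t IH] T s.
  rewrite /= inE; split => [/eqP ->//|[_]]; by rewrite leqn0 size_eq0.
case: s => [|i s]; first by split.
rewrite /= inE /=; split.
  move=> /flattenP[l /mapP[j]]; rewrite mem_iota add0n => /= jT -> /mapP[u hu [-> ->]].
  by apply/tball_cons => //; apply/IH.
move=> h; have iT : (i < T [::])%N by case: h => /= /andP[].
apply/flattenP; exists [seq i :: u | u <- benum t (subt i T)].
  by apply/mapP; exists i => //; rewrite mem_iota.
by apply/mapP; exists s => //; apply/IH/tball_cons.
Qed.

Lemma measurable_ball_determined t (Q : ptree -> Prop) :
  (forall T T', (forall s, tball T t s <-> tball T' t s) -> Q T -> Q T') ->
  measurable [set T : PT | Q T].
Proof.
move=> hQ; pose l k : seq (seq nat) := odflt [::] (unpickle k).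
pose D := [set k | exists2 T0, Q T0 & forall s, tball T0 t s <-> s \in l k].
have -> : [set T : PT | Q T] =
    \bigcup_(k in D) [set T : PT | forall s, tball T t s <-> s \in l k].
  apply/seteqP; split => [T /= QT|T [k [T0 QT0 h0] /= h]]; last first.
    by apply: hQ QT0 => s; rewrite h0 h.
  have lk s : tball T t s <-> s \in l (pickle (benum t T)).
    by rewrite /l pickleK /= mem_benum.
  by exists (pickle (benum t T)) => //; exists T.
apply: bigcup_measurable => k _.
pose sd j : seq nat := odflt [::] (unpickle j).
have sdK s : sd (pickle s) = s by rewrite /sd pickleK.
have -> : [set T : PT | forall s, tball T t s <-> s \in l k] =
   \bigcap_j [set T : PT | tball T t (sd j) <-> sd j \in l k].
  apply/seteqP; split => T /= h; first by move=> j _ /=; exact: h.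
  by move=> s; have := h (pickle s) I; rewrite /mkset sdK.
apply: bigcapT_measurable => j; set s := sd j.
case: (boolP (s \in l k)) => sl.
  have -> : [set T : PT | tball T t s <-> true] = [set T : PT | tball T t s].
    by apply/seteqP; split => T /=; [case=> _; apply|].
  exact: measurable_tball.
have -> : [set T : PT | tball T t s <-> false] = ~` [set T : PT | tball T t s].
  by apply/seteqP; split => T /= h; [case: h => h _ /h|split].
by apply: measurableC; exact: measurable_tball.
Qed.

Lemma measurable_iso_invariant t d (Y : measurableType d) (w : ptree -> Y) :
  (forall T T', tball_iso T t T' -> w T = w T') -> measurable_fun setT (w : PT -> Y).
Proof.
move=> hw _ B mB; rewrite setTI.
apply: (@measurable_ball_determined t (fun T => B (w T))) => T T' h.
by rewrite (hw T T')//; exact: tball_eq_iso.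
Qed.

Lemma measurable_subt i : measurable_fun setT (subt i : PT -> PT).
Proof.
apply: (@measurability _ _ PT PT setT (subt i) cylinders) => // _ [_ [s [k ->]] <-].
rewrite setTI; exact: (measurable_cylinder (i :: s) [set j | j = k]).
Qed.

End BallMeasurability.

Section BallClasses.
Variable t : nat.
Implicit Types (T : ptree).

(* The isomorphism classes of balls are numbered through their node lists, which
   form a countable type. *)
Definition brep (k : nat) : ptree :=
  xget (fun=> 0%N) [set T : ptree | unpickle k = Some (benum t T)].

Lemma brep_iso T : exists k, tball_iso T t (brep k).
Proof.
exists (pickle (benum t T)); apply: tball_eq_iso => s; rewrite /brep.
case: xgetP => [T' _ h|/(_ T) h]; last by case: h; exact: pickleK.
have [e] : Some (benum t T) = Some (benum t T') by rewrite -h; exact/esym/pickleK.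
by rewrite -!mem_benum e.
Qed.

Lemma bclass_ex T : exists k, `[< tball_iso T t (brep k) >].
Proof. by have [k h] := brep_iso T; exists k; apply/asboolP. Qed.

(** The least index of a representative is an isomorphism invariant; larger indices of the same
    class have empty fibres. *)
Definition bclass T : nat := ex_minn (bclass_ex T).

Lemma bclassP T : tball_iso T t (brep (bclass T)).
Proof. by rewrite /bclass; case: ex_minnP => k /asboolP. Qed.

Lemma bclass_iso T T' : tball_iso T t T' -> bclass T = bclass T'.
Proof.
move=> h; apply/eqP; rewrite eqn_leq; apply/andP; split.
  rewrite {1}/bclass; case: ex_minnP => k _; apply; apply/asboolP.
  exact: tball_iso_trans h (bclassP T').
rewrite {1}/bclass; case: ex_minnP => k _; apply; apply/asboolP.
exact: tball_iso_trans (tball_iso_sym h) (bclassP T).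
Qed.

Definition bfiber k : set PT := [set T | bclass T = k].

Lemma measurable_bfiber k : measurable (bfiber k).
Proof.
apply: (@measurable_ball_determined t (fun T => bclass T = k)) => T T' h <-.
by apply/esym/bclass_iso/tball_eq_iso.
Qed.

Lemma trivIset_bfiber : trivIset setT bfiber.
Proof. by move=> i j _ _ [T [<- <-]]. Qed.

Lemma bigcup_bfiber : \bigcup_k bfiber k = setT.
Proof. by apply/seteqP; split => // T _; exists (bclass T). Qed.

Lemma bfiber_rep k : bclass (brep k) = k ->
  bfiber k = [set T : PT | tball_iso T t (brep k)].
Proof.
move=> e; apply/seteqP; split => T /=; first by move=> <-; exact: bclassP.
by move=> /bclass_iso; rewrite e.
Qed.

Lemma bfiber_norep k : bclass (brep k) <> k -> bfiber k = set0.
Proof.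
move=> e; apply/seteqP; split => // T /= h; case: e.
by have := bclass_iso (bclassP T); rewrite h => <-.
Qed.

(** The second conjunct keeps only least indices, so that a vertex has at most one class. *)
Definition gfiber n (g : graph n) k (v : 'I_n) : Prop :=
  gball_iso g v t (brep k) /\ bclass (brep k) = k.

Lemma gfiber_uniq n (g : graph n) k k' v : gfiber g k v -> gfiber g k' v -> k = k'.
Proof.
move=> [h e] [h' e']; rewrite -e -e'; apply: bclass_iso.
exact: gball_tball_iso h h'.
Qed.

End BallClasses.

(** * Local weak convergence *)

Section Averages.
Variables (R : realType) (P : forall n, graph n -> R).
Arguments P : clear implicits.
Hypotheses (P_ge0 : forall n g, 0 <= P n g) (P_sum : forall n, \sum_(g : graph n) P n g = 1)
  (P_simple : forall n g, P n g != 0 -> simple g).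
Local Notation vfun := (forall n, graph n -> 'I_n -> R).
Implicit Types X Y : vfun.

Definition avg X n : R := Egraph P (fun g : graph n => n%:R^-1 * \sum_v X n g v).

Lemma Egraph_le n (f h : graph n -> R) : (forall g, simple g -> f g <= h g) ->
  Egraph P f <= Egraph P h.
Proof.
move=> fh; apply: ler_sum => g _.
have [->|/P_simple sg] := eqVneq (P n g) 0; first by rewrite !mul0r.
by rewrite ler_wpM2l// fh.
Qed.

Lemma EgraphD n (f h : graph n -> R) :
  Egraph P (fun g => f g + h g) = Egraph P f + Egraph P h.
Proof. by rewrite /Egraph -big_split; apply: eq_bigr => g _; rewrite mulrDr. Qed.

Lemma EgraphZ n c (f : graph n -> R) : Egraph P (fun g => c * f g) = c * Egraph P f.
Proof. by rewrite /Egraph mulr_sumr; apply: eq_bigr => g _; rewrite mulrCA. Qed.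

Lemma Egraph_cst n c : Egraph P (fun _ : graph n => c) = c.
Proof. by rewrite /Egraph -mulr_suml P_sum mul1r. Qed.

Lemma avg_le X Y n : (forall g v, simple g -> X n g v <= Y n g v) -> avg X n <= avg Y n.
Proof.
move=> XY; apply: Egraph_le => g sg; rewrite ler_wpM2l ?invr_ge0//.
by apply: ler_sum => v _; exact: XY.
Qed.

Lemma avgD X Y n : avg (fun n g v => X n g v + Y n g v) n = avg X n + avg Y n.
Proof.
rewrite /avg -EgraphD; apply: eq_bigr => g _.
by rewrite big_split /= mulrDr.
Qed.

Lemma avgZ X c n : avg (fun n g v => c * X n g v) n = c * avg X n.
Proof.
rewrite /avg -EgraphZ; apply: eq_bigr => g _.
by rewrite -mulr_sumr; congr (_ * _); rewrite mulrCA.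
Qed.

Lemma avg_ge0 X n : (forall g v, simple g -> 0 <= X n g v) -> 0 <= avg X n.
Proof.
move=> X0; rewrite -[leLHS](Egraph_cst n 0); apply: Egraph_le => g sg.
by rewrite mulr_ge0 ?invr_ge0// sumr_ge0// => v _; exact: X0.
Qed.

Lemma avg_cst c n : (0 < n)%N -> avg (fun _ _ _ => c) n = c.
Proof.
move=> n0; rewrite /avg -[RHS](Egraph_cst n); apply: eq_bigr => g _; congr (_ * _).
by rewrite sumr_const card_ord -[c *+ n]mulr_natl mulKf// pnatr_eq0 -lt0n.
Qed.

Lemma avg_sum K (X : nat -> vfun) n :
  avg (fun n g v => \sum_(k < K) X k n g v) n = \sum_(k < K) avg (X k) n.
Proof.
elim: K => [|K IH].
  rewrite big_ord0 /avg -[RHS](Egraph_cst n 0); apply: eq_bigr => g _; congr (_ * _).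
  by rewrite big1 ?mulr0// => v _; rewrite big_ord0.
rewrite big_ord_recr /= -IH -avgD; apply: eq_bigr => g _; congr (_ * (_ * _)).
by apply: eq_bigr => v _; rewrite big_ord_recr.
Qed.

Definition indic (E : forall n, graph n -> 'I_n -> Prop) : vfun :=
  fun n g v => if `[< E n g v >] then 1 else 0.

Lemma tail_deg_avg L n :
  tail_deg P L n = avg (fun n g v => (deg g v)%:R * ((L <= deg g v)%N)%:R) n.
Proof. by []. Qed.

End Averages.

Section Transfer.
Variables (R : realType) (P : forall n, graph n -> R) (mu : probability PT R).
Arguments P : clear implicits.
Hypothesis H : lwc P mu.

Let P_ge0 : forall n g, 0 <= P n g. Proof. by have [[]] := H. Qed.
Let P_sum : forall n, \sum_(g : graph n) P n g = 1. Proof. by have [[]] := H. Qed.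
Let P_simple : forall n g, P n g != 0 -> simple g. Proof. by have [[]] := H. Qed.

Lemma tail_deg_small eps : 0 < eps ->
  exists2 L, (0 < L)%N & \forall n \near \oo, tail_deg P L n <= eps.
Proof.
move=> e0; have [_ h _ _] := H.
have : \forall L \near \oo, (limn_esup (fun n => (tail_deg P L n)%:E) < eps%:E)%E.
  have e0' : (0 < eps%:E)%E by rewrite lte_fin.
  exact: (h _ (open_ereal_lt' e0')).
move=> [L0 _ hL]; exists (maxn L0 1); first by rewrite leq_max orbT.
have := hL (maxn L0 1) (leq_maxl _ _).
(* The limit superior is an infimum of suprema over sets of the filter; one set [V] already brings
   the supremum below [eps]. *)
rewrite /= /limn_esup /limf_esup => /ereal_inf_lt[_ [V VF <-] hV].
apply: filterS VF => n Vn; rewrite -lee_fin.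
by apply: le_trans (ltW hV); apply: ereal_sup_ubound; exists n.
Qed.

Variable t : nat.
Local Notation r := t.+1.
Let m k := fine (mu (bfiber r k)).

Lemma cvg_fiber k : avg P (indic R (fun n g => gfiber r g k)) n @[n --> \oo] --> m k.
Proof.
have [_ _ h _] := H.
have [e|e] := pselect (bclass r (brep r k) = k).
  have := h r (brep r k); rewrite /m (bfiber_rep e).
  suff -> : (fun n => avg P (indic R (fun n (g : graph n) => gfiber r g k)) n) =
    (fun n => Proot P (fun (g : graph n) v => gball_iso g v r (brep r k))) by [].
  apply/funext => n; apply: eq_bigr => g _; congr (_ * (_ * _)).
  apply: eq_bigr => v _; rewrite /indic; congr (if _ then _ else _).
  by apply: asbool_equiv_eq; split => [[]//|h']; split.
rewrite /m (bfiber_norep e) measure0 /=.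
have -> : (fun n => avg P (indic R (fun n (g : graph n) => gfiber r g k)) n) = fun=> 0.
  apply/funext => n; apply: big1 => g _; rewrite big1 ?mulr0// => v _.
  by rewrite /indic asboolF// => -[].
exact: cvg_cst.
Qed.

Lemma mu_bfiber k : mu (bfiber r k) = (m k)%:E.
Proof. by rewrite /m fineK// fin_num_measure//; exact: measurable_bfiber. Qed.

Lemma m_ge0 k : 0 <= m k. Proof. by rewrite /m fine_ge0. Qed.

Lemma avg_deg_bound : exists2 B : R, 0 <= B & \forall n \near \oo,
  avg P (fun n g v => (deg g v)%:R) n <= B.
Proof.
have [L L0 hL] := tail_deg_small (@ltr01 R); exists (L%:R + 1) => //.
near=> n; have n0 : (0 < n)%N by near: n; exists 1%N.
apply: le_trans (_ : L%:R + tail_deg P L n <= _); last first.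
  by rewrite lerD2l; near: n.
rewrite tail_deg_avg -[X in X + _](avg_cst P_sum _ n0) -avgD; apply: avg_le => // g v sg.
case: leqP => h; rewrite ?mulr1 ?mulr0 ?addr0 ?lerDr//.
by rewrite ler_nat ltnW.
Unshelve. all: by end_near. Qed.

Lemma gfiber_sum (F : nat -> R) K n (g : graph n) v k : (k < K)%N -> gfiber r g k v ->
  \sum_(j < K) F j * indic R (fun n g => gfiber r g j) g v = F k.
Proof.
move=> kK gk; rewrite (bigD1 (Ordinal kK))//= /indic asboolT// mulr1 big1 ?addr0// => j jk.
rewrite asboolF ?mulr0// => gj; case/eqP: jk; apply/val_inj => /=.
exact: gfiber_uniq gj gk.
Qed.

(** A Fatou argument over finitely many classes: the bound on the mean degree of the graphs passes
    to [mu]. All integrability under [mu] comes from here. *)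
Lemma sum_fiber_deg_bound : exists2 B : R, 0 <= B & forall K,
  \sum_(k < K) (rdeg (brep r k))%:R * m k <= B.
Proof.
have [B B0 hB] := avg_deg_bound; exists B => // K.
have cv : \sum_(k < K) (rdeg (brep r k))%:R * avg P (indic R (fun n g => gfiber r g k)) n
   @[n --> \oo] --> \sum_(k < K) (rdeg (brep r k))%:R * m k.
  apply: cvg_big => [|k _]; first exact: add_continuous.
  by apply: cvgMr; exact: cvg_fiber.
rewrite -(cvg_lim _ cv)//; apply: limr_le; first by apply/cvg_ex; eexists; exact: cv.
near=> n; apply: le_trans (_ : avg P (fun n g v => (deg g v)%:R) n <= _); last by near: n.
under eq_bigr do rewrite -avgZ.
rewrite -(avg_sum P_sum K (fun k n g v => (rdeg (brep r k))%:R * indic R (fun n g => gfiber r g k) g v)).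
apply: avg_le => // g v sg.
have [[k kK gk]|no] := pselect (exists2 k, (k < K)%N & gfiber r g k v).
  rewrite (gfiber_sum (fun k => (rdeg (brep r k))%:R) kK gk).
  by case: gk => /gball_deg -> _.
rewrite big1// => k _; rewrite /indic asboolF ?mulr0// => gk; case: no.
by exists k.
Unshelve. all: by end_near. Qed.

Section Functional.
Variables (w : ptree -> R) (C : R).
Hypotheses (C_ge0 : 0 <= C)
  (w_iso : forall T T', tball_iso T r T' -> w T = w T')
  (w_bound : forall T, `|w T| <= C * (rdeg T).+1%:R).

Lemma w_brep T : w T = w (brep r (bclass r T)).
Proof. exact/w_iso/bclassP. Qed.

Lemma integral_bfiber (F : nat -> \bar R) k :
  (\int[mu]_(T in bfiber r k) F (bclass r T) = F k * (m k)%:E)%E.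
Proof.
rewrite -mu_bfiber -(integral_cst mu (measurable_bfiber r k) (F k)).
by apply: eq_integral => T; rewrite inE => ->.
Qed.

Lemma measurable_bclass d (Y : measurableType d) (F : nat -> Y) :
  measurable_fun setT ((fun T => F (bclass r T)) : PT -> Y).
Proof.
by apply: (@measurable_iso_invariant r) => T T' h; rewrite (bclass_iso h).
Qed.

Lemma sum_bclass_bound : exists B : R, forall F : nat -> R,
  (forall k, `|F k| <= C * (rdeg (brep r k)).+1%:R) ->
  forall K, \sum_(k < K) `|F k| * m k <= B.
Proof.
have [B B0 hB] := sum_fiber_deg_bound; exists (C * (B + 1)) => F hF K.
apply: le_trans (_ : \sum_(k < K) (C * ((rdeg (brep r k))%:R * m k) + C * m k) <= _).
  apply: ler_sum => k _; rewrite mulrA -mulrDl -[X in _ + X]mulr1 -mulrDr natr1.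
  by rewrite ler_wpM2r ?m_ge0.
rewrite big_split /= -!mulr_sumr -mulrDr ler_wpM2l// lerD ?hB//.
rewrite -lee_fin -sumEFin; under eq_bigr do rewrite -mu_bfiber.
rewrite -(@measure_semi_additive _ _ _ mu (bfiber r) K)//.
- apply: probability_le1; apply: bigsetU_measurable => k _; exact: measurable_bfiber.
- by move=> k; exact: measurable_bfiber.
- exact: trivIset_bfiber.
- by apply: bigsetU_measurable => k _; exact: measurable_bfiber.
Qed.

Lemma integrable_bclass (F : nat -> R) :
  (forall k, `|F k| <= C * (rdeg (brep r k)).+1%:R) ->
  mu.-integrable setT (fun T : PT => (F (bclass r T))%:E).
Proof.
move=> hF; apply/integrableP; split; first exact: (@measurable_bclass _ _ (EFin \o F)).
have [B hB] := sum_bclass_bound.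
rewrite -(bigcup_bfiber r) ge0_integral_bigcup//; last 3 first.
- exact: measurable_bfiber.
- rewrite bigcup_bfiber.
  exact: (@measurable_bclass _ _ (fun k => `|(F k)%:E|%E)).
- exact: trivIset_bfiber.
apply: le_lt_trans (ltry B).
apply: lime_le; first by apply: is_cvg_nneseries => k _ _; exact: integral_ge0.
apply: nearW => K.
rewrite big_mkord; under eq_bigr do rewrite (integral_bfiber (fun k => `|(F k)%:E|%E)) /= -EFinM.
by rewrite sumEFin lee_fin; exact: hB.
Qed.

(** The classes partition the space of trees, so the integral is an absolutely convergent series
    over classes. *)
Lemma cvg_sum_bclass (F : nat -> R) :
  (forall k, `|F k| <= C * (rdeg (brep r k)).+1%:R) ->
  \sum_(k < K) F k * m k @[K --> \oo] --> fine (\int[mu]_T (F (bclass r T))%:E).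
Proof.
move=> hF; have iF := integrable_bclass hF.
have e : (\int[mu]_T (F (bclass r T))%:E = \sum_(0 <= k <oo) (F k * m k)%:E)%E.
  rewrite -(bigcup_bfiber r) integral_bigcup//; last 3 first.
  - exact: trivIset_bfiber.
  - exact: measurable_bfiber.
  - by rewrite bigcup_bfiber.
  by apply: eq_eseriesr => k _; rewrite (integral_bfiber (fun k => (F k)%:E)).
have cs : cvgn (series (fun k => F k * m k)).
  apply: normed_cvg; apply: nondecreasing_is_cvgn.
    by apply/nondecreasing_series => k _ _; exact: normr_ge0.
  have [B hB] := sum_bclass_bound; exists B => _ [K _ <-].
  rewrite [leLHS](_ : _ = \sum_(k < K) `|F k * m k|); last first.
    by rewrite -(big_mkord xpredT (fun k => `|F k * m k|)).
  apply: le_trans (hB _ hF K); apply: ler_sum => k _.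
  by rewrite normrM (ger0_norm (m_ge0 _)).
have -> : (fun K => \sum_(k < K) F k * m k) = series (fun k => F k * m k).
  by apply/funext => K; rewrite /series /= big_mkord.
rewrite e.
have -> : (\sum_(0 <= k <oo) (F k * m k)%:E)%E = (limn (series (fun k => F k * m k)))%:E.
  rewrite -EFin_lim//; congr (limn _); apply/funext => K.
  by rewrite /series /= sumEFin.
exact: cs.
Qed.

Lemma w_brepE : (fun T : PT => (w T)%:E) = (fun T => (w (brep r (bclass r T)))%:E).
Proof. by apply/funext => T; rewrite -w_brep. Qed.

Lemma integrable_w : mu.-integrable setT (fun T : PT => (w T)%:E).
Proof. by rewrite w_brepE; apply: (integrable_bclass (F := fun k => w (brep r k))). Qed.

Lemma cvg_sum_w : \sum_(k < K) w (brep r k) * m k @[K --> \oo] --> fine (\int[mu]_T (w T)%:E).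
Proof. by rewrite w_brepE; apply: (cvg_sum_bclass (F := fun k => w (brep r k))). Qed.

End Functional.

Lemma cvg_sum_m : \sum_(k < K) m k @[K --> \oo] --> (1 : R).
Proof.
have h (T : ptree) : `|(1 : R)| <= 1 * (rdeg T).+1%:R by rewrite normr1 mul1r ler1n.
have := @cvg_sum_w (fun=> 1) 1 ler01 (fun _ _ _ => erefl) h.
rewrite integral_cst//.
have -> : fine (1 * mu [set: PT])%E = 1 by rewrite mul1e; have -> : mu setT = 1%E by exact: probability_setT.
by under eq_fun do under eq_bigr do rewrite mul1r.
Qed.

(** The statement is one-sided since graph quantities are only bounded by tree functionals. [X] is
    compared with [w] only where the ball is a tree; elsewhere linear growth in the degree
    suffices. *)
Lemma transfer_le (w : ptree -> R) (C : R) (X : forall n, graph n -> 'I_n -> R) :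
  0 <= C -> (forall T T', tball_iso T r T' -> w T = w T') ->
  (forall T, `|w T| <= C * (rdeg T).+1%:R) ->
  (forall n (g : graph n) v, simple g -> `|X n g v| <= C * (deg g v).+1%:R) ->
  (forall n (g : graph n) v T, simple g -> gball_iso g v r T -> X n g v <= w T) ->
  forall eps, 0 < eps ->
  \forall n \near \oo, avg P X n <= fine (\int[mu]_T (w T)%:E) + eps.
Proof.
move=> C0 wi wb Xb Xw eps e0; set I := fine _.
have e4 : 0 < eps / 4 by rewrite divr_gt0.
have e5 : 0 < eps / 4 / (2 * C + 1) by rewrite divr_gt0// ltr_wpDl ?mulr_ge0.
have [L L0 hL] := tail_deg_small e5.
have D0 : 0 < C * (L%:R + 1) + 1 by rewrite ltr_wpDl ?mulr_ge0 ?addr_ge0.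
(* [K] is chosen after [L]: the mass of the omitted classes must be small compared with the bound
   [C * (L + 1)] at degrees below [L]. *)
have [K [hK1 hK2]] : exists K, \sum_(k < K) w (brep r k) * m k < I + eps / 4 /\
    1 - \sum_(k < K) m k < eps / 4 / (C * (L%:R + 1) + 1).
  have h1 := @cvg_sum_w w C C0 wi wb; have h2 := cvg_sum_m.
  near \oo => K; exists K; split.
    by near: K; apply: (cvgr_lt I) => //; rewrite ltrDl.
  rewrite ltrBlDr -ltrBlDl; near: K; apply: (cvgr_gt 1) => //.
  by rewrite ltrBlDr ltrDl divr_gt0.
pose Y := indic R (fun n (g : graph n) v => exists2 k, (k < K)%N & gfiber r g k v).
pose Rk n := \sum_(k < K) w (brep r k) * avg P (indic R (fun n g => gfiber r g k)) n.
pose Mk n := \sum_(k < K) 1 * avg P (indic R (fun n g => gfiber r g k)) n.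
have cR : Rk n @[n --> \oo] --> \sum_(k < K) w (brep r k) * m k.
  apply: cvg_big => [|k _]; first exact: add_continuous.
  by apply: cvgMr; exact: cvg_fiber.
have cM : Mk n @[n --> \oo] --> \sum_(k < K) m k.
  apply: cvg_big => [|k _]; first exact: add_continuous.
  by rewrite -[m k]mul1r; apply: cvgMr; exact: cvg_fiber.
near=> n; have n0 : (0 < n)%N by near: n; exists 1%N.
(* The three terms account for vertices of the first [K] classes, other vertices of degree below
   [L], and other vertices of degree at least [L]. *)
have b1 : avg P X n <= Rk n + C * (L%:R + 1) * (1 - Mk n) + 2 * C * tail_deg P L n.
  pose XR : forall n, graph n -> 'I_n -> R := fun n g v =>
     \sum_(k < K) w (brep r k) * indic R (fun n g => gfiber r g k) g v.
  pose XM : forall n, graph n -> 'I_n -> R := fun n g v =>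
     \sum_(k < K) 1 * indic R (fun n g => gfiber r g k) g v.
  pose XD : forall n, graph n -> 'I_n -> R := fun n g v =>
     (deg g v)%:R * ((L <= deg g v)%N)%:R.
  have eR : avg P XR n = Rk n.
    rewrite (avg_sum P_sum K (fun k n g v => w (brep r k) * indic R (fun n g => gfiber r g k) g v)).
    by apply: eq_bigr => k _; rewrite avgZ.
  have eM : avg P XM n = Mk n.
    rewrite (avg_sum P_sum K (fun k n g v => 1 * indic R (fun n g => gfiber r g k) g v)).
    by apply: eq_bigr => k _; rewrite avgZ.
  have -> : Rk n + C * (L%:R + 1) * (1 - Mk n) + 2 * C * tail_deg P L n =
    avg P (fun n g v => (XR n g v + C * (L%:R + 1) * (1 + -1 * XM n g v)) + 2 * C * XD n g v) n.
    rewrite avgD avgZ avgD eR avgZ avgD (avg_cst P_sum)// avgZ eM tail_deg_avg.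
    by rewrite mulN1r.
  apply: avg_le => // g v sg.
  have XD0 : 0 <= 2 * C * XD n g v by rewrite mulr_ge0 ?mulr_ge0.
  have [[k kK gk]|no] := pselect (exists2 k, (k < K)%N & gfiber r g k v).
    rewrite /XR /XM (gfiber_sum (fun k => w (brep r k)) kK gk) (gfiber_sum (fun k => 1) kK gk).
    rewrite mulN1r subrr mulr0 addr0; apply: le_trans (_ : w (brep r k) <= _); last by rewrite lerDl.
    by case: gk => gk _; exact: Xw.
  have z (F : nat -> R) : \sum_(k < K) F k * indic R (fun n g => gfiber r g k) g v = 0.
    rewrite big1// => k _; rewrite /indic asboolF ?mulr0// => gk; case: no.
    by exists k.
  rewrite /XR /XM (z (fun k => w (brep r k))) (z (fun=> 1)) add0r mulr0 addr0 mulr1.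
  apply: le_trans (ler_norm _) _; apply: le_trans (Xb _ _ _ sg) _.
  rewrite /XD -natr1; case: leqP => h.
    have h1 : (1 : R) <= (deg g v)%:R by rewrite ler1n (leq_trans L0).
    have h2 : C * ((deg g v)%:R + 1) <= C * (2 * (deg g v)%:R).
      by rewrite ler_wpM2l// mulr2n mulrDl mul1r lerD2l.
    have h3 : 0 <= C * (L%:R + 1) by rewrite mulr_ge0 ?addr_ge0.
    rewrite mulr1; lra.
  rewrite !mulr0 addr0 ler_wpM2l// lerD2r ler_nat ltnW//.
apply: le_trans b1 _.
have r1 : Rk n < I + eps / 4 by near: n; exact: (cvgr_lt _ cR).
have r2 : 1 - Mk n < eps / 4 / (C * (L%:R + 1) + 1).
  rewrite ltrBlDr -ltrBlDl; near: n; apply: (cvgr_gt _ cM).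
  by rewrite ltrBlDr -ltrBlDl.
have r3 : tail_deg P L n <= eps / 4 / (2 * C + 1) by near: n.
have q2 : C * (L%:R + 1) * (1 - Mk n) <= eps / 4.
  apply: le_trans (_ : C * (L%:R + 1) * (eps / 4 / (C * (L%:R + 1) + 1)) <= _).
    by apply: ler_wpM2l; [rewrite mulr_ge0 ?addr_ge0|exact: ltW].
  rewrite mulrCA ler_piMr ?(ltW e4)// ler_pdivrMr// mul1r lerDl//.
have q3 : 2 * C * tail_deg P L n <= eps / 4.
  apply: le_trans (_ : 2 * C * (eps / 4 / (2 * C + 1)) <= _).
    by apply: ler_wpM2l => //; rewrite mulr_ge0.
  rewrite mulrCA ler_piMr ?(ltW e4)// ler_pdivrMr ?mul1r ?lerDl//.
  by rewrite ltr_wpDl ?mulr_ge0.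
lra.
Unshelve. all: by end_near. Qed.

End Transfer.

(** * Measurability of messages and of the Bethe functional *)

Section MessageMeasurability.
Variables (R : realType) (lam : R).
Hypothesis lam_ge0 : 0 <= lam.
Implicit Types (T : ptree) (b : bool).

Lemma measurable_hbar b : measurable_fun setT (hbar lam b : PT -> R).
Proof.
apply: (@measurable_fun_cvg _ _ _ _ (fun t (T : PT) => hb lam b t T)).
  by move=> t; apply: (@measurable_iso_invariant t.+1) => T T' /hb_iso ->.
by move=> T _; exact: cvg_hb.
Qed.

(** Sums over children have a length depending on the tree; splitting by the root degree fixes
    it. *)
Lemma measurable_by_deg d (Y : measurableType d) (F : nat -> PT -> Y) :
  (forall k, measurable_fun setT (F k)) -> measurable_fun setT (fun T : PT => F (rdeg T) T).
Proof.
move=> mF _ B mB; rewrite setTI.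
have -> : (fun T : PT => F (rdeg T) T) @^-1` B =
   \bigcup_k ([set T : PT | [set j | j = k] (T [::])] `&` (F k @^-1` B)).
  apply/seteqP; split => [T /= h|T [k _ [/= <-]]//].
  by exists (rdeg T).
apply: bigcup_measurable => k _; apply: measurableI; first exact: measurable_cylinder.
by rewrite -[X in measurable X]setTI; exact: mF.
Qed.

Lemma measurable_remchild j : measurable_fun setT (remchild j : PT -> PT).
Proof.
apply: (@measurability _ _ PT PT setT (remchild j) cylinders) => // _ [_ [s [k ->]] <-].
rewrite setTI; case: s => [|i s] /=.
  exact: (measurable_cylinder [::] [set a | a.-1 = k]).
exact: (measurable_cylinder ((if (i < j)%N then i else i.+1) :: s) [set a | a = k]).
Qed.

Lemma PhiTE h T : PhiT lam h T =
  ln (1 + lam * \prod_(j < T [::]) (1 - h (subt j T)))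
  - 2^-1 * \sum_(j < T [::]) ln (1 - h (subt j T) * h (remchild j T)).
Proof.
rewrite /PhiT /psi /psibar /msg; congr (ln _ - _ * _).
  rewrite big_bool /= addrC mul1r; congr (_ + _ * _).
    by apply: big1 => j _; rewrite big_bool /= !mul1r addrC subrK.
  by apply: eq_bigr => j _; rewrite big_bool /= mul0r mul1r add0r.
apply: eq_bigr => j _; rewrite !big_bool /= !mul0r !mul1r add0r; congr ln.
by ring.
Qed.

Lemma measurable_PhiT b : measurable_fun setT (PhiT lam (hbar lam b) : PT -> R).
Proof.
have mh := measurable_hbar b.
pose G d (T : PT) : R := ln (1 + lam * \prod_(j < d) (1 - hbar lam b (subt j T)))
  - 2^-1 * \sum_(j < d) ln (1 - hbar lam b (subt j T) * hbar lam b (remchild j T)).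
have -> : (PhiT lam (hbar lam b) : PT -> R) = fun T => G (rdeg T) T.
  by apply/funext => T; rewrite PhiTE.
have ms j : measurable_fun setT (fun T : PT => hbar lam b (subt j T)).
  by apply: (measurableT_comp mh); exact: measurable_subt.
have mr j : measurable_fun setT (fun T : PT => hbar lam b (remchild j T)).
  by apply: (measurableT_comp mh); exact: measurable_remchild.
apply: measurable_by_deg => d; apply: measurable_funB.
  apply: measurableT_comp; first exact: measurable_ln.
  apply: measurable_funD => //; apply: measurable_funM => //.
  by apply: measurable_prod => j _; apply: measurable_funB.
apply: measurable_funM => //; apply: measurable_sum => j.
apply: measurableT_comp; first exact: measurable_ln.
by apply: measurable_funB => //; apply: measurable_funM.
Qed.

End MessageMeasurability.

(** * Uniqueness regime *)

Section Uniqueness.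
Variables (R : realType) (mu : probability PT R).
Hypothesis deg_pos : (mu [set T : PT | rdeg T = 0%N] < 1)%E.

Lemma measurable_rdeg (Y : set nat) : measurable [set T : PT | Y (rdeg T)].
Proof. exact: measurable_cylinder. Qed.

Lemma mu_deg_pos : (0 < mu [set T : PT | (0 < rdeg T)%N])%E.
Proof.
have e : [set T : PT | (0 < rdeg T)%N] = ~` [set T : PT | rdeg T = 0%N].
  by apply/seteqP; split => T /=; rewrite lt0n => /eqP.
rewrite e probability_setC; last exact: (measurable_rdeg [set k | k = 0%N]).
by rewrite sube_gt0.
Qed.

Definition up_density (A : set ptree) (T : PT) : R :=
  if (0 < rdeg T)%N then (rdeg T)%:R^-1 * \sum_(j < rdeg T) \1_A (subt j T) else 0.

Lemma up_density_itv A T : 0 <= up_density A T <= ((0 < rdeg T)%N)%:R.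
Proof.
rewrite /up_density; case: ifP => d0; last by rewrite lexx.
have dp : 0 < (rdeg T)%:R :> R by rewrite ltr0n.
apply/andP; split; first by rewrite mulr_ge0 ?invr_ge0 ?sumr_ge0.
rewrite ler_pdivrMl// mulr1; apply: le_trans (_ : \sum_(j < rdeg T) 1 <= _).
  by apply: ler_sum => j _; rewrite indicE; case: (_ \in _).
by rewrite sumr_const card_ord.
Qed.

Lemma measurable_up_density (A : set PT) : measurable A -> measurable_fun setT (up_density A).
Proof.
move=> mA; apply: (measurable_by_deg (F := fun d (T : PT) =>
  if (0 < d)%N then d%:R^-1 * \sum_(j < d) \1_A (subt j T) else 0 : R)) => d.
case: (0 < d)%N; last exact: measurable_cst.
apply: measurable_funM => //; apply: measurable_sum => j.
apply: (@measurableT_comp _ _ _ _ _ _ (\1_A : PT -> R)); last exact: measurable_subt.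
exact: measurable_indic.
Qed.

(** [up_density] is at most the indicator of positive degree, and full mass forces almost sure
    equality. An average of indicators equal to 1 then puts every child subtree in [A]. *)
Lemma mu_up_ge1_ae (A : set PT) : measurable A -> (1 <= mu_up mu A)%E ->
  \forall T \ae mu, forall j, (j < rdeg T)%N -> A (subt j T).
Proof.
move=> mA h; pose q := fine (mu [set T : PT | (0 < rdeg T)%N]).
have mD : measurable [set T : PT | (0 < rdeg T)%N] by exact: (measurable_rdeg [set k | (0 < k)%N]).
have qE : mu [set T : PT | (0 < rdeg T)%N] = q%:E by rewrite fineK// fin_num_measure.
have q0 : 0 < q by rewrite -lte_fin -qE mu_deg_pos.
have mf : measurable_fun setT (fun T : PT => (up_density A T)%:E).
  by apply/measurable_EFinP; exact: measurable_up_density.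
have mi : measurable_fun setT (fun T : PT => (((0 < rdeg T)%N)%:R : R)%:E).
  apply/measurable_EFinP.
  exact: (measurable_by_deg (F := fun d (_ : PT) => ((0 < d)%N)%:R : R)).
have i1 : (\int[mu]_T (((0 < rdeg T)%N)%:R : R)%:E = q%:E)%E.
  rewrite -qE -(setIT [set T : PT | (0 < rdeg T)%N]) -integral_indic//.
  apply: eq_integral => T _; rewrite indicE; congr (_%:R%:E).
  by apply/esym; case: (boolP (0 < rdeg T)%N) => hT; [rewrite mem_set|rewrite memNset// => /= ; apply/negP].
have i2 : (q%:E <= \int[mu]_T (up_density A T)%:E)%E.
  move: h; rewrite /mu_up -/q muleC lee_pdivlMl// mule1.
  by apply.
have bT : mu.-integrable setT (fun T : PT => (((0 < rdeg T)%N)%:R : R)%:E).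
  apply/integrableP; split => //.
  under eq_integral do rewrite gee0_abs ?lee_fin//.
  by rewrite i1 ltry.
have iT : mu.-integrable setT (fun T : PT => (up_density A T)%:E).
  apply: le_integrable bT => // T _; have /andP[a1 a2] := up_density_itv A T.
  by rewrite !gee0_abs ?lee_fin.
have z : (\int[mu]_T `|(((0 < rdeg T)%N)%:R - up_density A T)%:E| = 0)%E.
  under eq_integral => T _.
    rewrite gee0_abs; last by rewrite lee_fin subr_ge0; case/andP: (up_density_itv A T).
    over.
  under eq_integral do rewrite EFinB.
  rewrite integralB//; apply/eqP; rewrite eq_le; apply/andP; split.
    by rewrite i1 leeBlDr ?add0e//; apply: integrable_fin_num.
  rewrite sube_ge0; last by rewrite integrable_fin_num.
  by apply: ge0_le_integral => // T _; rewrite lee_fin; case/andP: (up_density_itv A T).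
have mz : measurable_fun setT (fun T : PT => (((0 < rdeg T)%N)%:R - up_density A T)%:E).
  apply/measurable_EFinP; apply: measurable_funB; exact/measurable_EFinP.
move/(ae_eq_integral_abs _ measurableT mz) : z.
apply: filterS => T hT j jT; have [e] := hT I.
have d0 : (0 < rdeg T)%N by apply: leq_ltn_trans jT.
move: e; rewrite /up_density d0 /= => /eqP; rewrite subr_eq0 => /eqP e.
have dp : (rdeg T)%:R != 0 :> R by rewrite pnatr_eq0 -lt0n.
have s : \sum_(j < rdeg T) (1 - \1_A (subt j T)) = 0 :> R.
  rewrite sumrB sumr_const card_ord -[_ *+ _]mulr_natl mulr1 [X in _ - X](_ : _ = (rdeg T)%:R) ?subrr//.
  by apply: (mulfI (invr_neq0 dp)); rewrite -e mulVf.
have /psumr_eq0P := s; move=> /(_ _ (Ordinal jT) isT) /=.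
rewrite indicE; case: (boolP (_ \in A)) => [/set_mem//|_] /(_ _)/eqP.
rewrite subr0 oner_eq0 => H; exfalso; apply: notF; apply: H => i _.
by rewrite indicE; case: (_ \in _); rewrite subr_ge0.
Qed.

(** Were the mass at [l'] below 1, [l'] would belong to the set defining the threshold, whose
    infimum exceeds [l]. *)
Lemma below_lam_c_unique (l l' : R) : 0 <= l' -> l' <= l -> (l%:E < lam_c mu)%E ->
  \forall T \ae mu, forall j, (j < rdeg T)%N -> h0 l' (subt j T) = h1 l' (subt j T).
Proof.
move=> l0 ll hl; apply: (@mu_up_ge1_ae [set T | h0 l' T = h1 l' T]).
  rewrite (_ : mkset _ = ((fun T : PT => h0 l' T - h1 l' T) @^-1` [set 0])).
    rewrite -[X in measurable X]setTI; apply: measurable_funB => //; exact: measurable_hbar.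
  apply/seteqP; split => T /=; first by move=> ->; rewrite subrr.
  by move/eqP; rewrite subr_eq0 => /eqP.
rewrite leNgt; apply/negP => h; move: hl; apply/negP; rewrite -leNgt.
apply: le_trans (_ : (l'%:E <= _)%E); last by rewrite lee_fin.
by apply: ereal_inf_lbound; exists l'.
Qed.

End Uniqueness.

Section UniqueTree.
Variables (R : realType) (lam : R) (T : ptree).
Hypothesis lam_gt0 : 0 < lam.
Let lam_ge0 : 0 <= lam := ltW lam_gt0.
Hypothesis hU : forall j, (j < rdeg T)%N -> h0 lam (subt j T) = h1 lam (subt j T).

Lemma hbar_child_unique b j : (j < T [::])%N -> hbar lam b (subt j T) = h0 lam (subt j T).
Proof. by case: b => // jT; rewrite [RHS]hU. Qed.

(** [mu_up] concerns only subtrees at neighbours of the root; the recursion carries uniqueness to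
    the root marginal. *)
Lemma hbar_root_unique : hbar lam false T = hbar lam true T.
Proof.
rewrite !hbar_rec//=.
suff -> : \prod_(c < T [::]) (1 - hbar lam true (subt c T)) =
  \prod_(c < T [::]) (1 - hbar lam false (subt c T)) by [].
by apply: eq_bigr => c _; rewrite !hbar_child_unique.
Qed.

Lemma prod_remchild d j (F : nat -> R) : (j < d)%N ->
  \prod_(c < d.-1) F (if (c < j)%N then val c else c.+1) = \prod_(i < d | val i != j) F i.
Proof.
case: d => // d jd; pose j0 := Ordinal jd.
rewrite [RHS]big_mkcond /= (bigD1_ord j0)//= eqxx mul1r.
apply: eq_bigr => c _; have := neq_lift j0 c; rewrite eq_sym -val_eqE /= => ->.
by congr F; rewrite /= /bump; case: ltnP => h; rewrite ?add0n ?add1n.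
Qed.

Lemma hbar_remchild b j : (j < T [::])%N ->
  hbar lam b (remchild j T) =
  let x := lam * \prod_(i < T [::] | val i != j) (1 - h0 lam (subt i T)) in x / (1 + x).
Proof.
move=> jT; rewrite hbar_rec//=.
suff -> : \prod_(c < (T [::]).-1) (1 - hbar lam (~~ b) (subt c (remchild j T))) =
   \prod_(i < T [::] | val i != j) (1 - h0 lam (subt i T)) by [].
rewrite -(prod_remchild (fun i => 1 - h0 lam (subt i T)) jT).
apply: eq_bigr => c _; congr (1 - _); rewrite -(hbar_child_unique (~~ b)); first by [].
case: (ltnP c j) => cj; first exact: ltn_trans cj jT.
by have := ltn_ord c; rewrite ltn_predRL.
Qed.

(** The message from the root to child [j] is determined by the other children; inserting it turns
    the edge term of [PhiT] into the difference of logarithms in [Psi]. *)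
Lemma PhiT_Psi b : PhiT lam (hbar lam b) T = Psi lam (T [::]) (fun i => h0 lam (subt i T)).
Proof.
rewrite PhiTE /Psi.
have -> : \prod_(j < T [::]) (1 - hbar lam b (subt j T)) = \prod_(i < T [::]) (1 - h0 lam (subt i T)).
  by apply: eq_bigr => j _; rewrite hbar_child_unique.
congr (_ - _ * _); apply: eq_bigr => j _.
rewrite hbar_child_unique// hbar_remchild//=.
have h01 i : 0 <= h0 lam (subt i T) <= 1.
  by have /andP[-> _] := hbar_itv lam_ge0 false (subt i T); rewrite ltW// hbar_lt1.
have pe : \prod_(i < T [::] | val i != val j) (1 - h0 lam (subt i T)) =
  \prod_(i < T [::] | i != j) (1 - h0 lam (subt i T)) by apply: eq_bigl.
have p0 : 0 <= \prod_(i < T [::] | i != j) (1 - h0 lam (subt i T)).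
  by apply: prodr_ge0 => i _; rewrite subr_ge0; case/andP: (h01 i).
have hj0 : 0 <= 1 - h0 lam (subt j T) by rewrite subr_ge0; case/andP: (h01 j).
rewrite pe [X in ln (1 + _ * X) - _](bigD1 j)//=.
set p := \prod_(i < _ | _) _ in p0 *; set h := h0 _ _ in hj0 *.
have X0 : 0 < 1 + lam * p by rewrite ltr_wpDr// mulr_ge0.
rewrite -ln_div ?posrE// ?ltr_wpDr ?mulr_ge0//; congr ln.
by field; rewrite gt_eqF.
Qed.

Lemma cvg_hb_child b i : (i < T [::])%N -> hb lam b t (subt i T) @[t --> \oo] --> h0 lam (subt i T).
Proof. by move=> iT; rewrite -(hbar_child_unique b iT); exact: cvg_hb. Qed.

Lemma cvg_msg_gap : msg_gap lam t T @[t --> \oo] --> (0 : R).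
Proof.
rewrite -[X in _ --> X](_ : \sum_(i < T [::]) (h0 lam (subt i T) - h0 lam (subt i T)) = 0).
  apply: cvg_big => [|i _]; first exact: add_continuous.
  by apply: cvgB; exact: cvg_hb_child.
by apply: big1 => i _; rewrite subrr.
Qed.

Lemma cvg_Psi_low : Psi_low lam t T @[t --> \oo] --> Psi lam (T [::]) (fun i => h0 lam (subt i T)).
Proof.
have h01 b t i : 0 <= hb lam b t (subt i T) <= 1.
  by have /andP[-> /ltW] := hb_itv lam_ge0 b t (subt i T).
have H01 i : 0 <= h0 lam (subt i T) <= 1.
  by have /andP[-> _] := hbar_itv lam_ge0 false (subt i T); rewrite ltW// hbar_lt1.
have cp (Q : pred 'I_(T [::])) :
  ln (1 + lam * \prod_(i < T [::] | Q i) (1 - hb lam false t (subt i T))) @[t --> \oo] -->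
  ln (1 + lam * \prod_(i < T [::] | Q i) (1 - h0 lam (subt i T))).
  apply: continuous_cvg.
    apply: continuous_ln; rewrite ltr_wpDr// mulr_ge0// prodr_ge0// => i _.
    by rewrite subr_ge0; case/andP: (H01 i).
  apply: cvgD; first exact: cvg_cst.
  apply: cvgMr; apply: cvg_big => [|i _]; first exact: mul_continuous.
  by apply: cvgB; [exact: cvg_cst|exact: cvg_hb_child].
apply: cvgB; first exact: (cp xpredT).
apply: cvgMr; apply: cvg_big => [|j _]; first exact: add_continuous.
by apply: cvgB; [exact: (cp xpredT)|exact: (cp (fun i => i != j))].
Qed.

End UniqueTree.

Section BetheMaximum.
Variables (R : realType) (lam : R) (n : nat) (g : graph n).

Definition bethe_max : 'I_n -> R :=
  xget (fun=> 0) [set p | (forall v, BPeq g lam p v) /\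
     (forall q, feasible g q -> Bethe g lam q <= Bethe g lam p)].

Hypotheses (lam_gt0 : 0 < lam) (gs : simple g).

Lemma bethe_maxP : (forall v, BPeq g lam bethe_max v) /\
     (forall q, feasible g q -> Bethe g lam q <= Bethe g lam bethe_max).
Proof.
rewrite /bethe_max; case: xgetP => [p _ //|H].
have [p fp pm] := Bethe_maximizer g lam.
by case: (H p); split => //; exact: maximizer_BPeq.
Qed.

End BetheMaximum.

Lemma ae_imply (R : realType) (mu : probability PT R) (Q Q' : PT -> Prop) :
  (forall T, Q T -> Q' T) -> (\forall T \ae mu, Q T) -> \forall T \ae mu, Q' T.
Proof.
move=> QQ; apply: (@negligibleS _ _ _ mu) => T /= h hQ.
by apply: h; exact: QQ.
Qed.

(** * Passage to the local limit *)

Section Limits.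
Variables (R : realType) (P : forall n, graph n -> R) (mu : probability PT R).
Arguments P : clear implicits.
Hypothesis H : lwc P mu.
Variable lam : R.
Hypotheses (lam_gt0 : 0 < lam)
  (hU : \forall T \ae mu, forall j, (j < rdeg T)%N -> h0 lam (subt j T) = h1 lam (subt j T)).
Let lam_ge0 : 0 <= lam := ltW lam_gt0.
Let P_simple : forall n g, P n g != 0 -> simple g. Proof. by have [[]] := H. Qed.

(** The dominating function is linear in the root degree, hence integrable by
    [sum_fiber_deg_bound]. *)
Lemma dominated_fine (v_ : nat -> ptree -> R) (v : PT -> R) (C : R) : 0 <= C ->
  (forall t T T', tball_iso T t.+2 T' -> v_ t T = v_ t T') ->
  (forall t T, `|v_ t T| <= C * (rdeg T).+1%:R) ->
  measurable_fun setT v ->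
  (\forall T \ae mu, v_ t T @[t --> \oo] --> v T) ->
  mu.-integrable setT (fun T : PT => (v T)%:E) /\
  fine (\int[mu]_T (v_ t T)%:E) @[t --> \oo] --> fine (\int[mu]_T (v T)%:E).
Proof.
move=> C0 vi vb mv vc.
have ig : mu.-integrable setT (fun T : PT => (C * (rdeg T).+1%:R)%:E).
  apply: (@integrable_w _ _ _ H 0%N (fun T => C * (rdeg T).+1%:R) C) => // [T T' h|T].
    by rewrite /rdeg (tball_iso_deg h).
  by rewrite ger0_norm// mulr_ge0.
have m_ t : measurable_fun setT (fun T : PT => (v_ t T)%:E).
  by apply/measurable_EFinP; exact: (measurable_iso_invariant (vi t)).
have mV : measurable_fun setT (fun T : PT => (v T)%:E) by exact/measurable_EFinP.
have cV : \forall T \ae mu, setT T -> (v_ t T)%:E @[t --> \oo] --> (v T)%:E.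
  by apply: ae_imply vc => T h _; apply: cvg_EFin => //; exact: nearW.
have bV : \forall T \ae mu, forall t, setT T -> (`|(v_ t T)%:E| <= (C * (rdeg T).+1%:R)%:E)%E.
  by apply: aeW => T t _; rewrite lee_fin.
have [i1 _ i2] := dominated_convergence measurableT m_ mV cV ig bV.
have fi : (\int[mu]_T (v T)%:E)%E \is a fin_num by exact: integrable_fin_num.
by split => //; apply: fine_cvg; rewrite fineK.
Qed.

Let bp n (g : graph n) : simple g -> forall v, BPeq g lam (bethe_max lam g) v.
Proof. by move=> /(bethe_maxP lam_gt0)[]. Qed.

(** The depth [t] is fixed first, so that the gap of the root bounds has small mean under [mu]; only
    then does [n] grow. *)
Lemma avg_nu_sub_p eps : 0 < eps -> \forall n \near \oo,
  avg P (fun n g v => `|nu g lam v - bethe_max lam g v|) n <= eps.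
Proof.
move=> e0; have e2 : 0 < eps / 2 by rewrite divr_gt0.
pose w t T := hb lam true t.+1 T - hb lam false t.+1 T.
have wi t T T' : tball_iso T t.+2 T' -> w t T = w t T' by move=> h; rewrite /w !(hb_iso _ _ h).
have wb t T : `|w t T| <= 1 * (rdeg T).+1%:R.
  have /andP[a1 a2] := hb_itv lam_ge0 true t.+1 T.
  have /andP[b1 b2] := hb_itv lam_ge0 false t.+1 T.
  apply: le_trans (_ : 1 <= _); last by rewrite mul1r ler1n.
  by rewrite /w ler_norml; lra.
have [_ c0] := @dominated_fine w (fun=> 0) 1 ler01 wi wb (measurable_cst _) ltac:(
  apply: ae_imply hU => T hT; rewrite -[X in _ --> X](subrr (hbar lam false T));
  rewrite {1}(hbar_root_unique lam_gt0 hT);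
  apply: cvgB; rewrite (cvg_shiftS (fun t => hb lam _ t T)); exact: cvg_hb).
move: c0; rewrite integral0 /= => c0.
have [t wt] : exists t, fine (\int[mu]_T (w t T)%:E) < eps / 2.
  near \oo => t; exists t; near: t; exact: (cvgr_lt _ c0).
have := @transfer_le _ _ _ H t.+1 (w t) 1 (fun n g v => `|nu g lam v - bethe_max lam g v|)
  ler01 (wi t) (wb t).
move=> /(_ _ _ _ e2) h; apply: filterS (h _ _) => [n hn|n g v sg|n g v T sg hT].
- apply: le_trans hn _; lra.
- rewrite normr_id mul1r; apply: le_trans (nu_sub_p_le1 lam_gt0 (bp sg) v) _.
  by rewrite ler1n.
- exact: (nu_sub_p_le lam_gt0 sg (bp sg) hT).
Unshelve. all: by end_near. Qed.

Lemma msg_gap_ge0 t T : 0 <= msg_gap lam t T.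
Proof. by apply: sumr_ge0 => i _; rewrite subr_ge0; exact: hb_false_le_true. Qed.

(** Degree times [msg_gap] may be quadratic in the degree and so fail to be integrable. The cap
    [2 * lam] is free, because both vertex terms are at most [lam] times degree plus one. *)
Definition gap_error t T : R := (rdeg T).+1%:R * Num.min (2 * lam) (lam * msg_gap lam t T).

Lemma gap_error_itv t T : 0 <= gap_error t T <= (2 * lam) * (rdeg T).+1%:R.
Proof.
rewrite /gap_error mulr_ge0 ?le_min ?mulr_ge0 ?msg_gap_ge0//=.
by rewrite mulrC ler_wpM2r// ge_min lexx.
Qed.

Lemma Psi_low_bound t T : `|Psi_low lam t T| <= (rdeg T).+1%:R * lam.
Proof.
apply: Psi_bound => // i _.
by have /andP[-> /ltW] := hb_itv lam_ge0 false t (subt i T).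
Qed.

Lemma cvg_Psi_low_ae b :
  \forall T \ae mu, Psi_low lam t T @[t --> \oo] --> PhiT lam (hbar lam b) T.
Proof. by apply: ae_imply hU => T hT; rewrite PhiT_Psi//; exact: cvg_Psi_low. Qed.

Lemma integrable_PhiT b : mu.-integrable setT (fun T : PT => (PhiT lam (hbar lam b) T)%:E).
Proof.
have [] := @dominated_fine (Psi_low lam) (PhiT lam (hbar lam b)) lam lam_ge0 _ _
  (measurable_PhiT lam_ge0 b) (cvg_Psi_low_ae b); last by [].
- by move=> t T T'; exact: Psi_low_iso.
- by move=> t T; rewrite mulrC; exact: Psi_low_bound.
Qed.

(** The signs [s = 1] and [s = -1] give the upper and the lower estimate from the one-sided
    [transfer_le]. *)
Lemma transfer_Phi (s : R) b : `|s| = 1 -> forall eps, 0 < eps -> \forall n \near \oo,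
  s * avg P (fun n g v => PhiV g (bethe_max lam g) v) n <=
  s * fine (\int[mu]_T (PhiT lam (hbar lam b) T)%:E) + eps.
Proof.
move=> s1 eps e0; have e2 : 0 < eps / 2 by rewrite divr_gt0.
have l3 : 0 <= 3 * lam by rewrite mulr_ge0.
pose w t T := s * Psi_low lam t T + gap_error t T.
have wi t T T' : tball_iso T t.+2 T' -> w t T = w t T'.
  move=> h; rewrite /w /gap_error /rdeg (Psi_low_iso _ h) (msg_gap_iso _ h).
  by rewrite (tball_iso_deg h).
have wb t T : `|w t T| <= (3 * lam) * (rdeg T).+1%:R.
  have /andP[a1 a2] := gap_error_itv t T; have a3 := Psi_low_bound t T.
  apply: le_trans (ler_normD _ _) _; rewrite normrM s1 mul1r (ger0_norm a1).
  apply: le_trans (lerD a3 a2) _; lra.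
have cw : \forall T \ae mu, w t T @[t --> \oo] --> s * PhiT lam (hbar lam b) T.
  apply: ae_imply hU => T hT; rewrite -[X in _ --> X]addr0; apply: cvgD.
    by apply: cvgMr; rewrite PhiT_Psi//; exact: cvg_Psi_low.
  rewrite -[X in _ --> X](mulr0 (rdeg T).+1%:R); apply: cvgMr.
  have c0 : lam * msg_gap lam t T @[t --> \oo] --> (0 : R).
    by rewrite -[X in _ --> X](mulr0 lam); apply: cvgMr; exact: cvg_msg_gap.
  apply: (squeeze_cvgr _ (cvg_cst 0) c0); apply: nearW => t.
  by rewrite le_min !mulr_ge0 ?msg_gap_ge0//= ge_min lexx orbT.
have mPhi := measurable_PhiT lam_ge0 b.
have [_ c0] := dominated_fine l3 wi wb (measurable_funM (measurable_cst s) mPhi) cw.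
have iPhi := integrable_PhiT b.
have iE : fine (\int[mu]_T (s * PhiT lam (hbar lam b) T)%:E) =
   s * fine (\int[mu]_T (PhiT lam (hbar lam b) T)%:E).
  under eq_integral do rewrite EFinM.
  by rewrite integralZl// fineM// integrable_fin_num.
have [t wt] : exists t, fine (\int[mu]_T (w t T)%:E) <
    s * fine (\int[mu]_T (PhiT lam (hbar lam b) T)%:E) + eps / 2.
  near \oo => t; exists t; near: t; apply: (cvgr_lt _ c0).
  by rewrite -iE ltrDl.
have := @transfer_le _ _ _ H t.+1 (w t) (3 * lam)
  (fun n g v => s * PhiV g (bethe_max lam g) v) l3 (wi t) (wb t).
move=> /(_ _ _ _ e2) h; apply: filterS (h _ _) => [n|n g v sg|n g v T sg hT].
- by rewrite avgZ => hn; apply: le_trans hn _; lra.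
- rewrite normrM s1 mul1r; apply: le_trans (PhiV_bound lam_gt0 sg (bp sg) v) _.
  by rewrite mulrC ler_wpM2r// ler_peMl// ler1n.
- rewrite /w -lerBlDl -mulrBr; apply: le_trans (ler_norm _) _.
  rewrite normrM s1 mul1r /gap_error /rdeg minr_pMr// le_min.
  rewrite (PhiV_sub_Psi_le lam_gt0 sg (bp sg) hT) andbT.
  have a1 := PhiV_bound lam_gt0 sg (bp sg) v; have a2 := Psi_low_bound t T.
  rewrite (gball_deg hT) in a1.
  apply: le_trans (ler_normB _ _) _; rewrite /rdeg in a2; lra.
Unshelve. all: by end_near. Qed.

Lemma cvg_avg_PhiV b : avg P (fun n g v => PhiV g (bethe_max lam g) v) n @[n --> \oo] -->
  fine (\int[mu]_T (PhiT lam (hbar lam b) T)%:E).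
Proof.
apply/cvgrPdist_le => eps e0.
have h1 := transfer_Phi b (normr1 R) e0.
have h2 := transfer_Phi b (normrN1 R) e0.
by apply: filterS2 h1 h2 => n; rewrite !mul1r !mulN1r ler_norml; lra.
Qed.

End Limits.

(** * Comparison of the two free energies *)

Section FreeEnergy.
Variables (R : realType) (P : forall n, graph n -> R) (mu : probability PT R).
Arguments P : clear implicits.
Hypothesis H : lwc P mu.
Let P_ge0 : forall n g, 0 <= P n g. Proof. by have [[]] := H. Qed.
Let P_sum : forall n, \sum_(g : graph n) P n g = 1. Proof. by have [[]] := H. Qed.
Let P_simple : forall n g, P n g != 0 -> simple g. Proof. by have [[]] := H. Qed.
Let P_deg : (mu [set T : PT | rdeg T = 0%N] < 1)%E. Proof. by have [] := H. Qed.

Definition bethe_density (lam : R) n : R :=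
  avg P (fun n g v => PhiV g (bethe_max lam g) v) n.
Definition occ (lam : R) n : R := avg P (fun n g v => nu g lam v) n.
Definition bethe_occ (lam : R) n : R := avg P (fun n g v => bethe_max lam g v) n.

Lemma phin_Egraph (lam : R) n :
  phin P lam n = Egraph P (fun g : graph n => n%:R^-1 * ln (Zg lam g)).
Proof. by rewrite /phin -EgraphZ. Qed.

Lemma phin_subgradient (l l' : R) n : 0 < l -> 0 < l' ->
  phin P l n + (ln l' - ln l) * occ l n <= phin P l' n.
Proof.
move=> l0 l0'; rewrite !phin_Egraph /occ /avg -EgraphZ -EgraphD.
apply: Egraph_le => // g sg; rewrite mulrCA -mulrDr ler_wpM2l//.
exact: lnZ_subgradient.
Qed.

Lemma bethe_density_Egraph (l : R) n : 0 < l -> bethe_density l n =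
  Egraph P (fun g : graph n => n%:R^-1 * Bethe g l (bethe_max l g)).
Proof.
move=> l0; apply/eqP; rewrite eq_le; apply/andP; split; apply: Egraph_le => // g sg;
  by rewrite (Bethe_BP sg l0 (bethe_maxP l0 sg).1).
Qed.

Lemma bethe_density_subgradient (l l' : R) n : 0 < l -> 0 < l' ->
  bethe_density l n + (ln l' - ln l) * bethe_occ l n <= bethe_density l' n.
Proof.
move=> l0 l0'; rewrite !bethe_density_Egraph// /bethe_occ /avg -EgraphZ -EgraphD.
apply: Egraph_le => // g sg; rewrite mulrCA -mulrDr ler_wpM2l//.
rewrite -Bethe_affine; apply: (bethe_maxP l0' sg).2.
exact: (BP_feasible sg (bethe_maxP l0 sg).1).
Qed.

Lemma inv_mul_natr_le n (x : R) : 0 <= x -> n%:R^-1 * (n%:R * x) <= x.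
Proof.
case: n => [|n] x0; first by rewrite invr0 mul0r.
by rewrite mulKf// pnatr_eq0.
Qed.

Lemma phin_itv (l : R) n : 0 <= l -> 0 <= phin P l n <= l.
Proof.
move=> l0; rewrite phin_Egraph; apply/andP; split.
  rewrite -[leLHS](Egraph_cst P_sum n); apply: Egraph_le => // g sg.
  by rewrite mulr_ge0// ln_ge0// Zg_ZA ZA_ge1.
rewrite -[leRHS](Egraph_cst P_sum n); apply: Egraph_le => // g sg.
apply: le_trans (inv_mul_natr_le n l0); rewrite ler_wpM2l//.
have Z1 := ZA_ge1 g finset.setT l0; have Z2 := ZA_le sg finset.setT l0.
rewrite cardsT card_ord in Z2; rewrite Zg_ZA.
apply: le_trans (_ : ln ((1 + l) ^+ n) <= _).
  by rewrite ler_ln ?posrE ?exprn_gt0 ?ltr_wpDr// (lt_le_trans _ Z1).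
rewrite lnXn ?ltr_wpDr// -[_ *+ n]mulr_natl ler_wpM2l// le_ln1Dx// (lt_le_trans _ l0)//.
Qed.

Lemma bethe_density_itv (l : R) n : 0 < l -> 0 <= bethe_density l n <= l.
Proof.
move=> l0; have l0' := ltW l0; rewrite bethe_density_Egraph//; apply/andP; split.
  rewrite -[leLHS](Egraph_cst P_sum n); apply: Egraph_le => // g sg.
  rewrite mulr_ge0// -(Bethe_zero g l); apply: (bethe_maxP l0 sg).2.
  exact: zero_feasible.
rewrite -[leRHS](Egraph_cst P_sum n); apply: Egraph_le => // g sg.
apply: le_trans (inv_mul_natr_le n l0'); rewrite ler_wpM2l//.
apply: le_trans (Bethe_le sg l0 (bethe_maxP l0 sg).1) _.
by rewrite ler_wpM2l// le_ln1Dx// (lt_le_trans _ l0').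
Qed.

Lemma avg_itv (X : forall n, graph n -> 'I_n -> R) n :
  (forall g v, simple g -> 0 <= X n g v <= 1) -> 0 <= avg P X n <= 1.
Proof.
move=> h; apply/andP; split.
  by apply: avg_ge0 => // g v sg; have /andP[] := h g v sg.
rewrite -[leRHS](Egraph_cst P_sum n); apply: Egraph_le => // g sg.
apply: le_trans (inv_mul_natr_le n ler01); rewrite ler_wpM2l//.
apply: le_trans (_ : \sum_(v < n) 1 <= _).
  by apply: ler_sum => v _; have /andP[] := h g v sg.
by rewrite sumr_const card_ord mulr1.
Qed.

Lemma occ_itv (l : R) n : 0 < l -> 0 <= occ l n <= 1.
Proof. by move=> l0; apply: avg_itv => g v sg; apply: nu_itv => //; exact: ltW. Qed.

Lemma bethe_occ_itv (l : R) n : 0 < l -> 0 <= bethe_occ l n <= 1.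
Proof.
move=> l0; apply: avg_itv => g v sg.
by have /andP[/ltW -> /ltW ->] := p_itv (bethe_maxP l0 sg).1 v.
Qed.

Lemma occ_sub_le (l : R) n : `|occ l n - bethe_occ l n| <=
  avg P (fun n g v => `|nu g l v - bethe_max l g v|) n.
Proof.
have e : occ l n - bethe_occ l n =
    avg P (fun n g v => nu g l v + -1 * bethe_max l g v) n.
  by rewrite avgD avgZ mulN1r.
have hN (Y : forall n, graph n -> 'I_n -> R) : - avg P Y n = avg P (fun n g v => -1 * Y n g v) n.
  by rewrite avgZ mulN1r.
rewrite ler_norml e hN; apply/andP; split; apply: avg_le => // g v _.
  by rewrite !mulN1r lerNl -normrN ler_norm.
by rewrite mulN1r ler_norm.
Qed.

(* [r] and [r'] are subgradients of convex functions [a] and [b] at the points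
   of a subdivision of step [d]. *)
Lemma subdivision_compare (a b r r' : nat -> R) (d : R) N : 0 <= d ->
  (forall i, (i < N)%N -> a i.+1 - d * r i.+1 <= a i) ->
  (forall i, (i < N)%N -> b i + d * r' i <= b i.+1) ->
  a N - b N <= a 0%N - b 0%N + d * (r N - r 0%N) + d * \sum_(i < N) `|r i - r' i|.
Proof.
move=> d0; elim: N => [|N IH] ha hb; first by rewrite big_ord0 subrr !mulr0 !addr0.
have h1 := IH (fun i h => ha i (ltnW h)) (fun i h => hb i (ltnW h)).
have h2 := ha N (ltnSn N); have h3 := hb N (ltnSn N).
have h4 : d * (r N - r' N) <= d * `|r N - r' N| by rewrite ler_wpM2l// ler_norm.
rewrite big_ord_recr /=; lra.
Qed.

Lemma near_forall_lt N (Q : nat -> nat -> Prop) :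
  (forall i, (i < N)%N -> \forall n \near \oo, Q i n) ->
  \forall n \near \oo, forall i, (i < N)%N -> Q i n.
Proof.
elim: N => [|N IH] h; first exact: nearW.
have h1 := IH (fun i hi => h i (ltnW hi)); have h2 := h N (ltnSn N).
apply: filterS2 h1 h2 => n h1 h2 i; rewrite ltnS leq_eqVlt => /predU1P[->//|].
exact: h1.
Qed.

Lemma phin_sub_bethe (l : R) : 0 < l ->
  (forall l', 0 < l' -> l' <= l -> \forall T \ae mu, forall j, (j < rdeg T)%N ->
     h0 l' (subt j T) = h1 l' (subt j T)) ->
  phin P l n - bethe_density l n @[n --> \oo] --> (0 : R).
Proof.
move=> l0 hU; apply/cvgrPdist_le => eps e0.
pose d := eps / 4; have d0 : 0 < d by rewrite divr_gt0.
pose K := Num.truncn (l / (d * d)); pose N := K.+1.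
have lN : l * expR (- (N%:R * d)) <= d.
  (* Then [N * d] exceeds [l / d], and [expR (N * d) >= N * d] brings the initial fugacity down to
     at most [d]. *)
  have h1 : l / (d * d) < N%:R by apply: truncnS_gt; rewrite ltW// divr_gt0// mulr_gt0.
  rewrite expRN ler_pdivrMr ?expR_gt0//.
  apply: le_trans (_ : d * (N%:R * d) <= _).
    by move: h1; rewrite ltr_pdivrMr ?mulr_gt0// => /ltW h1; apply: le_trans h1 _; lra.
  rewrite ler_wpM2l ?(ltW d0)//; apply: le_trans (expR_ge1Dx _).
  by rewrite lerDr.
pose lam i : R := l * expR (- ((N - i)%:R * d)).
have lam0 i : 0 < lam i by rewrite mulr_gt0// expR_gt0.
have laml i : lam i <= l.
  by rewrite /lam ler_piMr ?(ltW l0)// -expR0 ler_expR oppr_le0 mulr_ge0// ltW.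
have lnlam i : (i < N)%N -> ln (lam i.+1) - ln (lam i) = d.
  move=> iN; rewrite /lam !lnM ?posrE ?expR_gt0// !expRK.
  have -> : (N - i)%N = (N - i.+1).+1 by rewrite subnSK.
  by rewrite -natr1; ring.
have lamN : lam N = l by rewrite /lam subnn mul0r oppr0 expR0 mulr1.
have lam0d : lam 0%N <= d by rewrite /lam subn0.
(* With this tolerance at each of the grid points, the sum of all slope errors stays below 1. *)
have hN : 0 < (N.+1%:R : R)^-1 by rewrite invr_gt0.
have near1 : \forall n \near \oo, forall i, (i < N.+1)%N ->
    `|occ (lam i) n - bethe_occ (lam i) n| <= (N.+1%:R)^-1.
  apply: near_forall_lt => i _.
  apply: filterS (avg_nu_sub_p H (lam0 i) (hU _ (lam0 i) (laml i)) hN) => n.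
  by apply: le_trans; exact: occ_sub_le.
apply: filterS near1 => n hn; rewrite sub0r normrN.
have sumle (f : nat -> nat) : (forall i, (i < N)%N -> (f i < N.+1)%N) ->
    \sum_(i < N) `|occ (lam (f i)) n - bethe_occ (lam (f i)) n| <= 1.
  move=> fN; apply: le_trans (_ : \sum_(i < N) (N.+1%:R)^-1 <= _).
    by apply: ler_sum => i _; apply: hn; exact: fN.
  rewrite sumr_const card_ord -[_ *+ N]mulr_natl ler_pdivrMr// mul1r ler_nat//.
have s1 := sumle id (fun i h => leqW h).
have sa i : (i < N)%N -> phin P (lam i.+1) n - d * occ (lam i.+1) n <= phin P (lam i) n.
  move=> iN; have := phin_subgradient n (lam0 i.+1) (lam0 i).
  by rewrite -opprB lnlam// mulNr.
have sa' i : (i < N)%N -> phin P (lam i) n + d * occ (lam i) n <= phin P (lam i.+1) n.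
  by move=> iN; have := phin_subgradient n (lam0 i) (lam0 i.+1); rewrite lnlam.
have sb i : (i < N)%N -> bethe_density (lam i.+1) n - d * bethe_occ (lam i.+1) n <= bethe_density (lam i) n.
  move=> iN; have := bethe_density_subgradient n (lam0 i.+1) (lam0 i).
  by rewrite -opprB lnlam// mulNr.
have sb' i : (i < N)%N -> bethe_density (lam i) n + d * bethe_occ (lam i) n <= bethe_density (lam i.+1) n.
  by move=> iN; have := bethe_density_subgradient n (lam0 i) (lam0 i.+1); rewrite lnlam.
pose fa i := phin P (lam i) n; pose fb i := bethe_density (lam i) n.
pose fr i := occ (lam i) n; pose fr' i := bethe_occ (lam i) n.
have c1 := @subdivision_compare fa fb fr fr' d N (ltW d0) sa sb'.
have c2 := @subdivision_compare fb fa fr' fr d N (ltW d0) sb sa'.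
rewrite /fa /fb /fr /fr' lamN in c1 c2.
have e1 : \sum_(i < N) `|bethe_occ (lam i) n - occ (lam i) n| =
  \sum_(i < N) `|occ (lam i) n - bethe_occ (lam i) n| by apply: eq_bigr => i _; rewrite distrC.
rewrite e1 in c2.
have ds1 : d * \sum_(i < N) `|occ (lam i) n - bethe_occ (lam i) n| <= d.
  by rewrite ler_piMr// ltW.
have /andP[oc1 oc2] := occ_itv n l0; have /andP[oc3 oc4] := occ_itv n (lam0 0%N).
have /andP[oc5 oc6] := bethe_occ_itv n l0; have /andP[oc7 oc8] := bethe_occ_itv n (lam0 0%N).
have /andP[p1 p2] := phin_itv n (ltW (lam0 0%N)).
have /andP[p3 p4] := bethe_density_itv n (lam0 0%N).
have q1 : d * (occ l n - occ (lam 0%N) n) <= d by rewrite ler_piMr ?(ltW d0)// lerBlDr (le_trans oc2)// lerDl.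
have q2 : d * (bethe_occ l n - bethe_occ (lam 0%N) n) <= d by rewrite ler_piMr ?(ltW d0)// lerBlDr (le_trans oc6)// lerDl.
(* Three errors of size [d] arise: the initial difference, the telescoped slopes, and the sum of
   slope errors; the fourth is slack. *)
have e4 : eps = 4 * d by rewrite /d; field.
rewrite ler_norml e4.
move: c1 c2 ds1 q1 q2 p1 p2 p3 p4 lam0d; clear; lra.
Qed.

Lemma phin_cvg_Phi (l : R) b : 0 < l ->
  (forall l', 0 < l' -> l' <= l -> \forall T \ae mu, forall j, (j < rdeg T)%N ->
     h0 l' (subt j T) = h1 l' (subt j T)) ->
  phin P l n @[n --> \oo] --> fine (Phi_mu mu l (hbar l b)) /\
  Phi_mu mu l (hbar l b) \is a fin_num.
Proof.
move=> l0 hU; split; last first.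
  by apply: integrable_fin_num => //; apply: (integrable_PhiT H l0); exact: hU.
have h1 := phin_sub_bethe l0 hU; have h2 := @cvg_avg_PhiV _ _ _ H l l0 (hU l l0 (lexx l)) b.
rewrite -[X in _ --> X]add0r.
under eq_fun => n do rewrite -[phin P l n](subrK (bethe_density l n)).
exact: cvgD h1 h2.
Qed.

Lemma Star_of_unique (l : R) : 0 < l ->
  (forall l', 0 < l' -> l' <= l -> \forall T \ae mu, forall j, (j < rdeg T)%N ->
     h0 l' (subt j T) = h1 l' (subt j T)) ->
  cvgn (phin P l) /\
  ((limn (phin P l))%:E = Phi_mu mu l (h0 l) /\ (limn (phin P l))%:E = Phi_mu mu l (h1 l)).
Proof.
move=> l0 hU; have [c0 f0] := phin_cvg_Phi false l0 hU.
have [c1 f1] := phin_cvg_Phi true l0 hU.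
split; first by apply/cvg_ex; eexists; exact: c0.
rewrite (cvg_lim (@Rhausdorff R) c0); split; first exact: fineK f0.
by rewrite -(cvg_lim (@Rhausdorff R) c0) (cvg_lim (@Rhausdorff R) c1); exact: fineK f1.
Qed.

Lemma Star_below_lam_c (l : R) : 0 < l -> (l%:E < lam_c mu)%E ->
  cvgn (phin P l) /\
  ((limn (phin P l))%:E = Phi_mu mu l (h0 l) /\ (limn (phin P l))%:E = Phi_mu mu l (h1 l)).
Proof.
move=> l0 lc; apply: Star_of_unique => // l' l0' ll.
by apply: (below_lam_c_unique P_deg _ ll lc); exact: ltW.
Qed.

Lemma phin_increment (l l' : R) n : 0 < l' -> l' <= l ->
  0 <= phin P l n - phin P l' n <= ln l - ln l'.
Proof.
move=> l0 ll; have l0' := lt_le_trans l0 ll.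
have d0 : 0 <= ln l - ln l' by rewrite subr_ge0 ler_ln ?posrE.
have h1 := phin_subgradient n l0 l0'; have h2 := phin_subgradient n l0' l0.
have /andP[a1 a2] := occ_itv n l0; have /andP[b1 b2] := occ_itv n l0'.
have c1 : 0 <= (ln l - ln l') * occ l' n by rewrite mulr_ge0.
have c2 : (ln l - ln l') * occ l n <= ln l - ln l' by rewrite ler_piMr.
rewrite -opprB mulNr in h2; lra.
Qed.

(** [phin] is 1-Lipschitz in [ln l] uniformly in [n], so convergence at a slightly smaller fugacity
    makes the sequence at [l] Cauchy. *)
Lemma phin_boundary (l : R) : 0 < l -> (forall l', 0 < l' -> l' < l -> cvgn (phin P l')) ->
  cvgn (phin P l) /\
  forall l', 0 < l' -> l' < l ->
    0 <= limn (phin P l) - limn (phin P l') <= ln l - ln l'.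
Proof.
move=> l0 hc; have cv : cvgn (phin P l).
  apply/cauchy_cvgP/cauchy_exP => eps e0.
  pose l' := l * expR (- (eps / 2)).
  have e2 : 0 < eps / 2 by rewrite divr_gt0.
  have l0' : 0 < l' by rewrite mulr_gt0// expR_gt0.
  have ll : l' < l by rewrite /l' gtr_pMr// -[ltRHS]expR0 ltr_expR oppr_lt0.
  have dl : ln l - ln l' = eps / 2.
    by rewrite /l' lnM ?posrE ?expR_gt0// expRK; ring.
  exists (limn (phin P l')).
  have hn : \forall n \near \oo, `|limn (phin P l') - phin P l' n| < eps / 2.
    by have /cvgrPdist_lt := hc l' l0' ll; apply.
  suff : \forall n \near \oo, ball (limn (phin P l')) eps (phin P l n) by [].
  apply: filterS hn => n hn; rewrite /ball /= /ball_.
  have := phin_increment n l0' (ltW ll); rewrite dl.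
  by move: hn; rewrite !ltr_norml; move=> /andP[? ?] /andP[? ?]; lra.
split => // l' l0' ll; have cv' := hc l' l0' ll.
have cd : phin P l n - phin P l' n @[n --> \oo] --> limn (phin P l) - limn (phin P l').
  exact: cvgB cv cv'.
rewrite -(cvg_lim _ cd)//; apply/andP; split.
  apply: limr_ge; first by apply/cvg_ex; eexists; exact: cd.
  by apply: nearW => n; have /andP[] := phin_increment n l0' (ltW ll).
apply: limr_le; first by apply/cvg_ex; eexists; exact: cd.
by apply: nearW => n; have /andP[] := phin_increment n l0' (ltW ll).
Qed.

Lemma lam_c_ge0 : (0 <= lam_c mu)%E.
Proof. by apply: le_ereal_inf_tmp => _ [l [l0 _] <-]; rewrite lee_fin. Qed.

Lemma limn_phin_left_continuous (l : R) : 0 <= l ->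
  (forall l', 0 < l' -> l' < l -> cvgn (phin P l')) ->
  cvgn (phin P l) /\
  (fun l => limn (phin P l)) @ within (fun x => 0 < x) (l^'-) --> limn (phin P l).
Proof.
(* At [l = 0] the densities vanish and the filter is degenerate: no positive [x] lies to the left of
   0. *)
rewrite le_eqVlt => /predU1P[<-|l0] hc.
  split.
    have -> : phin P 0 = fun=> 0.
      by apply/funext => n; apply/eqP; rewrite eq_le andbC; exact: phin_itv.
    exact: is_cvg_cst.
  move=> A _; suff : \forall x \near 0^'-, 0 < x -> A (limn (phin P x)) by [].
  near=> x => x0; exfalso.
  have : x < 0 by near: x; exact: nbhs_left_lt.
  by rewrite ltNge ltW.
have [cv hb] := phin_boundary l0 hc; split => //.
move=> A /nbhs_ballP[eps /= e0 hA].
suff : \forall x \near l^'-, 0 < x -> A (limn (phin P x)) by [].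
have cl : \forall x \near l^'-, `|ln l - ln x| < eps.
  apply: cvg_within; have /cvgrPdist_lt := continuous_ln l0; exact.
near=> x => x0; apply: hA; rewrite /ball /=.
have xl : x < l by near: x; exact: nbhs_left_lt.
have /andP[a1 a2] := hb x x0 xl; rewrite ger0_norm//; apply: le_lt_trans a2 _.
by apply: le_lt_trans (ler_norm _) _; near: x.
Unshelve. all: by end_near. Qed.

End FreeEnergy.

(** * Regular trees *)

Section TwoCycles.
Variable R : realType.
Implicit Types (l x y z u : R) (k n : nat).

Lemma bernoulli n u : -1 <= u -> 1 + n%:R * u <= (1 + u) ^+ n.
Proof.
move=> u1; have u0 : 0 <= 1 + u by rewrite addrC -lerBlDr sub0r.
elim: n => [|n IH]; first by rewrite mul0r addr0.
rewrite exprS; apply: le_trans (ler_wpM2l u0 IH).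
have : 0 <= n%:R * (u * u) by rewrite mulr_ge0// -expr2 sqr_ge0.
rewrite -natr1; lra.
Qed.

Lemma bernoulli_lt n u : (1 < n)%N -> -1 < u -> u != 0 -> 1 + n%:R * u < (1 + u) ^+ n.
Proof.
case: n => // -[//|n] _ u1 un; have u0 : 0 < 1 + u by rewrite addrC -ltrBlDr sub0r.
rewrite exprS; apply: lt_le_trans (ler_wpM2l (ltW u0) (bernoulli n.+1 (ltW u1))).
have : 0 < (n.+1)%:R * (u * u).
  by rewrite mulr_gt0// -expr2 exprn_even_gt0.
rewrite -[n.+2%:R]natr1; lra.
Qed.

(* The fugacity [l] at which the slope of [z |-> l / (1 + z) ^+ k] at its fixed
   point equals [-1]; the fixed point is then [(k - 1)^-1]. *)
Definition crit_fug k : R := (k.-1)%:R^-1 * (1 + (k.-1)%:R^-1) ^+ k.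

(** The left side is the tangent line to [a ^+ k.+1] at [1 + (k.-1)%:R^-1]; after rescaling this is
    Bernoulli's inequality. *)
Lemma crit_tangent k a : (1 < k)%N -> 0 < a ->
  crit_fug k * ((k%:R ^+ 2 - 1) * a - k%:R ^+ 2) <= a ^+ k.+1 /\
  (a != 1 + (k.-1)%:R^-1 ->
   crit_fug k * ((k%:R ^+ 2 - 1) * a - k%:R ^+ 2) < a ^+ k.+1).
Proof.
case: k => // -[//|k] _ a0; rewrite /crit_fug /=.
set q : R := k.+1%:R; have q0 : 0 < q by rewrite ltr0n.
have kq : k.+2%:R = q + 1 :> R by rewrite /q natr1.
pose a1 := 1 + q^-1; have a10 : 0 < a1 by rewrite addr_gt0// invr_gt0.
pose u := a / a1 - 1.
have au : a = a1 * (1 + u) by rewrite /u addrC subrK mulrC divfK// gt_eqF.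
have u1 : -1 < u by rewrite /u ltrBrDr addNr divr_gt0.
have e : q^-1 * (1 + q^-1) ^+ k.+2 * ((k.+2%:R ^+ 2 - 1) * a - k.+2%:R ^+ 2) =
    a1 ^+ k.+3 * (1 + k.+3%:R * u).
  have a1E : a1 * q = q + 1 by rewrite /a1; field; rewrite gt_eqF.
  have -> : k.+3%:R = q + 2 :> R by rewrite /q -addn2 natrD -natr1.
  rewrite -/a1 (exprS a1 k.+2) kq /u mulrAC; set b := a1 ^+ k.+2.
  rewrite /a1; field; rewrite !gt_eqF//=.
rewrite e {1 3}au !exprMn; split.
  by rewrite ler_wpM2l ?exprn_ge0 ?(ltW a10)//; apply: bernoulli; exact: ltW.
move=> ne; rewrite ltr_pM2l ?exprn_gt0//; apply: bernoulli_lt => //.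
apply: contra ne => /eqP u0.
by rewrite au u0 addr0 mulr1.
Qed.

Lemma no_two_cycle k l x y : (1 < k)%N -> 0 < l -> l <= crit_fug k ->
  0 < x -> x <= y -> x * (1 + y) ^+ k = l -> y * (1 + x) ^+ k = l -> x = y.
Proof.
move=> k1 l0 lc x0; rewrite le_eqVlt => /predU1P[//|xy] ex ey; exfalso.
have y0 : 0 < y := lt_trans x0 xy.
(* Up to the constant [ln l] this is [ln (f (f z)) - ln z] for [f z = l / (1 + z) ^+ k], so both
   points of a 2-cycle give the value [- ln l]. *)
pose N z := (k ^ 2)%:R * ln (1 + z) - k%:R * ln ((1 + z) ^+ k + l) - ln z.
pose N' z := (k ^ 2)%:R * (1 + z)^-1
  - k%:R * (k%:R * (1 + z) ^+ k.-1 / ((1 + z) ^+ k + l)) - z^-1.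
have dN z : 0 < z -> is_derive z 1 N (N' z).
  move=> z0; have z1 : 0 < 1 + z by rewrite addr_gt0.
  have z2 : 0 < (1 + z) ^+ k + l by rewrite addr_gt0// exprn_gt0.
  have e1 : (fun z => 1 + z) = (cst 1 : R -> R) + id by [].
  have d1 : is_derive z 1 (fun z => 1 + z) 1.
    by rewrite e1; apply: is_derive_eq; rewrite add0r.
  have d2 : is_derive z 1 (fun z => ln (1 + z)) ((1 + z)^-1).
    have := @is_derive1_comp _ (@ln R) (fun z => 1 + z) z _ _ (is_derive1_ln z1) d1.
    by rewrite mulr1.
  have e3 : (fun z => (1 + z) ^+ k + l) = ((fun z => 1 + z) : R -> R) ^+ k + cst l.
    by apply/funext => y'; rewrite !fctE.
  have d3 : is_derive z 1 (fun z => (1 + z) ^+ k + l) (k%:R * (1 + z) ^+ k.-1).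
    by rewrite e3; apply: is_derive_eq; rewrite addr0 /GRing.scale /= mulr1.
  have d4 : is_derive z 1 (fun z => ln ((1 + z) ^+ k + l))
      (((1 + z) ^+ k + l)^-1 * (k%:R * (1 + z) ^+ k.-1)).
    exact: (@is_derive1_comp _ (@ln R) (fun z => (1 + z) ^+ k + l) z _ _ (is_derive1_ln z2) d3).
  have d5 := is_derive1_ln z0.
  have e5 : N = (k ^ 2)%:R *: (fun z => ln (1 + z)) - k%:R *: (fun z => ln ((1 + z) ^+ k + l)) - @ln R.
    by [].
  rewrite e5; apply: is_derive_eq; rewrite /N' /GRing.scale /=.
  by rewrite [_^-1 * (k%:R * _)]mulrC.
have N'E z : 0 < z -> N' z = (l * ((k%:R ^+ 2 - 1) * (1 + z) - k%:R ^+ 2) - (1 + z) ^+ k.+1)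
     / (z * (1 + z) * ((1 + z) ^+ k + l)).
  move=> z0; have z1 : 0 < 1 + z by rewrite addr_gt0.
  have z2 : 0 < (1 + z) ^+ k + l by rewrite addr_gt0// exprn_gt0.
  rewrite /N' natrX -(prednK (ltnW k1 : (0 < k)%N)) /=.
  rewrite -(prednK (ltnW k1 : (0 < k)%N)) in z2.
  move: (k.-1.+1)%:R => K; rewrite !(exprS (1 + z)) in z2 *.
  move: ((1 + z) ^+ k.-1) z2 => q z2.
  by field; rewrite !gt_eqF.
have N'le z : 0 < z -> N' z <= 0 /\ (z != (k.-1)%:R^-1 -> N' z < 0).
  move=> z0; have z1 : 0 < 1 + z by rewrite addr_gt0.
  have D0 : 0 < z * (1 + z) * ((1 + z) ^+ k + l).
    by rewrite !mulr_gt0// addr_gt0// exprn_gt0.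
  have [h1 h2] := crit_tangent k1 z1.
  (* Replacing [l] by [crit_fug k] is monotone only when the bracket is nonnegative; otherwise the
     product is at most 0. *)
  have h3 : l * ((k%:R ^+ 2 - 1) * (1 + z) - k%:R ^+ 2) <=
     Num.max 0 (crit_fug k * ((k%:R ^+ 2 - 1) * (1 + z) - k%:R ^+ 2)).
    case: (leP 0 ((k%:R ^+ 2 - 1) * (1 + z) - k%:R ^+ 2)) => h.
      by rewrite le_max ler_wpM2r ?orbT.
    by rewrite le_max nmulr_lle0// (ltW l0).
  have p0 : 0 < (1 + z) ^+ k.+1 by rewrite exprn_gt0.
  rewrite N'E// pmulr_lle0 ?invr_gt0// subr_le0; split.
    by apply: le_trans h3 _; rewrite ge_max (ltW p0).
  move=> ne; rewrite pmulr_llt0 ?invr_gt0// subr_lt0; apply: le_lt_trans h3 _.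
  by rewrite gt_max p0 h2//; apply: contra ne => /eqP/addrI ->.
have N0 a b : 0 < a -> 0 < b -> a * (1 + b) ^+ k = l -> b * (1 + a) ^+ k = l ->
    N a = - ln l.
  move=> a0 b0 ea eb; have a1 : 0 < 1 + a by rewrite addr_gt0.
  have b1 : 0 < 1 + b by rewrite addr_gt0.
  have la : ln l = ln a + k%:R * ln (1 + b).
    by rewrite -ea lnM ?posrE ?exprn_gt0// lnXn// mulr_natl.
  have lb : ln ((1 + a) ^+ k + l) = k%:R * ln (1 + a) + ln (1 + b).
    have <- : (1 + a) ^+ k * (1 + b) = (1 + a) ^+ k + l by rewrite mulrDr mulr1 -eb [b * _]mulrC.
    by rewrite lnM ?posrE ?exprn_gt0// lnXn// mulr_natl.
  by rewrite /N lb la natrX; ring.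
have mvt a b : 0 < a -> a < b -> exists2 c, a < c < b & N b - N a = N' c * (b - a).
  move=> a0 ab.
  have hD z : z \in `]a, b[ -> is_derive z 1 N (N' z).
    by rewrite in_itv /= => /andP[az _]; apply: dN; exact: lt_trans az.
  have hC : {within `[a, b], continuous N}.
    apply: derivable_within_continuous => z; rewrite in_itv /= => /andP[az _].
    by have [] := dN z (lt_le_trans a0 az).
  by have [c] := MVT ab hD hC; rewrite in_itv /= => cab e; exists c.
(* Equal end values and nonpositive slopes give a point of zero slope in each half of [[x], [y]];
   yet the slope can vanish at one point only. *)
pose m := (x + y) / 2.
have xm : x < m by rewrite /m; lra.
have my : m < y by rewrite /m; lra.
have [c1 /andP[xc1 c1m] E1] := mvt x m x0 xm.
have [c2 /andP[mc2 c2y] E2] := mvt m y (lt_trans x0 xm) my.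
have c10 : 0 < c1 by exact: lt_trans xc1.
have c20 : 0 < c2 by apply: lt_trans mc2; exact: lt_trans c1m.
have [n1 s1] := N'le c1 c10; have [n2 s2] := N'le c2 c20.
have q1 : N' c1 * (m - x) <= 0 by rewrite mulr_le0_ge0// subr_ge0 ltW.
have q2 : N' c2 * (y - m) <= 0 by rewrite mulr_le0_ge0// subr_ge0 ltW.
have Nx := N0 x y x0 y0 ex ey; have Ny := N0 y x y0 x0 ey ex.
have z1 : N' c1 * (m - x) = 0 by lra.
have z2 : N' c2 * (y - m) = 0 by lra.
have c1E : c1 = (k.-1)%:R^-1.
  apply/eqP; apply: contraT => /s1 h; move/eqP: z1.
  by rewrite mulf_eq0 lt_eqF//= subr_eq0 gt_eqF.
have c2E : c2 = (k.-1)%:R^-1.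
  apply/eqP; apply: contraT => /s2 h; move/eqP: z2.
  by rewrite mulf_eq0 lt_eqF//= subr_eq0 gt_eqF.
by have := lt_trans c1m mc2; rewrite c1E c2E ltxx.
Qed.

End TwoCycles.

Section RegularTree.
Variable R : realType.
Implicit Types (l : R) (k d : nat).

Definition ctree k : ptree := fun=> k.

Lemma prod_ctree (F : ptree -> R) k :
  \prod_(c < ctree k [::]) F (subt c (ctree k)) = F (ctree k) ^+ k.
Proof.
by transitivity (\prod_(c < k) F (ctree k)) => //; rewrite big_const_ord iter_mulr_1.
Qed.

Lemma hbar_ctree l k b : 0 <= l -> hbar l b (ctree k) =
  (fun x => x / (1 + x)) (l * (1 - hbar l (~~ b) (ctree k)) ^+ k).
Proof. by move=> l0; rewrite hbar_rec//= (prod_ctree (fun T => 1 - hbar l (~~ b) T)). Qed.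

(** [x] and [y] are the odds of the two extreme messages, which the recursion exchanges. *)
Lemma ctree_two_cycle l k : 0 < l -> h0 l (ctree k) != h1 l (ctree k) ->
  exists x y, [/\ 0 < x, x < y, x * (1 + y) ^+ k = l & y * (1 + x) ^+ k = l].
Proof.
move=> l0 ne; have l0' := ltW l0.
pose a := h0 l (ctree k); pose b := h1 l (ctree k).
have a1 : 0 < 1 - a by rewrite subr_gt0; exact: hbar_lt1.
have b1 : 0 < 1 - b by rewrite subr_gt0; exact: hbar_lt1.
have ab : a < b by rewrite lt_neqAle ne; exact: hbar_le.
pose x := l * (1 - b) ^+ k; pose y := l * (1 - a) ^+ k.
have x0 : 0 < x by rewrite mulr_gt0// exprn_gt0.
have y0 : 0 < y by rewrite mulr_gt0// exprn_gt0.
have ea : a = x / (1 + x) by exact: hbar_ctree.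
have eb : b = y / (1 + y) by exact: hbar_ctree.
have x1 : 1 + x != 0 by rewrite gt_eqF// addr_gt0.
have y1 : 1 + y != 0 by rewrite gt_eqF// addr_gt0.
have ha : (1 - a) * (1 + x) = 1 by rewrite ea; field.
have hb : (1 - b) * (1 + y) = 1 by rewrite eb; field.
exists x, y; split => //.
- rewrite ltNge; apply/negP => yx; move: ab; rewrite ltNge; apply/negP/negPn.
  by rewrite ea eb ler_odds// ltW.
- by rewrite /x -mulrA -exprMn hb expr1n mulr1.
- by rewrite /y -mulrA -exprMn ha expr1n mulr1.
Qed.

(* The interval [x, y] is mapped outside itself, which keeps the two boundary
   conditions apart. *)
Lemma ctree_nonunique l k x y : 0 < l -> (0 < k)%N -> 0 <= x -> x < y -> y <= l ->
  l <= x * (1 + y) ^+ k -> y * (1 + x) ^+ k <= l ->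
  h0 l (ctree k) != h1 l (ctree k).
Proof.
move=> l0 k0 x0 xy yl hx hy; have l0' := ltW l0; have y0 := le_lt_trans x0 xy.
have key t : bd l false t (ctree k) <= x /\ y <= bd l true t (ctree k).
  elim: t => [|t [IH1 IH2]]; first by rewrite /= /ctree (gtn_eqF k0).
  have f0 := bd_ge0 l0' false t (ctree k).
  have f1 : 0 < 1 + bd l false t (ctree k) by rewrite ltr_wpDr.
  have t1 : 0 < 1 + bd l true t (ctree k) by rewrite ltr_wpDr// (le_trans (ltW y0)).
  rewrite /= (prod_ctree (fun T => (1 + bd l true t T)^-1)).
  rewrite (prod_ctree (fun T => (1 + bd l false t T)^-1)) !exprVn; split.
    rewrite ler_pdivrMr ?exprn_gt0//; apply: le_trans hx _; rewrite ler_wpM2l//.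
    apply: lerXn2r; rewrite ?nnegrE ?lerD2l//; last exact: ltW.
    by rewrite addr_ge0// ltW.
  rewrite ler_pdivlMr ?exprn_gt0//; apply: le_trans hy; rewrite ler_wpM2l ?(ltW y0)//.
  apply: lerXn2r; rewrite ?nnegrE ?lerD2l//; first exact: ltW.
  by rewrite addr_ge0.
rewrite /h0 /h1 lt_eqF//; apply: le_lt_trans (_ : x / (1 + x) < _).
  rewrite -(cvg_lim (@Rhausdorff R) (@cvg_hb _ l l0' false (ctree k))); apply: limr_le.
    exact: is_cvg_hb.
  by apply: nearW => t; apply: ler_odds; [exact: bd_ge0|case: (key t)].
apply: lt_le_trans (_ : y / (1 + y) <= _).
  rewrite ltr_pdivrMr ?ltr_wpDr// mulrAC ltr_pdivlMr ?addr_gt0//.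
  by rewrite !mulrDr !mulr1 mulrC ltrD2r.
rewrite -(cvg_lim (@Rhausdorff R) (@cvg_hb _ l l0' true (ctree k))); apply: limr_ge.
  exact: is_cvg_hb.
by apply: nearW => t; apply: ler_odds; [exact: ltW|case: (key t)].
Qed.

(** The witness [l'] lies strictly below [l], as needed to contradict uniqueness below [l]. The
    point [x] is the fixed point at criticality, and [y] its image under the recursion at [l']. *)
Lemma ctree_above_crit l k : (1 < k)%N -> crit_fug R k < l ->
  exists2 l', l' < l & 0 < l' /\ h0 l' (ctree k) != h1 l' (ctree k).
Proof.
move=> k1 cl; pose x := (k.-1)%:R^-1 : R.
have k1' : 0 < (k.-1)%:R :> R by rewrite ltr0n -ltnS prednK// ltnW.
have x0 : 0 < x by rewrite invr_gt0.
have X0 : 0 < (1 + x) ^+ k by rewrite exprn_gt0// addr_gt0.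
have c0 : 0 < crit_fug R k by rewrite /crit_fug -/x mulr_gt0.
pose l' := (crit_fug R k + l) / 2.
have [cl' l'l] : crit_fug R k < l' /\ l' < l by rewrite /l'; split; lra.
have l'0 : 0 < l' by exact: lt_trans cl'.
pose y := l' / (1 + x) ^+ k.
have yE : y * (1 + x) ^+ k = l' by rewrite /y divfK// gt_eqF.
have xy : x < y by rewrite /y ltr_pdivlMr.
exists l' => //; split => //; apply: (@ctree_nonunique l' k x y) => //.
- exact: ltnW.
- exact: ltW.
- rewrite -[leRHS]yE ler_peMr ?(ltW (lt_trans x0 xy))//.
  by rewrite exprn_ege1// lerDl ltW.
- rewrite -yE.
  have X1 : 1 + x != 0 by rewrite gt_eqF// addr_gt0.
  (* Bernoulli's inequality gives exactly [y], since [k * x / (1 + x) = 1]: this is slope -1 at the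
     critical fixed point. *)
  have e : 1 + y = (1 + x) * (1 + (y - x) / (1 + x)) by field.
  have u1 : -1 <= (y - x) / (1 + x).
    by apply: le_trans (_ : 0 <= _); rewrite ?lerN10// divr_ge0 ?subr_ge0 ?ltW// addr_gt0.
  rewrite e exprMn mulrCA [y * _]mulrC ler_wpM2l ?(ltW X0)//.
  apply: le_trans (ler_wpM2l (ltW x0) (bernoulli k u1)).
  have -> : x * (1 + k%:R * ((y - x) / (1 + x))) = y; last by [].
  have kE : k%:R = (k.-1)%:R + 1 :> R by rewrite natr1 prednK// ltnW.
  rewrite kE /x; field.
  by rewrite !gt_eqF//= ltr_wpDr.
- by rewrite yE.
Qed.

(** Uniqueness below [l] forces [l <= crit_fug R k], and up to and including that value there is no
    2-cycle. For [k <= 1] a 2-cycle is excluded by direct computation. *)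
Lemma ctree_unique_at_threshold l k : 0 < l ->
  (forall l', 0 < l' -> l' < l -> h0 l' (ctree k) = h1 l' (ctree k)) ->
  h0 l (ctree k) = h1 l (ctree k).
Proof.
move=> l0 hU; apply/eqP/negPn/negP => /(ctree_two_cycle l0)[x [y [x0 xy ex ey]]].
case: (leqP k 1) => k1.
  move: k1 ex ey; rewrite leq_eqVlt ltnS leqn0 => /orP[] /eqP ->.
    rewrite !expr1 => ex ey; have : x = y by lra.
    by move=> e; rewrite e ltxx in xy.
  by rewrite !expr0 !mulr1 => ex ey; rewrite ex ey ltxx in xy.
have lc : l <= crit_fug R k.
  rewrite leNgt; apply/negP => /(ctree_above_crit k1)[l' l'l [l'0]].
  by rewrite (hU _ l'0 l'l) eqxx.
by have := no_two_cycle k1 l0 lc x0 (ltW xy) ex ey => e; rewrite e ltxx in xy.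
Qed.

Variables (P : forall n, graph n -> R) (mu : probability PT R) (d : nat).
Arguments P : clear implicits.
Hypotheses (H : lwc P mu)
  (mu_dirac : forall A : set PT, measurable A -> mu A = (\1_A (regtree d))%:E).

(** The point [regtree d] is a countable intersection of cylinders, hence measurable with measure
    one, although [Q] itself may fail to be measurable. *)
Lemma dirac_ae (Q : PT -> Prop) : Q (regtree d) -> \forall T \ae mu, Q T.
Proof.
move=> hQ; pose sd j : seq nat := odflt [::] (unpickle j).
have sdK s : sd (pickle s) = s by rewrite /sd pickleK.
pose N : set PT := ~` (\bigcap_j [set T : PT | [set a | a = regtree d (sd j)] (T (sd j))]).
have mN : measurable N.
  by apply: measurableC; apply: bigcapT_measurable => j; exact: measurable_cylinder.
exists N; split => //.
  by rewrite mu_dirac// indicE memNset// => h; apply: h.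
move=> T /= nQ h; apply: nQ; suff -> : T = regtree d by [].
apply/funext => s; have := h (pickle s) I; rewrite /= sdK; exact.
Qed.

Lemma ae_dirac (Q : PT -> Prop) : (\forall T \ae mu, Q T) -> Q (regtree d).
Proof.
move=> [N [mN N0 sN]]; apply: contrapT => nQ.
have : N (regtree d) by apply: sN.
move: N0; rewrite mu_dirac// => -[/eqP]; rewrite indicE pnatr_eq0 eqb0 => /negP h hN.
by apply: h; exact/mem_set.
Qed.

Lemma regtree_deg_gt0 : (0 < d)%N.
Proof.
have [_ _ _ h] := H; rewrite lt0n; apply/eqP => d0; move: h.
rewrite mu_dirac; last exact: (measurable_cylinder [::] [set k | k = 0%N]).
by rewrite indicE mem_set ?ltxx// /rdeg /regtree /=.
Qed.

(** Each child subtree of [regtree d] is [ctree d.-1]. Below [l] almost sure uniqueness under a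
    point mass is uniqueness on that tree; at [l] itself [ctree_unique_at_threshold] takes over. *)
Lemma regtree_unique l l' : 0 < l' -> l' <= l -> (l%:E <= lam_c mu)%E ->
  h0 l' (ctree d.-1) = h1 l' (ctree d.-1).
Proof.
move=> l0 + lc; have P_deg : (mu [set T : PT | rdeg T = 0%N] < 1)%E by have [] := H.
have below l1 : 0 < l1 -> l1 < l -> h0 l1 (ctree d.-1) = h1 l1 (ctree d.-1).
  move=> l10 l1l; have l1c : (l1%:E < lam_c mu)%E by apply: lt_le_trans lc; rewrite lte_fin.
  have := ae_dirac (below_lam_c_unique P_deg (ltW l10) (lexx l1) l1c).
  by move=> /(_ 0%N regtree_deg_gt0).
rewrite le_eqVlt => /predU1P[e|]; last exact: below.
by rewrite e in l0 *; apply: ctree_unique_at_threshold.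
Qed.

Lemma Star_regtree l : 0 < l -> (l%:E <= lam_c mu)%E ->
  cvgn (phin P l) /\
  ((limn (phin P l))%:E = Phi_mu mu l (h0 l) /\ (limn (phin P l))%:E = Phi_mu mu l (h1 l)).
Proof.
move=> l0 lc; apply: (Star_of_unique H l0) => l' l0' ll.
by apply: dirac_ae => j _; exact: regtree_unique ll lc.
Qed.

End RegularTree.

Unset Implicit Arguments.

Theorem mainTheorem4 (R : realType) (P : forall n, graph n -> R)
    (mu : probability PT R) :
  lwc P mu ->
  let lc := lam_c mu in
  (* property "star" at fugacity l *)
  let Star := fun l : R =>
    cvgn (phin P l) /\
    ((limn (phin P l))%:E = Phi_mu mu l (h0 l) /\
     (limn (phin P l))%:E = Phi_mu mu l (h1 l)) in
  (* total-variation hypothesis at l *)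
  let TVhyp := fun l : R =>
    forall l0 : R, 0 < l0 < l -> exists C : R,
      mu_up_ae mu (fun T => (total_variation l0 l (fun l' => h0 l' T) <= C%:E)%E) in
  (* (a) *)
  (forall l : R, 0 < l -> (l%:E < lc)%E -> TVhyp l -> Star l) /\
  (forall lcr : R, lc = lcr%:E ->
     (forall l : R, 0 < l -> l < lcr -> TVhyp l) ->
     cvgn (phin P lcr) /\
     (fun l => limn (phin P l)) @ within (fun x => 0 < x) (lcr^'-) -->
       limn (phin P lcr)) /\
  (* (b) *)
  (forall Delta : R,
     mu_up_ae mu (fun T => (branching_number R T <= (Delta - 1)%:E)%E) ->
     forall l : R, 0 < l -> (l%:E < lc)%E -> l * (Delta - 2) < 1 -> Star l) /\
  (* (c) *)
  (forall d : nat,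
     (forall A : set PT, measurable A -> mu A = (\1_A (regtree d))%:E) ->
     forall l : R, 0 < l -> (l%:E <= lc)%E -> Star l).
Proof.
move=> H lc Star TVhyp.
have hStar l : 0 < l -> (l%:E < lc)%E -> Star l by exact: Star_below_lam_c.
split; first by move=> l l0 llc _; exact: hStar.
split; last first.
  split; first by move=> Delta _ l l0 llc _; exact: hStar.
  by move=> d hmu l l0 llc; exact: Star_regtree H hmu l l0 llc.
move=> lcr lcE _; apply: (limn_phin_left_continuous H).
  by rewrite -lee_fin -lcE; exact: lam_c_ge0.
move=> l l0 llc; have [] // := hStar l l0 _.
by rewrite lcE lte_fin.
Qed.
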